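(* Let $n\ge 1$ and $k>0$. For every $X=(x_1,\dots,x_{n+1})\in\mathbb{R}^{n+1}$ and every $\lambda\in\mathfrak a^+$, $$E_k(X,\lambda)=c_{n,k}\,\frac{e^{x_{n+1}(\lambda_1+\dots+\lambda_{n+1})}}{\pi(\lambda)^{2k}}\int_{\lambda_{n+1}}^{\lambda_n}\cdots\int_{\lambda_2}^{\lambda_1}\sum_{w\in S_n}\epsilon(w)\,Q(\lambda,w\nu)\,\widetilde E_k(X',w\nu)\,e^{-x_{n+1}(\nu_1+\dots+\nu_n)}\,W_k(\lambda,\nu)\,d\nu_1\cdots d\nu_n,$$ where $X'=(x_1,\dots,x_n)$ and $c_{n,k}=\frac{(n+1)\Gamma((n+1)k)}{\Gamma(k)^{n+1}}$.
   Context: Root system of type $A_{d-1}$ on $\mathbb{R}^d$ (no normalization $\sum x_i=0$ is imposed): roots $e_i-e_j$ ($i\neq j$), positive roots $e_i-e_j$ ($i<j$), Weyl group $S_d$ acting by $(wX)_i=X_{w(i)}$; $(i,j)$ denotes the transposition exchanging coordinates $i$ and $j$. For a constant multiplicity $k>0$ the Dunkl operators are $T_j(k)f(\lambda)=\frac{\partial f}{\partial\lambda_j}(\lambda)+k\sum_{i\neq j}\frac{f(\lambda)-f((i,j)\lambda)}{\lambda_j-\lambda_i}$, $j=1,\dots,d$. The Dunkl kernel $E_k(X,Y)$ on $\mathbb{R}^d\times\mathbb{R}^d$ is, for fixed $X$, the unique real-analytic function of $Y$ with $T_j(k)$ (acting in $Y$) satisfying $T_jE_k(X,\cdot)=x_jE_k(X,\cdot)$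 for all $j$ and $E_k(X,0)=1$; it is symmetric in $(X,Y)$, satisfies $E_k(wX,wY)=E_k(X,Y)$ for $w\in S_d$, and extends holomorphically to $\mathbb{C}^d\times\mathbb{C}^d$. Here $E_k$ denotes the Dunkl kernel for $A_n$ on $\mathbb{R}^{n+1}$ and $\widetilde E_k$ the Dunkl kernel for $A_{n-1}$ on $\mathbb{R}^n$ (same $k$); for $n=1$, $\widetilde E_k(x,\nu)=e^{x\nu}$. $\mathfrak a^+=\{\lambda\in\mathbb{R}^{n+1}:\lambda_1>\lambda_2>\dots>\lambda_{n+1}\}$, $\pi(\lambda)=\prod_{1\le i<j\le n+1}(\lambda_i-\lambda_j)$, $\epsilon(w)$ is the sign of $w$, and $S_n$ acts on $\nu\in\mathbb{R}^n$ by $(w\nu)_i=\nu_{w(i)}$. $W_k(\lambda,\nu)=\Big(\prod_{r=1}^{n+1}\big[\prod_{s=r}^{n}(\lambda_r-\nu_s)\prod_{s=1}^{r-1}(\nu_s-\lambda_r)\big]\Big)^{k-1}$ (nonnegative base on the integration domain), and $Q(\lambda,\nu)=\prod_{r=1}^{n+1}\big[\prod_{s=r+1}^{n}(\lambda_r-\nu_s)\prod_{s=1}^{r-1}(\nu_s-\lambda_r)\big]=(-1)^{n(n+1)/2}\prod_{1\le i\le n+1,\,1\le j\le n,\, i\neq j}(\lambda_i-\nu_j)$. *)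

(* Defs.v *)
From HB Require Import structures.
From mathcomp Require Import all_boot all_order all_algebra all_fingroup.
From mathcomp Require Import all_classical all_reals all_analysis.
Set Implicit Arguments. Unset Strict Implicit. Unset Printing Implicit Defensive.
Import Order.TTheory GRing.Theory Num.Theory.
Import numFieldNormedType.Exports.
Local Open Scope classical_set_scope.
Local Open Scope ring_scope.

Section Defs.
Variable R : realType.

Definition monom d (y : 'rV[R]_d) (alpha : 'I_d -> nat) : R :=
  \prod_(i < d) (y 0 i) ^+ alpha i.

Definition real_analytic d (f : 'rV[R]_d -> R) : Prop :=
  forall a : 'rV[R]_d, exists r : R, 0 < r /\
    exists c : ('I_d -> nat) -> R,
      forall y : 'rV[R]_d, `|y - a| < r ->
        ((\esum_(alpha in [set: 'I_d -> nat]) (`|c alpha * monom (y - a) alpha|)%:E)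
           < +oo)%E /\
        (fun N : nat => \sum_(alpha : {ffun 'I_d -> 'I_N.+1})
            c (fun i => nat_of_ord (alpha i)) *
            monom (y - a) (fun i => nat_of_ord (alpha i))) @ \oo --> f y.

Definition swap_coord d (i j : 'I_d) (x : 'rV[R]_d) : 'rV[R]_d :=
  \row_l x 0 (tperm i j l).

Definition perm_act d (w : 'S_d) (x : 'rV[R]_d) : 'rV[R]_d :=
  \row_l x 0 (w l).

Definition e_ d (j : 'I_d) : 'rV[R]_d := delta_mx 0 j.

Definition dunkl d (k : R) (j : 'I_d) (f : 'rV[R]_d -> R) (x : 'rV[R]_d) : R :=
  'D_(e_ j) f x +
  k * \sum_(i < d | i != j) (f x - f (swap_coord i j x)) / (x 0 j - x 0 i).

Definition regular d (x : 'rV[R]_d) : Prop :=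
  forall i j : 'I_d, i != j -> x 0 i != x 0 j.

(* E is the Dunkl kernel of A_{d-1} on R^d with multiplicity k:
   for every X, E X is real analytic, solves T_j E(X,.) = x_j E(X,.)
   (at the regular points, where the formula for T_j is literally defined;
   by continuity this is the defining system), and E(X,0) = 1. *)
Definition is_dunkl_kernel d (k : R) (E : 'rV[R]_d -> 'rV[R]_d -> R) : Prop :=
  forall X : 'rV[R]_d,
    [/\ real_analytic (E X),
        (forall (j : 'I_d) (y : 'rV[R]_d), regular y ->
            dunkl k j (E X) y = X 0 j * E X y)
      & E X 0 = 1].

Definition Gamma (s : R) : R :=
  Rintegral (@lebesgue_measure R) `]0%R, +oo[
    (fun t => powR t (s - 1) * expR (- t)).

Fixpoint iter_integral (m : nat) (a b : nat -> R) (F : (nat -> R) -> R) : R :=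
  match m with
  | 0 => F (fun _ => 0)
  | m'.+1 => Rintegral (@lebesgue_measure R) `[a m', b m']
      (fun t => iter_integral m' a b (fun v => F (fun i => if i == m' then t else v i)))
  end.

Definition chamber n (lam : 'rV[R]_n.+1) : Prop :=
  forall i j : 'I_n.+1, (i < j)%N -> lam 0 j < lam 0 i.

Definition pi_poly n (lam : 'rV[R]_n.+1) : R :=
  \prod_(i < n.+1) \prod_(j < n.+1 | (i < j)%N) (lam 0 i - lam 0 j).

Definition W_base n (lam : 'rV[R]_n.+1) (nu : 'rV[R]_n) : R :=
  \prod_(r < n.+1)
    ((\prod_(s < n | (r <= s)%N) (lam 0 r - nu 0 s)) *
     (\prod_(s < n | (s < r)%N) (nu 0 s - lam 0 r))).

Definition W_k n (k : R) (lam : 'rV[R]_n.+1) (nu : 'rV[R]_n) : R :=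
  powR (W_base lam nu) (k - 1).

Definition Q_poly n (lam : 'rV[R]_n.+1) (nu : 'rV[R]_n) : R :=
  \prod_(r < n.+1)
    ((\prod_(s < n | (r < s)%N) (lam 0 r - nu 0 s)) *
     (\prod_(s < n | (s < r)%N) (nu 0 s - lam 0 r))).

Definition c_const (n : nat) (k : R) : R :=
  (n.+1)%:R * Gamma (n.+1%:R * k) / (Gamma k) ^+ n.+1.

End Defs.

(* Main.v *)
Require Import Defs.
From HB Require Import structures.
From mathcomp Require Import all_boot all_order all_algebra all_fingroup.
From mathcomp Require Import all_classical all_reals all_analysis.
From mathcomp Require Import measurable_realfun.
From mathcomp Require Import ring lra.
Set Implicit Arguments. Unset Strict Implicit. Unset Printing Implicit Defensive.
Import Order.TTheory GRing.Theory Num.Theory.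
Import numFieldNormedType.Exports.
Local Open Scope classical_set_scope.
Local Open Scope ring_scope.

(** Fix a Weyl chamber point [lam] and restrict to the rays [t -> t * w lam], [w] in [S_(n+1)].
By Euler's formula, contracting the Dunkl system with the position vector turns it into the
linear system of singular ODEs
  t u_w'(t) = - (k/2) sum_(i != j) (u_w(t) - u_((i,j)w)(t)) + t <X, w lam> u_w(t),
whose reflection part is dissipative for [sum_w u_w^2]; so, by Gronwall, a solution vanishing
at [t = 0] vanishes. It remains to see that the right-hand side, with [lam] replaced by
[t * w lam], solves the same system. After rescaling [nu] the interlacing domain and the
weight do not depend on [t], and the difference of the two sides of the system is the integral
of a divergence: the terms [div_term] below. The rational identity behind this is
[dunkl_rational_identity].

At [t = 0] the integral reduces, by a Vandermonde computation, to the Dixon-Anderson integral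
of [prod_(i<j) (nu_i - nu_j)] against the weight. As a function of [k] that integral is
log-convex and satisfies an explicit recursion [k -> k + 1]; its closed form in terms of
[Gamma] then follows as in the Bohr-Mollerup theorem. *)

(** * Weighted iterated integrals *)

(** The formula is given on the chamber only, so a candidate value at [t * w lam] has to be chosen:
    box and weight stay those of [lam], and only [Q] sees the permuted nodes, with the sign
    [(-1) ^+ w]. Under [nu = t * v] all powers of [t] cancel against [pi_poly] to the [2k], because
    [n^2 + n(n+1)(k-1) + n = n(n+1)k]; [t] survives in the smaller kernel and the exponentials
    alone. The factor [exp(- x_(n+1) * sum nu)] is symmetric in [nu], so it commutes with
    reflections and merely shifts each spectral parameter [x_j] to [x_j - x_(n+1)]. For [k < 1] the
    weight is singular at the nodes. Integrals are therefore taken of continuous functions against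
    weights that are merely integrable on open intervals, and the weight is differentiated only
    after multiplication by [node_poly], which vanishes at every node and so removes both the
    singularity and the boundary terms. For the same reason log-convexity in [k] is claimed on
    [[1, +oo)] only, where the weight is a continuous function; the recursion in [k] carries the
    comparison down to [(0, 1)]. *)

Section OneDim.
Variable R : realType.
Local Notation mu := (@lebesgue_measure R).

(** Here [f] may be unbounded at both ends. The difference of [F] and the running integral of [f]
    has zero derivative inside, so it is constant by the mean value theorem; its limits at the two
    ends are then compared. *)
Lemma FTC_open (a b A B : R) (f F : R -> R) : a < b ->
  mu.-integrable `[a, b] (EFin \o f) ->
  (forall x, a < x < b -> {for x, continuous f}) ->
  (forall x, a < x < b -> is_derive x 1 F (f x)) ->
  F x @[x --> a^'+] --> A -> F x @[x --> b^'-] --> B ->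
  Rintegral mu `[a, b] f = B - A.
Proof.
move=> ab intf cf dF FA FB.
pose G x := Rintegral mu `[a, x] f.
have dG x : a < x < b -> is_derive x 1 G (f x).
  move=> /[dup] axb /andP[ax xb].
  have [dG1 eG] := continuous_FTC1_closed xb intf ax (cf _ axb).
  exact: (DeriveDef dG1 (etrans (esym (derive1E _ _)) eG)).
pose H x := F x - G x.
have dH x : a < x < b -> is_derive x 1 H 0.
  move=> axb; rewrite -(subrr (f x)).
  by apply: is_deriveB; [exact: dF|exact: dG].

have cstH x y : a < x -> x < y -> y < b -> H x = H y.
  move=> ax xy yb.
  have dH' z : z \in `[x, y]%R -> is_derive z 1 H 0.
    by rewrite in_itv/= => /andP[xz zy]; apply: dH; rewrite (lt_le_trans ax xz) (le_lt_trans zy yb).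
  have dHo z : z \in `]x, y[%R -> is_derive z 1 H 0.
    by rewrite in_itv/= => /andP[xz zy]; apply: dH'; rewrite in_itv/= !ltW.
  have cH : {within `[x, y], continuous H}.
    by apply: derivable_within_continuous => z /dH'[].
  have [c _] := MVT xy dHo cH.
  by rewrite mul0r => /eqP; rewrite subr_eq0 => /eqP.
pose m := (a + b) / 2.
have am : a < m by rewrite /m; lra.
have mb : m < b by rewrite /m; lra.
have HE x : a < x < b -> H x = H m.
  move=> /andP[ax xb]; have [xm|mx|->//] := ltgtP x m.
  - exact: cstH.
  - by rewrite (cstH m x).
have GA : G x @[x --> a^'+] --> 0.
  apply: cvg_at_right_filter; exact: (parameterized_integral_cvg_left ab intf).
have GB : G x @[x --> b^'-] --> G b.
  exact: (parameterized_integral_cvg_at_left ab intf).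
have FGA : H x @[x --> a^'+] --> A - 0 by apply: cvgB.
have FGB : H x @[x --> b^'-] --> B - G b by apply: cvgB.
have HmA : H x @[x --> a^'+] --> H m.
  apply: cvg_near_cst.
  near=> x; rewrite HE//; apply/andP; split=> //; near: x; exact: nbhs_right_lt.
have HmB : H x @[x --> b^'-] --> H m.
  apply: cvg_near_cst.
  near=> x; rewrite HE//; apply/andP; split=> //; near: x; exact: nbhs_left_gt.
have e1 : A - 0 = H m by apply: (cvg_unique _ FGA HmA).
have e2 : B - G b = H m by apply: (cvg_unique _ FGB HmB).
by rewrite -/(G b); move: e1 e2; lra.
Unshelve. all: by end_near. Qed.

(** On an inner closed interval the integral is a difference of two values of [F], hence at most
    [2 * M]; monotone convergence along an exhaustion by such intervals keeps this bound. *)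
Lemma ge0_derive_integrable (a b M : R) (f F : R -> R) : a < b ->
  (forall x, a < x < b -> 0 <= f x) ->
  (forall x, a < x < b -> {for x, continuous f}) ->
  (forall x, a < x < b -> is_derive x 1 F (f x)) ->
  (forall x, a < x < b -> `|F x| <= M) ->
  mu.-integrable `]a, b[ (EFin \o f).
Proof.
move=> ab f0 cf dF FM.
have mf : measurable_fun `]a, b[ f.
  by apply: open_continuous_measurable_fun => // x; rewrite inE/= in_itv/=; exact: cf.
(* The denominator starts at 3 so that [2 * d n < b - a], that is, every exhausting interval is
   nondegenerate. *)
pose d (n : nat) : R := (b - a) / n.+3%:R.
have d0 n : 0 < d n by rewrite divr_gt0 ?subr_gt0.
have d1 n : d n *+ 2 < b - a.
  rewrite -mulr_natr /d -mulrA gtr_pMr ?subr_gt0// mulrC ltr_pdivrMr// mul1r ltr_nat//.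
pose I (n : nat) : set R := `[a + d n, b - d n]%classic.
have Ioo n x : I n x -> a < x < b.
  rewrite /I/= in_itv/= => /andP[h1 h2]; have := d0 n; have := d1 n; lra.
have UI : \bigcup_n I n = `]a, b[%classic.
  apply/seteqP; split=> x /=.
    by move=> [n _ /Ioo]; rewrite in_itv.
  rewrite in_itv/= => /andP[ax xb].
  pose e := Num.min (x - a) (b - x).
  have e0 : 0 < e by rewrite /e lt_min !subr_gt0 ax xb.
  exists (Num.truncn ((b - a) / e)) => //.
  rewrite /I/= in_itv/=.
  suff de : d (Num.truncn ((b - a) / e)) <= e.
    move: (de); rewrite {2 4}/e le_min => /andP[]; lra.
  rewrite /d ler_pdivrMr// mulrC -ler_pdivrMr//.
  rewrite (le_trans (ltW (truncnS_gt _)))// ler_nat//.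
  by rewrite -[X in (X <= _)%N]addn0 -addn2 leq_add2l.
have ndI : nondecreasing_seq I.
  move=> m n mn; apply/subsetPset => x; rewrite /I/= !in_itv/= => /andP[h1 h2].
  have : d n <= d m by rewrite /d ler_pM2l ?subr_gt0// lef_pV2 ?posrE// ler_nat.
  lra.
apply/integrableP; split; first exact/measurable_EFinP.
have -> : (\int[mu]_(x in `]a, b[) `|(EFin \o f) x| = \int[mu]_(x in `]a, b[) (f x)%:E)%E.
  by apply: eq_integral => x; rewrite inE/= in_itv/= => xab; rewrite ger0_norm// f0.
rewrite -UI.
have mI n : measurable (I n) by exact: measurable_itv.
have mfI i : measurable_fun (I i) (EFin \o f).
  apply/measurable_EFinP; apply: measurable_funS mf => // x /Ioo; by rewrite /= in_itv.
have f0I i x : I i x -> (0 <= (EFin \o f) x)%E by move=> /Ioo/f0 h; rewrite /= lee_fin.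
have cv : (\int[mu]_(x in I i) (EFin \o f) x)%E @[i --> \oo] -->
    (\int[mu]_(x in \bigcup_i I i) (EFin \o f) x)%E.
  exact: ge0_nondecreasing_set_cvg_integral.
apply: (@le_lt_trans _ _ (2 * M)%:E); last by rewrite ltry.
rewrite -(cvg_lim _ cv)//.
apply: lime_le; first by apply/cvg_ex; eexists; exact: cv.
apply: nearW => n.
have an : a + d n < b - d n by have := d1 n; lra.
have cI : {within I n, continuous f}.
  apply: continuous_in_subspaceT => x; rewrite inE => /Ioo; exact: cf.
have intI : mu.-integrable (I n) (EFin \o f).
  by apply: continuous_compact_integrable => //; exact: segment_compact.
have dFn x : a + d n <= x <= b - d n -> is_derive x 1 F (f x).
  by move=> h; apply: dF; apply: (Ioo n); rewrite /I/= in_itv.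
have cF x : a + d n <= x <= b - d n -> {for x, continuous F}.
  move=> /dFn[h _]; apply: differentiable_continuous; exact/derivable1_diffP.
have e : Rintegral mu `[a + d n, b - d n] f = F (b - d n) - F (a + d n).
  apply: (FTC_open an intI).
  - by move=> x h; apply: cf; apply: (Ioo n); rewrite /I/= in_itv/=; move: h; lra.
  - by move=> x h; apply: dFn; lra.
  - by apply: cvg_at_right_filter; apply: cF; lra.
  - by apply: cvg_at_left_filter; apply: cF; lra.
have -> : (\int[mu]_(x in I n) (EFin \o f) x)%E = (F (b - d n) - F (a + d n))%:E.
  by rewrite -e /Rintegral fineK//; exact: integrable_fin_num.
rewrite lee_fin.
have := FM _ (Ioo n (a + d n) _); have := FM _ (Ioo n (b - d n) _).
rewrite /I/= !in_itv/= !lexx (ltW an)/= => /(_ isT) + /(_ isT).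
rewrite !ler_norml; lra.
Qed.

End OneDim.

(** * Topology of real row vectors, and rules for continuity and derivatives of explicit
    functions *)

Section RowTopology.
Variable R : realType.

Lemma coord_le_norm n (v : 'rV[R]_n) i : `|v 0 i| <= `|v|.
Proof.
rewrite [leRHS]/Num.Def.normr/= mx_normrE.
exact: (@le_bigmax _ _ _ _ (fun i : 'I_1 * 'I_n => `|v i.1 i.2|) (0, i)).
Qed.

Lemma rV_norm_le n (v : 'rV[R]_n) e : 0 <= e ->
  (forall i, `|v 0 i| <= e) -> `|v| <= e.
Proof.
move=> e0 h; rewrite [leLHS]/Num.Def.normr/= mx_normrE.
by apply: bigmax_le => // -[i j] _ /=; rewrite ord1.
Qed.

Lemma cvg_rV n (T : Type) (F : set_system T) (FF : Filter F) (f : T -> 'rV[R]_n) (l : 'rV[R]_n) :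
  (forall i, f x 0 i @[x --> F] --> l 0 i) -> f x @[x --> F] --> l.
Proof.
move=> h; apply/cvgrPdist_le => e e0.
have : \forall x \near F, forall i, `|(l 0 i - f x 0 i)| <= e.
  by apply: filter_forall => i; exact: (cvgrPdist_le _ _).1 (h i) e e0.
apply: filterS => x hx; apply: rV_norm_le; first exact: ltW.
by move=> i; rewrite !mxE; exact: hx.
Qed.

Lemma continuous_rV n (T : topologicalType) (f : T -> 'rV[R]_n) :
  (forall i, continuous (fun x => f x 0 i)) -> continuous f.
Proof. by move=> h x; apply: cvg_rV => i; exact: h. Qed.

Definition upd n (s : 'I_n) (t : R) (v : 'rV[R]_n) : 'rV[R]_n :=
  \row_i (if i == s then t else v 0 i).

Lemma upd_continuous n (s : 'I_n) (T : topologicalType) (f : T -> R) (g : T -> 'rV[R]_n) :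
  continuous f -> continuous g -> continuous (fun x => upd s (f x) (g x)).
Proof.
move=> cf cg; apply: continuous_rV => i.
have -> : (fun x => upd s (f x) (g x) 0 i) = if i == s then f else (fun x => g x 0 i).
  by apply/funext => x; rewrite mxE; case: ifP.
case: ifP => _; first exact: cf.
by move=> x; exact: (continuous_comp (cg x) (@coord_continuous _ _ _ 0 i _)).
Qed.

Lemma updC n (s s' : 'I_n) t t' v : s != s' ->
  upd s t (upd s' t' v) = upd s' t' (upd s t v).
Proof.
move=> ss'; apply/rowP => i; rewrite !mxE.
by have [->|//] := eqVneq i s; rewrite (negPf ss').
Qed.

Lemma updE n (s : 'I_n) t v : upd s t v 0 s = t.
Proof. by rewrite mxE eqxx. Qed.

Lemma updN n (s i : 'I_n) t v : i != s -> upd s t v 0 i = v 0 i.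
Proof. by move=> h; rewrite mxE (negPf h). Qed.

Lemma cont_pair (T U V : topologicalType) (f : T -> U) (g : T -> V) :
  continuous f -> continuous g -> continuous (fun x => (f x, g x)).
Proof. by move=> cf cg x; exact: (cvg_pair (cf x) (cg x)). Qed.

Lemma cont_comp (T U V : topologicalType) (f : T -> U) (g : U -> V) :
  continuous f -> continuous g -> continuous (fun x => g (f x)).
Proof. by move=> cf cg x; exact: (continuous_comp (cf x) (cg (f x))). Qed.

Lemma cont_id (T : topologicalType) : continuous (fun x : T => x).
Proof. by move=> x; exact: cvg_id. Qed.

Lemma cont_fst (T U V : topologicalType) (f : T -> U * V) :
  continuous f -> continuous (fun x => (f x).1).
Proof. by move=> cf; apply: (cont_comp cf) => x; exact: cvg_fst. Qed.

Lemma cont_snd (T U V : topologicalType) (f : T -> U * V) :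
  continuous f -> continuous (fun x => (f x).2).
Proof. by move=> cf; apply: (cont_comp cf) => x; exact: cvg_snd. Qed.

Lemma cont_dist (T : topologicalType) (f : T -> R) (x : T) :
  (forall e, 0 < e -> \forall y \near x, `|f x - f y| <= e) -> {for x, continuous f}.
Proof. by move=> H; apply/cvgrPdist_le. Qed.

Lemma contD (T : topologicalType) (f g : T -> R) :
  continuous f -> continuous g -> continuous (fun x => f x + g x).
Proof. by move=> cf cg x; apply: continuousD; [exact: cf|exact: cg]. Qed.

Lemma contB (T : topologicalType) (f g : T -> R) :
  continuous f -> continuous g -> continuous (fun x => f x - g x).
Proof. by move=> cf cg x; apply: continuousB; [exact: cf|exact: cg]. Qed.

Lemma contM (T : topologicalType) (f g : T -> R) :
  continuous f -> continuous g -> continuous (fun x => f x * g x).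
Proof. by move=> cf cg x; apply: continuousM; [exact: cf|exact: cg]. Qed.

Lemma contC (T : topologicalType) (c : R) : continuous (fun _ : T => c).
Proof. by move=> x; exact: cst_continuous. Qed.

(** Stating the remainder without a quotient allows [h = 0] and spares every later differentiation a
    division by [h]. *)
Lemma is_derive_le (V : normedModType R) (f : V -> R) (a v : V) (df : R) :
  (forall e, 0 < e -> \forall h \near (0 : R),
     `|f (h *: v + a) - f a - h * df| <= e * `|h|) ->
  is_derive a v f df.
Proof.
move=> H.
suff cv : h^-1 *: ((f \o shift a) (h *: v) - f a) @[h --> 0^'] --> df.
  apply: DeriveDef; first by apply/cvg_ex; eexists; exact: cv.
  exact: cvg_lim cv.
apply/cvgrPdist_le => e e0.
have := H e e0; rewrite near_withinE; apply: filterS => h hh h0.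
rewrite -(ler_pM2r (_ : 0 < `|h|)) ?normr_gt0//.
apply: le_trans hh; rewrite -normrM le_eqVlt; apply/orP; left; apply/eqP.
rewrite -[RHS]normrN; congr `|_|.
rewrite mulrBl opprB /= /GRing.scale/= mulrAC mulVf// mul1r opprB; ring.
Qed.

Section DeriveRules.
Variables (V : normedModType R) (a v : V).
Implicit Types (f g : V -> R).

Lemma derC (c : R) : is_derive a v (fun _ : V => c) 0.
Proof. exact: is_derive_cst. Qed.

Lemma derD f g (df dg : R) : is_derive a v f df -> is_derive a v g dg ->
  is_derive a v (fun x => f x + g x) (df + dg).
Proof. by move=> hf hg; exact: is_deriveD. Qed.

Lemma derM f g (df dg : R) : is_derive a v f df -> is_derive a v g dg ->
  is_derive a v (fun x => f x * g x) (df * g a + f a * dg).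
Proof.
move=> hf hg; have := is_deriveM hf hg => h.
by apply: (is_derive_eq h); rewrite /GRing.scale/=; ring.
Qed.

Lemma derZ (c : R) f (df : R) : is_derive a v f df ->
  is_derive a v (fun x => c * f x) (c * df).
Proof. by move=> hf; exact: is_deriveZ. Qed.

Lemma der_sum (I : Type) (r : seq I) (P : pred I) (f : I -> V -> R) (df : I -> R) :
  (forall i, P i -> is_derive a v (f i) (df i)) ->
  is_derive a v (fun x => \sum_(i <- r | P i) f i x) (\sum_(i <- r | P i) df i).
Proof.
move=> hf; elim: r => [|i r IH].
  by rewrite big_nil; under eq_fun do rewrite big_nil; exact: derC.
rewrite big_cons; case: (boolP (P i)) => [|/negPf] Pi.
  by under eq_fun do rewrite big_cons Pi; apply: derD => //; exact: hf.
by under eq_fun do rewrite big_cons Pi.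
Qed.

End DeriveRules.

Lemma der_comp (f g : R -> R) (x df dg : R) : is_derive (g x) (1 : R) f df ->
  is_derive x (1 : R) g dg -> is_derive x (1 : R) (fun t => f (g t)) (df * dg).
Proof. by move=> hf hg; exact: is_derive1_comp. Qed.

Lemma der_id (x : R) : is_derive x (1 : R) (fun t : R => t) 1.
Proof. exact: is_derive_id. Qed.

Lemma der_expR (g : R -> R) (x dg : R) : is_derive x (1 : R) g dg ->
  is_derive x (1 : R) (fun t => expR (g t)) (expR (g x) * dg).
Proof. by move=> hg; apply: der_comp => //; exact: is_derive_expR. Qed.

End RowTopology.

(** * One-variable integrals against an integrable weight *)

Section Wint.
Variable R : realType.
Local Notation mu := (@lebesgue_measure R).

(** Only the open interval matters: interlacing weights with exponent [k - 1 < 0] are unbounded near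
    the endpoints but still integrable. *)
Definition weight (a b : R) (w : R -> R) :=
  [/\ a < b, forall x, a < x < b -> 0 <= w x
    & mu.-integrable `]a, b[ (EFin \o w)].

Definition wint (a b : R) (w g : R -> R) : R :=
  Rintegral mu `]a, b[ (fun x => g x * w x).

Variables (a b : R) (w : R -> R).
Hypothesis wt : weight a b w.
Implicit Types g h : R -> R.
Let ab : a < b. Proof. by case: wt. Qed.

Lemma eq_wint g h : (forall x, a < x < b -> g x = h x) -> wint a b w g = wint a b w h.
Proof.
move=> gh; apply: eq_Rintegral => x; rewrite inE/= in_itv/= => xab.
by rewrite gh.
Qed.

Lemma continuous_itv_bounded g : continuous g ->
  exists M, forall x, a <= x <= b -> `|g x| <= M.
Proof.
move=> cg.
have cn : {within `[a, b], continuous (fun x => `|g x|)}.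
  by apply: continuous_subspaceT => x; apply: continuous_comp; [exact: cg|exact: norm_continuous].
have [c cab hc] := EVT_max (ltW ab) cn.
by exists `|g c| => x xab; apply: hc; rewrite in_itv.
Qed.

Lemma wint_integrable g : continuous g ->
  mu.-integrable `]a, b[ (EFin \o (fun x => g x * w x)).
Proof.
move=> cg; have [_ _ iw] := wt.
have [M hM] := continuous_itv_bounded cg.
have -> : EFin \o (fun x => g x * w x) = ((EFin \o g) \* (EFin \o w))%E.
  by apply/funext => x /=; rewrite EFinM.
apply: integrableMr => //.
- apply: measurable_funTS; exact: continuous_measurable_fun.
- exists M; split; first exact: num_real.
  move=> N MN x /=; rewrite in_itv/= => /andP[ax xb].
  by apply: (le_trans _ (ltW MN)); apply: hM; rewrite !ltW.
Qed.

Lemma wintD g h : continuous g -> continuous h ->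
  wint a b w (fun x => g x + h x) = wint a b w g + wint a b w h.
Proof.
move=> cg ch; rewrite /wint -RintegralD//; try exact: wint_integrable.
by apply: eq_Rintegral => x _; rewrite mulrDl.
Qed.

Lemma wintZ c g : continuous g -> wint a b w (fun x => c * g x) = c * wint a b w g.
Proof.
move=> cg; rewrite /wint -RintegralZl//; try exact: wint_integrable.
by apply: eq_Rintegral => x _; rewrite mulrA.
Qed.

Lemma wint0 : wint a b w (fun=> 0) = 0.
Proof.
rewrite /wint (@eq_Rintegral _ _ _ _ _ (fun=> 0)).
  by rewrite Rintegral_cst// mul0r.
by move=> x _; rewrite mul0r.
Qed.

Lemma wintB g h : continuous g -> continuous h ->
  wint a b w (fun x => g x - h x) = wint a b w g - wint a b w h.
Proof.
move=> cg ch; rewrite -[X in _ = _ + X]mulN1r -wintZ// -wintD//.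
  by apply: eq_wint => x _; rewrite mulN1r.
by move=> x; apply: (@continuousM _ _ (cst (-1))); [exact: cst_continuous|exact: ch].
Qed.

Lemma le_wint g h : continuous g -> continuous h ->
  (forall x, a < x < b -> g x <= h x) -> wint a b w g <= wint a b w h.
Proof.
move=> cg ch gh; apply: le_Rintegral => //; try exact: wint_integrable.
move=> x /=; rewrite in_itv/= => xab; apply: ler_wpM2r; last exact: gh.
by have [_ + _] := wt; apply.
Qed.

Lemma wint_norm_le g M : continuous g ->
  (forall x, a < x < b -> `|g x| <= M) -> `|wint a b w g| <= M * wint a b w (fun=> 1).
Proof.
move=> cg gM.
have c1 : continuous (fun _ : R => 1 : R) by move=> x; exact: cst_continuous.
have cM (N : R) : continuous (fun _ : R => N * 1 : R) by move=> x; exact: cst_continuous.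
rewrite ler_norml -mulNr -!wintZ//; apply/andP; split; apply: le_wint => // x /gM;
  by rewrite mulr1 ler_norml => /andP[].
Qed.

Lemma wint_ge0 g : (forall x, a < x < b -> 0 <= g x) -> 0 <= wint a b w g.
Proof.
move=> g0; apply: Rintegral_ge0 => x /=; rewrite in_itv/= => xab.
by apply: mulr_ge0; [exact: g0|have [_ + _] := wt; exact].
Qed.

(** Compactness of the segment makes continuity in the parameter uniform in the integration
    variable. Together with the finite mass of the weight this replaces dominated convergence
    below. *)
Lemma tube (T : topologicalType) (G : T -> R -> R) :
  continuous (fun p : T * R => G p.1 p.2) ->
  forall x0 e, 0 < e -> \forall x \near x0, forall t, a <= t <= b -> `|G x t - G x0 t| <= e.
Proof.
move=> cG x0 e e0.
have /compact_near_coveringP/(_ T (nbhs x0) (fun x t => `|G x t - G x0 t| <= e) _) :=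
  @segment_compact R a b.
move=> H; near=> x => t tab.
have : `[a, b]%classic `<=` (fun t => `|G x t - G x0 t| <= e).
  near: x; apply: H => {}t _.
  have e20 : 0 < e / 2 by rewrite divr_gt0.
  have h1 := (cvgrPdist_le _ _).1 (cG (x0, t)) _ e20.
  have h2 : \forall s \near t, `|G x0 t - G x0 s| <= e / 2.
    have ct : continuous (fun s => G x0 s).
      move=> s; apply: (@continuous_comp _ _ _ (fun s => (x0, s)) (fun p => G p.1 p.2)); last exact: cG.
      exact: (cvg_pair (cvg_cst _) cvg_id).
    exact: (cvgrPdist_le _ _).1 (ct t) _ e20.
  case: h1 => -[U V] /= [Ux Vt] UV.
  exists ((V `&` [set s | `|G x0 t - G x0 s| <= e / 2]), U) => /=; first by split=> //; exact: filterI.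
  move=> [s x] /= [[Vs h]] Ux'.
  have := UV (x, s) (conj Ux' Vs) => /= h'.
  have -> : G x s - G x0 s = (G x0 t - G x0 s) - (G x0 t - G x s) by ring.
  by rewrite (le_trans (ler_normB _ _))// (splitr e) lerD.
by apply; rewrite /= in_itv.
Unshelve. all: by end_near. Qed.

Lemma section_continuous (T : topologicalType) (G : T -> R -> R) x :
  continuous (fun p : T * R => G p.1 p.2) -> continuous (G x).
Proof.
move=> cG s; apply: (@continuous_comp _ _ _ (fun s => (x, s)) (fun p => G p.1 p.2)); last exact: cG.
exact: (cvg_pair (cvg_cst _) cvg_id).
Qed.

Lemma wint_continuous (T : topologicalType) (G : T -> R -> R) :
  continuous (fun p : T * R => G p.1 p.2) -> continuous (fun x => wint a b w (G x)).
Proof.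
move=> cG x0; apply/cvgrPdist_le => e e0.
have W0 : 0 <= wint a b w (fun=> 1) by apply: wint_ge0.
pose d := e / (wint a b w (fun=> 1) + 1).
have d0 : 0 < d by rewrite divr_gt0// ltr_wpDl.
have := tube cG x0 d0; apply: filterS => x hx.
have cx y : continuous (G y) by exact: section_continuous.
rewrite -wintB//; apply: le_trans (_ : d * wint a b w (fun=> 1) <= e).
  apply: wint_norm_le.
    by move=> s; apply: continuousB; exact: cx.
  by move=> t /andP[at_ tb]; rewrite distrC; apply: hx; rewrite !ltW.
by rewrite /d mulrAC ler_pdivrMr ?ltr_wpDl// ler_pM2l// lerDl.
Qed.

(** The mean value theorem turns the increment of [F] into [F'] at an intermediate parameter, and
    [tube] makes this close to [F' t] uniformly in the integration variable. *)
Lemma wint_derive (F F' : R -> R -> R) :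
  (forall t r : R, is_derive t (1 : R) (F ^~ r) (F' t r)) ->
  (forall t, continuous (F t)) ->
  continuous (fun p : R * R => F' p.1 p.2) ->
  forall t : R, is_derive t (1 : R) (fun t => wint a b w (F t)) (wint a b w (F' t)).
Proof.
move=> dF cF cF' t; apply: is_derive_le => e e0.
have W0 : 0 <= wint a b w (fun=> 1) by apply: wint_ge0.
pose d := e / (wint a b w (fun=> 1) + 1).
have d0 : 0 < d by rewrite divr_gt0// ltr_wpDl.
have /nbhs_ballP[/= r r0 hr] := tube cF' t d0.
near=> h.
have hr1 : `|h| < r.
  by near: h; apply/nbhs_ballP; exists r => // h; rewrite -ball_normE/= sub0r normrN.
have cF't : continuous (F' t) by exact: section_continuous.
have cl g c : continuous g -> continuous (fun x : R => c * g x).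
  by move=> cg x; apply: (@continuousM _ _ (cst c)); [exact: cst_continuous|exact: cg].
rewrite -wintZ// -!wintB//; last 2 first.
- by move=> x; apply: continuousB; exact: cF.
- exact: cl.
apply: le_trans (_ : (d * `|h|) * wint a b w (fun=> 1) <= _); last first.
  rewrite mulrAC ler_wpM2r// /d mulrAC ler_pdivrMr ?ltr_wpDl// ler_pM2l// lerDl//.
apply: wint_norm_le.
  by apply: contB; [apply: contB; exact: cF|exact: cl].
move=> x /andP[ax xb].
have key c : `|c - t| < r -> `|F' c x - F' t x| <= d.
  move=> hc; apply: hr; last by rewrite !ltW.
  by rewrite -ball_normE/= distrC.
have cFx : continuous (F ^~ x).
  by move=> s; apply: differentiable_continuous; apply/derivable1_diffP; have [] := dF s x.
have mvt u v : u < v -> exists2 c, u < c < v & F v x - F u x = F' c x * (v - u).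
  move=> uv; have cuv := @continuous_subspaceT _ _ `[u, v]%classic _ cFx.
  have [c] := MVT uv (fun s _ => dF s x) cuv.
  by rewrite in_itv/=; exists c.
rewrite /= [_ *: 1]mulr1.
have [h0|h0|->] := ltgtP h 0.
- have [|c /andP[c1 c2] e1] := mvt (h + t) t; first by rewrite gtrDr.
  have -> : F (h + t) x - F t x - h * F' t x = h * (F' c x - F' t x).
    by move: e1 => /(congr1 -%R); rewrite opprB => ->; ring.
  rewrite normrM mulrC ler_wpM2r// key//; move: hr1; rewrite !ltr0_norm//; lra.
- have [|c /andP[c1 c2] e1] := mvt t (h + t); first by rewrite ltrDr.
  have -> : F (h + t) x - F t x - h * F' t x = h * (F' c x - F' t x).
    by rewrite e1; ring.
  rewrite normrM mulrC ler_wpM2r// key//; move: hr1; rewrite !gtr0_norm//; lra.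
- by rewrite add0r subrr mul0r subr0 normr0 mulr_ge0// ltW.
Unshelve. all: by end_near. Qed.

End Wint.

(** * Iterated weighted integrals over a list of coordinates *)

Section Iterated.
Variables (R : realType) (n : nat).
Variables (a b : 'I_n -> R) (w : 'I_n -> R -> R).
Hypothesis wt : forall s, weight (a s) (b s) (w s).
Implicit Types (F G : 'rV[R]_n -> R) (l : seq 'I_n) (s : 'I_n).

Definition slice s F (v : 'rV[R]_n) : R :=
  wint (a s) (b s) (w s) (fun t => F (upd s t v)).

(** The head of [l] is the outermost variable, and coordinates outside [l] keep the values they have
    in the argument. Each partial integral is thus again a function on the whole row space, so that
    the one-variable lemmas iterate by induction on [l]. *)
Definition iterint l F := foldr slice F l.

Lemma upd_line_continuous s v : continuous (fun t : R => upd s t v).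
Proof. by apply: upd_continuous; [exact: cont_id|move=> x; exact: cst_continuous]. Qed.

Lemma comp_upd_continuous F s v : continuous F -> continuous (fun t => F (upd s t v)).
Proof. exact/cont_comp/upd_line_continuous. Qed.

(** Joint continuity in an external parameter and in all coordinates is the property that survives
    one integration; it is the induction invariant for continuity and for differentiation under the
    integral. *)
Lemma slice_continuousP (T : topologicalType) (F : T -> 'rV[R]_n -> R) s :
  continuous (fun p : T * 'rV[R]_n => F p.1 p.2) ->
  continuous (fun p : T * 'rV[R]_n => slice s (F p.1) p.2).
Proof.
move=> cF.
apply: (wint_continuous (wt s) (G := fun (p : T * 'rV[R]_n) t => F p.1 (upd s t p.2))).
pose g (q : (T * 'rV[R]_n) * R) := (q.1.1, upd s q.2 q.1.2).
have cg : continuous g.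
  apply: cont_pair; first by do 2 apply: cont_fst; exact: cont_id.
  apply: upd_continuous; first by apply: cont_snd; exact: cont_id.
  by apply: cont_snd; apply: cont_fst; exact: cont_id.
exact: (cont_comp cg cF).
Qed.

Lemma iterint_continuousP (T : topologicalType) (F : T -> 'rV[R]_n -> R) l :
  continuous (fun p : T * 'rV[R]_n => F p.1 p.2) ->
  continuous (fun p : T * 'rV[R]_n => iterint l (F p.1) p.2).
Proof. by move=> cF; elim: l => //= s l; exact: (slice_continuousP (F := fun x => iterint l (F x))). Qed.

Lemma iterint_continuous F l : continuous F -> continuous (iterint l F).
Proof.
move=> cF.
have cF' : continuous (fun p : R * 'rV[R]_n => F p.2).
  by apply: cont_comp cF; apply: cont_snd; exact: cont_id.
have c0 : continuous (fun v : 'rV[R]_n => (0 : R, v)).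
  by apply: cont_pair; [exact: contC|exact: cont_id].
have h : continuous (fun p : R * 'rV[R]_n => iterint l F p.2).
  exact: (iterint_continuousP (F := fun=> F)).
have := cont_comp c0 h.
by [].
Qed.

Lemma iterint_line_continuous F l s v : continuous F ->
  continuous (fun t => iterint l F (upd s t v)).
Proof. by move=> cF; apply: comp_upd_continuous; exact: iterint_continuous. Qed.

Lemma iterintD F G l v : continuous F -> continuous G ->
  iterint l (fun v => F v + G v) v = iterint l F v + iterint l G v.
Proof.
move=> cF cG; elim: l v => //= s l IH v.
rewrite /slice -wintD//; try exact: iterint_line_continuous.
by apply: eq_wint => t _; exact: IH.
Qed.

Lemma iterintZ c F l v : continuous F ->
  iterint l (fun v => c * F v) v = c * iterint l F v.
Proof.
move=> cF; elim: l v => //= s l IH v.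
rewrite /slice -wintZ//; try exact: iterint_line_continuous.
by apply: eq_wint => t _; exact: IH.
Qed.

Lemma iterint0 l v : iterint l (fun=> 0) v = 0.
Proof.
elim: l v => //= s l IH v; rewrite /slice -[RHS](wint0 (a s) (b s) (w s)).
by apply: eq_wint => t _; exact: IH.
Qed.

Lemma iterintB F G l v : continuous F -> continuous G ->
  iterint l (fun v => F v - G v) v = iterint l F v - iterint l G v.
Proof.
move=> cF cG; elim: l v => //= s l IH v.
rewrite /slice -wintB//; try exact: iterint_line_continuous.
by apply: eq_wint => t _; exact: IH.
Qed.

Lemma cont_sum (T : topologicalType) (I : Type) (r : seq I) (P : pred I) (F : I -> T -> R) :
  (forall i, P i -> continuous (F i)) -> continuous (fun x => \sum_(i <- r | P i) F i x).
Proof.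
move=> cF; elim: r => [|i r IH].
  by under eq_fun do rewrite big_nil; exact: contC.
case: (boolP (P i)) => [|/negPf] Pi; under eq_fun do rewrite big_cons Pi; last exact: IH.
by apply: contD => //; exact: cF.
Qed.

Lemma cont_prod (T : topologicalType) (I : Type) (r : seq I) (P : pred I) (F : I -> T -> R) :
  (forall i, P i -> continuous (F i)) -> continuous (fun x => \prod_(i <- r | P i) F i x).
Proof.
move=> cF; elim: r => [|i r IH].
  by under eq_fun do rewrite big_nil; exact: contC.
case: (boolP (P i)) => [|/negPf] Pi; under eq_fun do rewrite big_cons Pi; last exact: IH.
by apply: contM => //; exact: cF.
Qed.

Lemma iterint_sum (I : Type) (r : seq I) (P : pred I) (F : I -> 'rV[R]_n -> R) l v :
  (forall i, P i -> continuous (F i)) ->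
  iterint l (fun v => \sum_(i <- r | P i) F i v) v = \sum_(i <- r | P i) iterint l (F i) v.
Proof.
move=> cF; elim: r => [|i r IH].
  by under eq_fun do rewrite big_nil; rewrite big_nil iterint0.
rewrite big_cons -IH.
case: (boolP (P i)) => [|/negPf] Pi; under eq_fun do rewrite big_cons Pi; last by [].
by rewrite iterintD//; [exact: cF|exact: cont_sum].
Qed.

Lemma eq_iterint F G l (v0 : 'rV[R]_n) :
  (forall v : 'rV[R]_n, (forall s, s \in l -> a s < v 0 s < b s) ->
     (forall s, s \notin l -> v 0 s = v0 0 s) -> F v = G v) ->
  iterint l F v0 = iterint l G v0.
Proof.
elim: l v0 => [|s l IH] v0 FG /=.
  by apply: FG => // s; rewrite in_nil.
apply: eq_wint => t tab; apply: IH => v hv1 hv2; apply: FG => r.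
  rewrite inE; have [rl _|rl] := boolP (r \in l); first exact: hv1.
  by rewrite orbF => /eqP rs; rewrite hv2// rs updE.
rewrite inE negb_or => /andP[rs rl]; by rewrite hv2// updN.
Qed.

Lemma iterint_ge0 F l v0 :
  (forall v : 'rV[R]_n, (forall s, s \in l -> a s < v 0 s < b s) -> 0 <= F v) ->
  0 <= iterint l F v0.
Proof.
elim: l F v0 => [|s l IH] F v0 F0 /=; first by apply: F0 => s; rewrite in_nil.
apply: wint_ge0 => // t tab.
(* The induction hypothesis forgets that coordinate [s] has been set to [t]. Cutting [F] off outside
   the interval of [s] makes it nonnegative without that information and changes no value that the
   integral uses. *)
suff : 0 <= iterint l (fun v => if a s < v 0 s < b s then F v else 0) (upd s t v0).
  congr (0 <= _); have [sl|sl] := boolP (s \in l).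
    by apply: eq_iterint => v hv _; rewrite hv.
  by apply: eq_iterint => v _ ->//; rewrite updE tab.
apply: IH => v hv; case: ifP => // hs; apply: F0 => r; rewrite inE => /orP[/eqP ->//|].
exact: hv.
Qed.

Lemma le_iterint F G l v0 : continuous F -> continuous G ->
  (forall v : 'rV[R]_n, (forall s, s \in l -> a s < v 0 s < b s) -> F v <= G v) ->
  iterint l F v0 <= iterint l G v0.
Proof.
move=> cF cG FG; rewrite -subr_ge0 -iterintB//; apply: iterint_ge0 => v hv.
by rewrite subr_ge0; exact: FG.
Qed.

Lemma section_continuous_rV (F : R -> 'rV[R]_n -> R) t :
  continuous (fun p : R * 'rV[R]_n => F p.1 p.2) -> continuous (F t).
Proof.
have c0 : continuous (fun v : 'rV[R]_n => (t, v)).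
  by apply: cont_pair; [exact: contC|exact: cont_id].
by move=> cF; exact: (cont_comp c0 cF).
Qed.

Lemma iterint_derive (F F' : R -> 'rV[R]_n -> R) l :
  (forall (t : R) v, is_derive t (1 : R) (F ^~ v) (F' t v)) ->
  continuous (fun p : R * 'rV[R]_n => F p.1 p.2) ->
  continuous (fun p : R * 'rV[R]_n => F' p.1 p.2) ->
  forall (t : R) v, is_derive t (1 : R) (fun t => iterint l (F t) v) (iterint l (F' t) v).
Proof.
move=> dF cF cF'; elim: l => //= s l IH t v.
have cu : continuous (fun p : R * R => (p.1, upd s p.2 v)).
  apply: cont_pair; first by apply: cont_fst; exact: cont_id.
  apply: upd_continuous; first by apply: cont_snd; exact: cont_id.
  by move=> x; exact: cst_continuous.
have cJ : continuous (fun p : R * R => iterint l (F p.1) (upd s p.2 v)).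
  have h : continuous (fun p : R * 'rV[R]_n => iterint l (F p.1) p.2).
    exact: iterint_continuousP.
  exact: (cont_comp cu h).
have cJ' : continuous (fun p : R * R => iterint l (F' p.1) (upd s p.2 v)).
  have h : continuous (fun p : R * 'rV[R]_n => iterint l (F' p.1) p.2).
    exact: iterint_continuousP.
  exact: (cont_comp cu h).
apply: (wint_derive (wt s) (F := fun t r => iterint l (F t) (upd s r v))
  (F' := fun t r => iterint l (F' t) (upd s r v))) => //.
by move=> x; apply: iterint_line_continuous; exact: section_continuous_rV.
Qed.

Lemma iterint_pull l s (f : R -> R) F v : s \notin l -> continuous F ->
  iterint l (fun v => f (v 0 s) * F v) v = f (v 0 s) * iterint l F v.
Proof.
move=> + cF; elim: l v => //= r l IH v.
rewrite inE negb_or => /andP[sr sl]; rewrite /slice -wintZ//; last exact: iterint_line_continuous.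
by apply: eq_wint => t _; rewrite IH// updN.
Qed.

Lemma iterint_upd l s t F v : s \notin l ->
  iterint l (fun v => F (upd s t v)) v = iterint l F (upd s t v).
Proof.
elim: l v => //= r l IH v; rewrite inE negb_or => /andP[sr sl].
by apply: eq_wint => u _; rewrite IH// updC.
Qed.

(** The integrals inside that of [s] are moved through the derivative by [iterint_derive]; the
    one-variable identity then makes the integral over [s] vanish, and the integrals outside it are
    integrals of zero. *)
Lemma iterint_ibp l s (p q : R -> R) h hs v : uniq l -> s \in l ->
  (forall H H' : R -> R, (forall t : R, is_derive t (1 : R) H (H' t)) -> continuous H' ->
     wint (a s) (b s) (w s) (fun t => p t * H t + q t * H' t) = 0) ->
  continuous p -> continuous q -> continuous h -> continuous hs ->
  (forall v (t : R), is_derive t (1 : R) (fun t => h (upd s t v)) (hs (upd s t v))) ->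
  iterint l (fun v => p (v 0 s) * h v + q (v 0 s) * hs v) v = 0.
Proof.
move=> + + ibp cp cq ch chs dh.
have cps : continuous (fun v : 'rV[R]_n => p (v 0 s)).
  by apply: cont_comp cp; exact: coord_continuous.
have cqs : continuous (fun v : 'rV[R]_n => q (v 0 s)).
  by apply: cont_comp cq; exact: coord_continuous.
elim: l v => // r l IH v /= /andP[rl ul].
rewrite inE; have [sr _|sr /= sl] := eqVneq s r; last first.
  rewrite -[RHS](wint0 (a r) (b r) (w r)); apply: eq_wint => t _; exact: IH.
subst r.
rewrite -[RHS](ibp (fun t => iterint l h (upd s t v)) (fun t => iterint l hs (upd s t v))).
- apply: eq_wint => t _; rewrite iterintD; [|exact: contM..].
  by rewrite !iterint_pull// updE.
- move=> t.
  have du : forall (t : R) v, is_derive t (1 : R) ((fun t v => h (upd s t v)) ^~ v)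
      ((fun t v => hs (upd s t v)) t v) by move=> u x; exact: dh.
  have cu : continuous (fun p : R * 'rV[R]_n => upd s p.1 p.2).
    by apply: upd_continuous; [apply: cont_fst|apply: cont_snd]; exact: cont_id.
  have := iterint_derive (F := fun t v => h (upd s t v)) l du (cont_comp cu ch) (cont_comp cu chs) t v.
  rewrite iterint_upd// => H.
  have -> // : (fun t => iterint l h (upd s t v)) = (fun t => iterint l (fun v => h (upd s t v)) v).
  by apply/funext => u; rewrite iterint_upd.
- exact: iterint_line_continuous.
Qed.

Lemma iterint_prod l (g : 'I_n -> R -> R) v : uniq l -> (forall s, continuous (g s)) ->
  iterint l (fun v => \prod_s g s (v 0 s)) v =
  \prod_s (if s \in l then wint (a s) (b s) (w s) (g s) else g s (v 0 s)).
Proof.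
move=> + cg; elim: l v => //= r l IH v /andP[rl ul].
rewrite (bigD1 r)//= mem_head mulrC -wintZ//.
apply: eq_wint => t _; rewrite IH// (bigD1 r)//= (negPf rl) updE mulrC.
congr (_ * _); apply: eq_bigr => i ir; rewrite inE (negPf ir)/= updN//.
Qed.

End Iterated.

(** * Real analytic functions are continuously differentiable *)

Section Majorant.
Variables (R : realType) (d : nat).
Implicit Types (q : 'I_d -> R).

Definition lin q (h : 'rV[R]_d) : R := \sum_j q j * h 0 j.

(* [A] bounds the constant, linear and remainder parts of [p], with total at most [M] on the
   ball of radius [tau]; this makes [M] multiplicative, so it grows geometrically on monomials. *)
Definition majorized (tau M : R) (p : 'rV[R]_d -> R) (p0 : R) q :=
  exists A : R * R * R, [/\ 0 <= A.1.1, 0 <= A.1.2, 0 <= A.2 &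
   [/\ `|p0| <= A.1.1, forall h, `|lin q h| <= A.1.2 * `|h|,
     forall h, `|h| <= tau -> `|p h - p0 - lin q h| <= A.2 * `|h| ^+ 2 &
     A.1.1 + A.1.2 * tau + A.2 * tau ^+ 2 <= M]].

Lemma majorizedM (tau M M' : R) (p p' : 'rV[R]_d -> R) (p0 p0' : R) q q' : 0 <= tau ->
  majorized tau M p p0 q -> majorized tau M' p' p0' q' ->
  majorized tau (M * M') (fun h => p h * p' h) (p0 * p0')
    (fun j => p0 * q' j + p0' * q j).
Proof.
move=> t0 [[[A0 A1] A2] /= [a0 a1 a2 [hA0 hA1 hA2 hM]]].
move=> [[[B0 B1] B2] /= [b0 b1 b2 [hB0 hB1 hB2 hM']]].
have linE h : lin (fun j => p0 * q' j + p0' * q j) h = p0 * lin q' h + p0' * lin q h.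
  by rewrite /lin !mulr_sumr -big_split/=; apply: eq_bigr => j _; ring.
(* These are the coefficients of the product of two quadratics in [|h|]; in the cubic and quartic
   terms the extra factors [|h|] are replaced by [tau]. At [|h| = tau] nothing is lost, so the
   totals multiply exactly. *)
exists (A0 * B0, A0 * B1 + A1 * B0,
  A0 * B2 + A1 * B1 + A2 * B0 + tau * (A1 * B2 + A2 * B1) + tau ^+ 2 * (A2 * B2)) => /=.
split; rewrite ?addr_ge0 ?mulr_ge0 ?exprn_ge0//.
  by rewrite !addr_ge0// !mulr_ge0// ?addr_ge0 ?mulr_ge0 ?exprn_ge0.
split.
- by rewrite normrM ler_pM.
- move=> h; rewrite linE (le_trans (ler_normD _ _))// mulrDl lerD// normrM.
    by rewrite -mulrA ler_pM.
  by rewrite mulrC (mulrAC A1) ler_pM.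
- move=> h ht; rewrite linE.
  set r := p h - p0 - lin q h; set r' := p' h - p0' - lin q' h.
  have -> : p h = p0 + lin q h + r by rewrite /r; ring.
  have -> : p' h = p0' + lin q' h + r' by rewrite /r'; ring.
  have := hA2 h ht; rewrite -/r => hr.
  have := hB2 h ht; rewrite -/r' => hr'.
  have := hA1 h; have := hB1 h.
  set u := lin q h; set u' := lin q' h => hu' hu.
  set t := `|h| in hr hr' hu hu' ht *.
  have t_ge0 : 0 <= t by rewrite normr_ge0.
  have -> : (p0 + u + r) * (p0' + u' + r') - p0 * p0' - (p0 * u' + p0' * u) =
    p0 * r' + u * u' + r * p0' + (u * r' + r * u') + r * r' by ring.
  have bnd x y a b : `|x| <= a -> `|y| <= b -> `|x * y| <= a * b.
    by move=> xa yb; rewrite normrM ler_pM.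
  have tt : t ^+ 2 * t <= tau * t ^+ 2 by rewrite mulrC ler_wpM2r// exprn_ge0.
  have ttt : t ^+ 2 * t ^+ 2 <= tau ^+ 2 * t ^+ 2.
    by rewrite ler_wpM2r ?exprn_ge0// lerXn2r// nnegrE.
  apply: (@le_trans _ _ (A0 * (B2 * t ^+ 2) + (A1 * t) * (B1 * t) + (A2 * t ^+ 2) * B0 +
     ((A1 * t) * (B2 * t ^+ 2) + (A2 * t ^+ 2) * (B1 * t)) + (A2 * t ^+ 2) * (B2 * t ^+ 2))).
    do 3 (apply: le_trans (ler_normD _ _) _; apply: lerD; last by
      [exact: bnd | apply: le_trans (ler_normD _ _) _; apply: lerD; exact: bnd]).
    by apply: le_trans (ler_normD _ _) _; apply: lerD; exact: bnd.
  rewrite !mulrDl -!addrA lerD//.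
    by rewrite mulrA.
  rewrite lerD//.
    by rewrite le_eqVlt; apply/orP; left; apply/eqP; ring.
  rewrite lerD//.
    by rewrite le_eqVlt; apply/orP; left; apply/eqP; ring.
  rewrite addrA lerD//.
    have := ler_wpM2l (addr_ge0 (mulr_ge0 a1 b2) (mulr_ge0 a2 b1)) tt.
    by move=> h1; apply: le_trans (le_trans h1 _); rewrite le_eqVlt; apply/orP; left; apply/eqP; ring.
  have := ler_wpM2l (mulr_ge0 a2 b2) ttt.
  by move=> h1; apply: le_trans (le_trans h1 _); rewrite le_eqVlt; apply/orP; left; apply/eqP; ring.
- apply: le_trans (ler_pM _ _ hM hM'); rewrite ?addr_ge0 ?mulr_ge0 ?exprn_ge0//.
  by rewrite le_eqVlt; apply/orP; left; apply/eqP; ring.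
Qed.

Lemma majorized1 tau : majorized tau 1 (fun=> 1) 1 (fun=> 0).
Proof.
have l0 h : lin (fun=> 0) h = 0 by rewrite /lin big1// => j _; rewrite mul0r.
exists (1, 0, 0) => /=; split => //; split=> //.
- by rewrite normr1.
- by move=> h; rewrite l0 normr0 mul0r.
- by move=> h _; rewrite l0 subrr subr0 normr0 mul0r.
- by rewrite !mul0r !addr0.
Qed.

Lemma majorized_coord tau rho (y : 'rV[R]_d) i : 0 <= tau -> `|y| <= rho ->
  majorized tau (rho + tau) (fun h => (y + h) 0 i) (y 0 i) (fun j => (j == i)%:R).
Proof.
move=> t0 yr.
have le h : lin (fun j => (j == i)%:R) h = h 0 i.
  rewrite /lin (bigD1 i)//= eqxx mul1r big1 ?addr0// => j /negPf ->.
  by rewrite mul0r.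
exists (rho, 1, 0) => /=; split => //.
  by apply: le_trans yr.
split=> //.
- exact: le_trans (coord_le_norm _ _) yr.
- by move=> h; rewrite le mul1r; exact: coord_le_norm.
- by move=> h _; rewrite le mxE mul0r (_ : _ - _ = 0) ?normr0//; ring.
- by rewrite mul0r addr0 mul1r.
Qed.

Lemma majorized_prod tau (I : Type) (r : seq I) (M : I -> R) (p : I -> 'rV[R]_d -> R) :
  0 <= tau -> (forall i, exists p0 q, majorized tau (M i) (p i) p0 q) ->
  exists p0 q, majorized tau (\prod_(i <- r) M i) (fun h => \prod_(i <- r) p i h) p0 q.
Proof.
move=> t0 H; elim: r => [|i r [p0 [q IH]]].
  exists 1, (fun=> 0); rewrite big_nil.
  have -> : (fun h => \prod_(j <- [::]) p j h) = (fun=> 1) by apply/funext => h; rewrite big_nil.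
  exact: majorized1.
have [p0' [q' H']] := H i.
exists (p0' * p0), (fun j => p0' * q j + p0 * q' j).
have -> : (fun h => \prod_(j <- i :: r) p j h) = (fun h => p i h * \prod_(j <- r) p j h).
  by apply/funext => h; rewrite big_cons.
by rewrite big_cons; exact: majorizedM.
Qed.

Lemma majorized_monom tau rho (y : 'rV[R]_d) (al : 'I_d -> nat) : 0 <= tau -> `|y| <= rho ->
  exists p0 q, majorized tau (monom (const_mx (rho + tau)) al) (fun h => monom (y + h) al) p0 q.
Proof.
move=> t0 yr; rewrite /monom; apply: majorized_prod => // i.
have -> : (fun h => (y + h) 0 i ^+ al i) = (fun h => \prod_(0 <= j < al i) (y + h) 0 i).
  by apply/funext => h; rewrite prodr_const_nat subn0.
rewrite mxE -[al i]subn0 -prodr_const_nat subn0.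
apply: majorized_prod => // _.
by exists (y 0 i), (fun j => (j == i)%:R); exact: majorized_coord.
Qed.

(** The error constant is the monomial itself at the point whose coordinates are all [rho + tau], so
    these constants stay summable against the coefficients of a power series that converges
    absolutely there. *)
Lemma monom_quad tau rho (y : 'rV[R]_d) (al : 'I_d -> nat) : 0 < tau -> `|y| <= rho ->
  exists q, forall h, `|h| <= tau ->
    `|monom (y + h) al - monom y al - lin q h|
      <= (monom (const_mx (rho + tau)) al / tau ^+ 2) * `|h| ^+ 2.
Proof.
move=> t0 yr; have [p0 [q [[[A0 A1] A2] /= [a0 a1 a2 [_ _ hq hM]]]]] :=
  majorized_monom al (ltW t0) yr.
exists q => h ht.
have l0 : lin q 0 = 0 by rewrite /lin big1// => j _; rewrite mxE mulr0.
(* At [h = 0] the remainder bound forces the constant part [p0] to be the value at [y]. *)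
have := hq 0; rewrite addr0 l0 subr0 normr0 expr0n/= mulr0 => /(_ (ltW t0)).
rewrite normr_le0 subr_eq0 => /eqP ->.
apply: le_trans (hq h ht) _; apply: ler_wpM2r; first exact: exprn_ge0.
rewrite ler_pdivlMr ?exprn_gt0//; apply: le_trans hM.
by rewrite lerDr addr_ge0// mulr_ge0// ltW.
Qed.

End Majorant.

Section AnalyticC1.
Variables (R : realType) (d : nat).
Implicit Types (f : 'rV[R]_d -> R) (q : 'I_d -> R).

Definition C1grad f (g : 'I_d -> 'rV[R]_d -> R) :=
  [/\ continuous f, forall j, continuous (g j) &
    forall y v : 'rV[R]_d, is_derive y v f (\sum_j v 0 j * g j y)].

(** One constant [C] serves all base points near [a]. This uniformity is what later makes the
    gradient continuous, although nothing is assumed on how [G] depends on [y]. *)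
Definition quad_at f (a : 'rV[R]_d) (r0 C : R) (G : 'rV[R]_d -> 'I_d -> R) :=
  forall y h : 'rV[R]_d, `|y - a| < r0 -> `|h| < r0 ->
    `|f (y + h) - f y - lin (G y) h| <= C * `|h| ^+ 2.

Lemma lin_norm_le q (h : 'rV[R]_d) : `|lin q h| <= (\sum_j `|q j|) * `|h|.
Proof.
rewrite mulr_suml; apply: le_trans (ler_norm_sum _ _ _) _.
by apply: ler_sum => j _; rewrite normrM ler_wpM2l// coord_le_norm.
Qed.

Lemma linZ q (c : R) (h : 'rV[R]_d) : lin q (c *: h) = c * lin q h.
Proof. by rewrite /lin mulr_sumr; apply: eq_bigr => j _; rewrite mxE; ring. Qed.

Lemma linD q (h h' : 'rV[R]_d) : lin q (h + h') = lin q h + lin q h'.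
Proof. by rewrite /lin -big_split; apply: eq_bigr => j _; rewrite mxE mulrDr. Qed.

Lemma lin_delta q j : lin q (e_ R j) = q j.
Proof.
rewrite /lin (bigD1 j)//= !mxE !eqxx mulr1 big1 ?addr0// => i /negPf ij.
by rewrite mxE ij andbF mulr0.
Qed.

Lemma norm_delta (j : 'I_d) : `|e_ R j| = 1.
Proof.
apply/eqP; rewrite eq_le; apply/andP; split.
  by apply: rV_norm_le => // i; rewrite mxE eqxx/=; case: (_ == _); rewrite ?normr1 ?normr0.
by have := coord_le_norm (e_ R j) j; rewrite mxE !eqxx/= normr1.
Qed.

Lemma near_norm_lt (a : 'rV[R]_d) r : 0 < r -> \forall y \near a, `|y - a| < r.
Proof.
move=> r0; apply/nbhs_ballP; exists r => // y.
by rewrite -ball_normE/= distrC.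
Qed.

Lemma quad_is_derive f a r0 C G y v : 0 < r0 -> 0 <= C -> quad_at f a r0 C G ->
  `|y - a| < r0 -> is_derive y v f (lin (G y) v).
Proof.
move=> r00 C0 Q ya; apply: is_derive_le => e e0.
pose K := C * `|v| ^+ 2 + 1.
have K0 : 0 < K by rewrite ltr_wpDl// mulr_ge0// exprn_ge0.
near=> h.
have h1 : `|h| < e / K.
  near: h; apply/nbhs_ballP; exists (e / K) => /=; first by rewrite divr_gt0.
  by move=> h; rewrite -ball_normE/= sub0r normrN.
have h2 : `|h *: v| < r0.
  have : `|h| < r0 / (`|v| + 1).
    near: h; apply/nbhs_ballP; exists (r0 / (`|v| + 1)) => /=; first by rewrite divr_gt0// ltr_wpDl.
    by move=> h; rewrite -ball_normE/= sub0r normrN.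
  rewrite ltr_pdivlMr ?ltr_wpDl// normrZ; apply: le_lt_trans.
  by rewrite ler_wpM2l// lerDl.
have hq := Q y (h *: v) ya h2; rewrite (addrC y) linZ in hq.
apply: (le_trans hq).
rewrite normrZ exprMn mulrCA expr2 -mulrA mulrC ler_wpM2r//.
apply: le_trans (_ : `|h| * K <= _); first by rewrite ler_wpM2l// lerDl.
by rewrite -ler_pdivlMr// ltW.
Unshelve. all: by end_near. Qed.

(** For continuity of the gradient, the point at distance [del = |y - a|] from [y] in direction
    [e_j] is reached from [a] directly and through [y]; comparing the expansions bounds the change
    of the linear parts on a vector of length [del] by a multiple of [del ^ 2]. *)
Lemma quad_C1grad f :
  (forall a, exists r0 C G, [/\ 0 < r0, 0 <= C & quad_at f a r0 C G]) ->
  C1grad f (fun j y => 'D_(e_ R j) f y).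
Proof.
move=> H; split.
- move=> a; have [r0 [C [G [r00 C0 Q]]]] := H a.
  apply: cont_dist => e e0.
  pose K := \sum_j `|G a j| + C * r0 + 1.
  have S0 : 0 <= \sum_j `|G a j| by apply: sumr_ge0.
  have K0 : 0 < K by rewrite ltr_wpDl// addr_ge0// mulr_ge0// ltW.
  near=> y.
  have h1 : `|y - a| < e / K by near: y; apply: near_norm_lt; rewrite divr_gt0.
  have h2 : `|y - a| < r0 by near: y; exact: near_norm_lt.
  have aa : `|a - a| < r0 by rewrite subrr normr0.
  have := Q a (y - a) aa h2; rewrite (addrC a) subrK => hq.
  have h3 : `|f y - f a| <= (\sum_j `|G a j|) * `|y - a| + C * `|y - a| ^+ 2.
    have -> : f y - f a = lin (G a) (y - a) + (f y - f a - lin (G a) (y - a)) by ring.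
    by apply: le_trans (ler_normD _ _) _; rewrite lerD// lin_norm_le.
  rewrite distrC; apply: le_trans h3 _.
  apply: le_trans (_ : K * `|y - a| <= e); last by rewrite mulrC -ler_pdivlMr// ltW.
  rewrite !mulrDl mul1r -addrA lerD2l; apply: ler_wpDr => //.
  by rewrite expr2 mulrA ler_wpM2r// ler_wpM2l// ltW.
- move=> j a; have [r0 [C [G [r00 C0 Q]]]] := H a.
  have DG y : `|y - a| < r0 -> 'D_(e_ R j) f y = G y j.
    by move=> ya; have [_ ->] := quad_is_derive (e_ R j) r00 C0 Q ya; rewrite lin_delta.
  apply: cont_dist => e e0.
  (* The steps [h] from [y], [y - a] from [a], and [y - a + h] from [a] have lengths at most [del],
     [del] and [2 * del], and contribute [C], [C] and [4 * C] times [del ^ 2]. *)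
  pose K := 6 * C + 1.
  have K0 : 0 < K by rewrite ltr_wpDl// mulr_ge0.
  near=> y.
  have h1 : `|y - a| < e / K by near: y; apply: near_norm_lt; rewrite divr_gt0.
  have h2 : `|y - a| < r0 / 2 by near: y; apply: near_norm_lt; rewrite divr_gt0.
  have h2' : `|y - a| < r0 by move: h2; lra.
  have aa : `|a - a| < r0 by rewrite subrr normr0.
  rewrite !DG// distrC.
  have [->|ya] := eqVneq y a; first by rewrite subrr normr0 ltW.
  set del := `|y - a| in h1 h2 h2' *.
  have del0 : 0 < del by rewrite normr_gt0 subr_eq0.
  pose h := del *: e_ R j.
  have nh : `|h| = del by rewrite normrZ norm_delta mulr1 ger0_norm// ltW.
  have q1 := Q y h h2' _; rewrite nh in q1; have {}q1 := q1 h2'.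
  have q2 := Q a (y - a) aa h2'.
  have nyh : `|y - a + h| <= del *+ 2 by rewrite mulr2n -{2}nh ler_normD.
  have nyh' : `|y - a + h| < r0 by apply: le_lt_trans nyh _; rewrite -mulr_natr; move: h2; lra.
  have q3 := Q a (y - a + h) aa nyh'.
  rewrite addrA (addrC a) subrK linD in q3; rewrite (addrC a) subrK -/del in q2.
  have {}q3 : `|f (y + h) - f a - (lin (G a) (y - a) + lin (G a) h)| <= C * (4 * del ^+ 2).
    apply: le_trans q3 _; rewrite ler_wpM2l//.
    have -> : 4 * del ^+ 2 = (del *+ 2) ^+ 2 by ring.
    by rewrite lerXn2r// nnegrE// ?mulrn_wge0// ltW.
  have key : `|lin (G y) h - lin (G a) h| <= 6 * C * del ^+ 2.
    have -> : lin (G y) h - lin (G a) h = (f (y + h) - f a - (lin (G a) (y - a) + lin (G a) h))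
        - (f (y + h) - f y - lin (G y) h) - (f y - f a - lin (G a) (y - a)) by ring.
    apply: le_trans (ler_normB _ _) _; apply: le_trans (lerD (ler_normB _ _) (lexx _)) _.
    by move: q1 q2 q3; lra.
  rewrite /h !linZ !lin_delta -mulrBr normrM (gtr0_norm del0) expr2 in key.
  rewrite mulrA mulrC ler_pM2r// in key.
  apply: le_trans key _; apply: le_trans (_ : K * del <= e).
    by rewrite ler_pM2r// lerDl.
  by rewrite mulrC -ler_pdivlMr// ltW.
- move=> y v; have [r0 [C [G [r00 C0 Q]]]] := H y.
  have yy : `|y - y| < r0 by rewrite subrr normr0.
  suff -> : \sum_j v 0 j * 'D_(e_ R j) f y = lin (G y) v by exact: quad_is_derive Q yy.
  apply: eq_bigr => j _; rewrite mulrC; congr (_ * _).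
  by have [_ ->] := quad_is_derive (e_ R j) r00 C0 Q yy; rewrite lin_delta.
Unshelve. all: by end_near. Qed.

End AnalyticC1.

Section RealAnalytic.
Variables (R : realType) (d : nat).

(** Convergence of the linear parts need not be assumed. Each [Q N j] is within [C * s] of a
    difference quotient of [S N] with step [s], and for fixed [s] these quotients converge; so
    [Q N j] is Cauchy, and the bound passes to the limit. *)
Lemma quad_limit (S : nat -> 'rV[R]_d -> R) (f : 'rV[R]_d -> R) y (tau C : R)
    (Q : nat -> 'I_d -> R) : 0 < tau -> 0 <= C ->
  (forall N h, `|h| <= tau -> `|S N (y + h) - S N y - lin (Q N) h| <= C * `|h| ^+ 2) ->
  (forall h, `|h| <= tau -> S N (y + h) @[N --> \oo] --> f (y + h)) ->
  exists G, forall h, `|h| <= tau -> `|f (y + h) - f y - lin G h| <= C * `|h| ^+ 2.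
Proof.
move=> t0 C0 HS Sf.
have Sy : S N y @[N --> \oo] --> f y.
  by have := Sf 0; rewrite normr0 addr0; apply; exact: ltW.
have cvQ j : cvg (Q N j @[N --> \oo]).
  apply/cauchy_cvgP/cauchy_exP => e e0.
  (* The step is so small that the quadratic error costs at most [e / 2]; the two errors of the
     values cost [e / 8] each. *)
  pose s := Num.min tau (e / (C + 1) / 2).
  have C10 : 0 < C + 1 by rewrite ltr_wpDl.
  have s0 : 0 < s by rewrite lt_min t0 !divr_gt0.
  have st : s <= tau by rewrite ge_min lexx.
  have sC : C * s <= e / 2.
    apply: le_trans (_ : (C + 1) * s <= _); first by rewrite ler_pM2r// lerDl.
    rewrite -ler_pdivlMl// (_ : _ * (e / 2) = e / (C + 1) / 2); last by rewrite mulrC mulrAC.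
    by rewrite ge_min lexx orbT.
  have nh : `|s *: e_ R j| = s by rewrite normrZ norm_delta mulr1 gtr0_norm.
  have hs : `|s *: e_ R j| <= tau by rewrite nh.
  exists ((f (y + s *: e_ R j) - f y) / s).
  have e4 : 0 < e / 8 * s by rewrite mulr_gt0// divr_gt0.
  have c1 : \forall N \near \oo, `|f (y + s *: e_ R j) - S N (y + s *: e_ R j)| <= e / 8 * s.
    by move/cvgrPdist_le : (Sf _ hs); exact.
  have c2 : \forall N \near \oo, `|f y - S N y| <= e / 8 * s.
    by move/cvgrPdist_le : Sy; exact.
  suff : \forall N \near \oo, ball ((f (y + s *: e_ R j) - f y) / s) e (Q N j) by [].
  near=> N; rewrite -ball_normE/=.
  have h1 : `|f (y + s *: e_ R j) - S N (y + s *: e_ R j)| <= e / 8 * s by near: N.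
  have h2 : `|f y - S N y| <= e / 8 * s by near: N.
  have := HS N _ hs; rewrite linZ lin_delta nh => h3.
  rewrite -(ltr_pM2r s0) -[X in _ * X < _](gtr0_norm s0) -normrM mulrBl divfK ?gt_eqF//.
  have -> : f (y + s *: e_ R j) - f y - Q N j * s =
     (f (y + s *: e_ R j) - S N (y + s *: e_ R j)) - (f y - S N y) +
     (S N (y + s *: e_ R j) - S N y - s * Q N j) by ring.
  apply: le_lt_trans (ler_normD _ _) _.
  apply: (@le_lt_trans _ _ (e / 8 * s + e / 8 * s + C * s ^+ 2)).
    by rewrite lerD// (le_trans (ler_normB _ _))// lerD.
  have : C * s ^+ 2 <= e / 2 * s by rewrite expr2 mulrA ler_pM2r.
  have : 0 < e * s by rewrite mulr_gt0.
  lra.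
exists (fun j => limn (fun N => Q N j)) => h ht.
have cl : lin (Q N) h @[N --> \oo] --> lin (fun j => limn (fun N => Q N j)) h.
  rewrite /lin; apply: cvg_big => [|j _]; first exact: add_continuous.
  by apply: cvgMr_tmp; exact: cvQ.
have cv : `|S N (y + h) - S N y - lin (Q N) h| @[N --> \oo] -->
    `|f (y + h) - f y - lin (fun j => limn (fun N => Q N j)) h|.
  by apply: cvg_norm; apply: cvgB => //; apply: cvgB => //; exact: Sf.
by apply: cvgr_to_le cv _; apply: nearW => N; exact: HS.
Unshelve. all: by end_near. Qed.

Lemma cube_sum_le (F : ('I_d -> nat) -> R) N : (forall al, 0 <= F al) ->
  (\esum_(al in [set: 'I_d -> nat]) (F al)%:E < +oo)%E ->
  \sum_(al : {ffun 'I_d -> 'I_N.+1}) F (fun i => nat_of_ord (al i)) <=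
  fine (\esum_(al in [set: 'I_d -> nat]) (F al)%:E).
Proof.
move=> F0 Fy.
have E0 : (0 <= \esum_(al in [set: 'I_d -> nat]) (F al)%:E)%E.
  by apply: esum_ge0 => al _; rewrite lee_fin.
rewrite -lee_fin fineK ?ge0_fin_numE//.
pose io (al : {ffun 'I_d -> 'I_N.+1}) : 'I_d -> nat := fun i => nat_of_ord (al i).
have io_inj : injective io.
  move=> x y xy; apply/ffunP => i; apply: val_inj.
  exact: (congr1 (fun g => g i) xy).
apply: esum_ge; exists (range io).
  by split=> //; apply: finite_image.
rewrite (@reindex_fsbig _ _ _ _ _ io [set: {ffun 'I_d -> 'I_N.+1}]).
  rewrite -sumEFin (fsbig_seq _ _ (index_enum_uniq _)) (_ : [set` _] = setT)//.
  by apply/seteqP; split=> // x _ /=; rewrite mem_index_enum.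
split=> //.
  by move=> x y _ _; exact: io_inj.
Qed.

Lemma real_analytic_quad (f : 'rV[R]_d -> R) : real_analytic f ->
  forall a, exists r0 C G, [/\ 0 < r0, 0 <= C & quad_at f a r0 C G].
Proof.
move=> Hf a; have [r [r0 [c Hc]]] := Hf a.
(* A base point within [tau] of [a] followed by a step of length at most [tau] stays within
   [2 * tau < r], and so does the comparison point [a + rr], where the series of absolute values is
   finite. *)
pose tau := r / 4.
have tau0 : 0 < tau by rewrite divr_gt0.
pose rr : 'rV[R]_d := const_mx (tau + tau).
have rrm al : 0 <= monom rr al.
  by apply: prodr_ge0 => i _; rewrite exprn_ge0// mxE addr_ge0// ltW.
have nrr : `|a + rr - a| < r.
  rewrite addrAC subrr add0r; apply: (@le_lt_trans _ _ (tau + tau)).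
    by apply: rV_norm_le => [|i]; rewrite ?mxE ?ger0_norm// addr_ge0// ltW.
  by rewrite /tau; lra.
have [Ey _] := Hc _ nrr.
rewrite (addrAC a) subrr add0r in Ey.
pose F al := `|c al * monom rr al|.
pose K := fine (\esum_(al in [set: 'I_d -> nat]) (F al)%:E).
have KN N : \sum_(al : {ffun 'I_d -> 'I_N.+1}) F (fun i => nat_of_ord (al i)) <= K.
  by apply: cube_sum_le => // al; exact: normr_ge0.
have K0 : 0 <= K by apply: le_trans (KN 0%N); apply: sumr_ge0 => al _; exact: normr_ge0.
pose S (N : nat) y := \sum_(al : {ffun 'I_d -> 'I_N.+1})
   c (fun i => nat_of_ord (al i)) * monom (y - a) (fun i => nat_of_ord (al i)).
pose C := K / tau ^+ 2.
have C0 : 0 <= C by rewrite divr_ge0// exprn_ge0// ltW.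
have ex y : exists G, `|y - a| < tau -> forall h, `|h| <= tau ->
    `|f (y + h) - f y - lin G h| <= C * `|h| ^+ 2.
  have [ya|] := ltP `|y - a| tau; last by exists (fun=> 0).
  have [q hq] := choice (fun al => monom_quad al tau0 (ltW ya)).
  pose Q N j := \sum_(al : {ffun 'I_d -> 'I_N.+1})
    c (fun i => nat_of_ord (al i)) * q (fun i => nat_of_ord (al i)) j.
  have [||G hG] := @quad_limit S f y tau C Q tau0 C0; last by exists G.
  - move=> N h ht.
    have -> : lin (Q N) h = \sum_(al : {ffun 'I_d -> 'I_N.+1})
       c (fun i => nat_of_ord (al i)) * lin (q (fun i => nat_of_ord (al i))) h.
      rewrite /lin /Q; under eq_bigr do rewrite mulr_suml.
      rewrite exchange_big/=; apply: eq_bigr => al _.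
      by rewrite mulr_sumr; apply: eq_bigr => j _; rewrite mulrA.
    rewrite /S -!sumrB; apply: le_trans (ler_norm_sum _ _ _) _.
    have -> : C * `|h| ^+ 2 = (`|h| ^+ 2 / tau ^+ 2) * K by rewrite /C; ring.
    apply: le_trans (ler_wpM2l _ (KN N)); last by rewrite divr_ge0// exprn_ge0// ltW.
    rewrite mulr_sumr; apply: ler_sum => al _.
    rewrite -!mulrBr normrM /F normrM (ger0_norm (rrm _)) mulrCA ler_wpM2l//.
    have := hq (fun i => nat_of_ord (al i)) h ht.
    rewrite (addrAC y h) => /le_trans; apply.
    by rewrite -/rr le_eqVlt; apply/orP; left; apply/eqP; ring.
  - move=> h ht; apply: (Hc _ _).2.
    rewrite addrAC; apply: le_lt_trans (ler_normD _ _) _.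
    by move: ya ht; rewrite /tau; lra.
have [G hG] := choice ex.
exists tau, C, G; split=> // y h ya ht; apply: hG => //; exact: ltW.
Qed.

Lemma real_analytic_C1 (f : 'rV[R]_d -> R) : real_analytic f ->
  C1grad f (fun j y => 'D_(e_ R j) f y).
Proof. by move=> Hf; apply: quad_C1grad; exact: real_analytic_quad. Qed.

End RealAnalytic.

(** * The Dunkl system along rays *)

Section OdeUniqueness.
Variables (R : realType) (I J : finType) (P : pred J) (tau : J -> I -> I).
Hypothesis tau_inj : forall j, injective (tau j).
Variables (c : R) (a : I -> R) (u u' : I -> R -> R).
Hypothesis c0 : 0 <= c.
Hypothesis du : forall w (t : R), is_derive t (1 : R) (u w) (u' w t).
Hypothesis ode : forall w t, 0 < t ->
  t * u' w t = - (c * \sum_(j | P j) (u w t - u (tau j w) t)) + t * (a w * u w t).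

(** The sum of squares is invariant under the permutation [tau j], so the expression is half the sum
    of the squares of the differences. *)
Lemma reflection_psd (v : I -> R) j : 0 <= \sum_w v w * (v w - v (tau j w)).
Proof.
have e : \sum_w v (tau j w) ^+ 2 = \sum_w v w ^+ 2.
  by rewrite [RHS](reindex_inj (@tau_inj j)).
have -> : \sum_w v w * (v w - v (tau j w)) = 2^-1 * \sum_w (v w - v (tau j w)) ^+ 2.
  transitivity (\sum_w v w * (v w - v (tau j w)) +
      2^-1 * (\sum_w v (tau j w) ^+ 2 - \sum_w v w ^+ 2)).
    by rewrite e subrr mulr0 addr0.
  rewrite -sumrB !mulr_sumr -big_split/=; apply: eq_bigr => w _; lra.
by rewrite mulr_ge0 ?invr_ge0// sumr_ge0// => w _; rewrite sqr_ge0.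
Qed.

Lemma ode_zero : (forall w, u w 0 = 0) -> forall w, u w 1 = 0.
Proof.
move=> u0 w0.
pose C := \sum_w `|a w|.
pose phi (t : R) : R := \sum_w u w t ^+ 2.
pose phi' (t : R) : R := \sum_w 2 * (u w t * u' w t).
have dphi (t : R) : is_derive t (1 : R) phi (phi' t).
  apply: der_sum => w _; have h := derM (du w t) (du w t).
  by apply: (is_derive_eq h); ring.
have ineq (t : R) : 0 < t -> phi' t <= 2 * C * phi t.
  move=> t0; rewrite -(ler_pM2l t0).
  have -> : t * phi' t = - (2 * c * \sum_(j | P j) \sum_w u w t * (u w t - u (tau j w) t)) +
     2 * t * \sum_w a w * u w t ^+ 2.
    rewrite exchange_big/= /phi' mulr_sumr -mulNr.
    rewrite (eq_bigr (fun w => - (2 * c) * (\sum_(j | P j) u w t * (u w t - u (tau j w) t))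
        + 2 * t * (a w * u w t ^+ 2))); first by rewrite big_split/= -!mulr_sumr.
    move=> w _; rewrite -mulr_sumr.
    have -> : t * (2 * (u w t * u' w t)) = 2 * u w t * (t * u' w t) by ring.
    by rewrite ode//; ring.
  have h1 : 0 <= \sum_(j | P j) \sum_w u w t * (u w t - u (tau j w) t).
    by apply: sumr_ge0 => j _; exact: (reflection_psd (u ^~ t)).
  have h2 : \sum_w a w * u w t ^+ 2 <= C * phi t.
    rewrite mulr_sumr; apply: ler_sum => w _; apply: ler_wpM2r; first exact: sqr_ge0.
    apply: le_trans (ler_norm _) _; rewrite /C (bigD1 w)//= lerDl.
    by apply: sumr_ge0.
  have h3 := mulr_ge0 c0 h1.
  have h4 := ler_wpM2l (ltW t0) h2.
  by move: h3 h4; lra.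
(* Since the singular reflection part only decreases [phi], the factor [1 / t] is harmless:
   [phi' <= 2 * C * phi] for [t > 0], so [psi] is nonincreasing from [psi 0 = 0]. *)
pose psi (t : R) : R := expR (- (2 * C) * t) * phi t.
have dpsi (t : R) : is_derive t (1 : R) psi (expR (- (2 * C) * t) * (phi' t - 2 * C * phi t)).
  have h := derM (der_expR (derZ (- (2 * C)) (der_id t))) (dphi t).
  by apply: (is_derive_eq h); ring.
have cpsi : {within `[0, 1], continuous psi}.
  apply: continuous_subspaceT => t; apply: differentiable_continuous.
  by apply/derivable1_diffP; have [] := dpsi t.
have : psi 1 <= psi 0.
  have d1 (t : R) : t \in `]0, 1[%R -> derivable psi t 1 by move=> _; have [] := dpsi t.
  have d2 (t : R) : t \in `]0, 1[%R -> derive1 psi t <= 0.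
    rewrite in_itv/= => /andP[t0 _]; rewrite derive1E; have [_ ->] := dpsi t.
    by rewrite pmulr_rle0 ?expR_gt0// subr_le0 ineq.
  exact: (ler0_derive1_nincr d1 d2 cpsi).
rewrite /psi (_ : phi 0 = 0); last by rewrite /phi big1// => w _; rewrite u0 expr0n.
rewrite mulr0 pmulr_rle0 ?expR_gt0// => phi1.
have : u w0 1 ^+ 2 <= 0.
  apply: le_trans phi1; rewrite /phi (bigD1 w0)//= lerDl.
  by apply: sumr_ge0 => w _; rewrite sqr_ge0.
by move=> h; apply/eqP; rewrite -sqrf_eq0 eq_le h sqr_ge0.
Qed.

End OdeUniqueness.

Lemma line_derive (R : realType) (d : nat) (f : 'rV[R]_d -> R) g (c : R -> 'rV[R]_d)
    (v : 'rV[R]_d) (t : R) : C1grad f g -> (forall h s, c (h + s) = h *: v + c s) ->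
  is_derive t (1 : R) (fun t => f (c t)) (\sum_j v 0 j * g j (c t)).
Proof.
move=> [_ _ /(_ (c t) v)] [df vf] hc.
have E : (fun h : R => h^-1 *: (((fun t => f (c t)) \o shift t) (h *: (1 : R)) - f (c t)))
   = (fun h : R => h^-1 *: ((f \o shift (c t)) (h *: v) - f (c t))).
  by apply/funext => h /=; rewrite [h *: 1]mulr1 hc.
by split; rewrite /derivable /derive E.
Qed.

Section DunklRay.
Variables (R : realType) (d : nat) (k : R).

(** Exchanging [i] and [j] and averaging leaves [y_j / (y_j - y_i) + y_i / (y_i - y_j) = 1]. This is
    why the denominators of the Dunkl operators disappear along rays. *)
Lemma sum_pair_antisym (y : 'rV[R]_d) (A : 'I_d -> 'I_d -> R) : regular y ->
  (forall i j, A i j = A j i) ->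
  \sum_j y 0 j * \sum_(i < d | i != j) A i j / (y 0 j - y 0 i) =
  2^-1 * \sum_j \sum_(i < d | i != j) A i j.
Proof.
move=> ry As.
have sw (F : 'I_d -> 'I_d -> R) :
    \sum_j \sum_(i < d | i != j) F i j = \sum_j \sum_(i < d | i != j) F j i.
  rewrite (exchange_big_dep predT)//=; apply: eq_bigr => j _.
  by apply: eq_bigl => i; rewrite eq_sym.
set S := LHS.
have e1 : S = \sum_j \sum_(i < d | i != j) y 0 j * (A i j / (y 0 j - y 0 i)).
  by apply: eq_bigr => j _; rewrite mulr_sumr.
have e2 : S = \sum_j \sum_(i < d | i != j) y 0 i * (A i j / (y 0 i - y 0 j)).
  by rewrite e1 sw; apply: eq_bigr => j _; apply: eq_bigr => i _; rewrite As.
have : S + S = \sum_j \sum_(i < d | i != j) A i j.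
  rewrite {1}e1 e2 -big_split/=; apply: eq_bigr => j _.
  rewrite -big_split/=; apply: eq_bigr => i ij.
  have h1 : y 0 j - y 0 i != 0 by rewrite subr_eq0 eq_sym ry.
  have h2 : y 0 i - y 0 j != 0 by rewrite subr_eq0 ry.
  by field; rewrite h1 h2.
by move=> <-; lra.
Qed.

Lemma dunkl_euler (f : 'rV[R]_d -> R) (X y : 'rV[R]_d) : regular y ->
  (forall j, dunkl k j f y = X 0 j * f y) ->
  \sum_j y 0 j * 'D_(e_ R j) f y =
  - (k / 2 * \sum_j \sum_(i < d | i != j) (f y - f (swap_coord i j y)))
  + (\sum_j X 0 j * y 0 j) * f y.
Proof.
move=> ry T.
have sc i j : swap_coord i j y = swap_coord j i y by rewrite /swap_coord tpermC.
have : \sum_j y 0 j * dunkl k j f y = (\sum_j X 0 j * y 0 j) * f y.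
  by rewrite mulr_suml; apply: eq_bigr => j _; rewrite T; ring.
have -> : \sum_j y 0 j * dunkl k j f y = \sum_j y 0 j * 'D_(e_ R j) f y +
    k * \sum_j y 0 j * \sum_(i < d | i != j) (f y - f (swap_coord i j y)) / (y 0 j - y 0 i).
  rewrite mulr_sumr -big_split/=; apply: eq_bigr => j _; rewrite /dunkl; ring.
rewrite (sum_pair_antisym (A := fun i j => f y - f (swap_coord i j y)))//; last first.
  by move=> i j; rewrite sc.
by move=> <-; ring.
Qed.

Lemma swap_perm_act (i j : 'I_d) (w : 'S_d) (x : 'rV[R]_d) :
  swap_coord i j (perm_act w x) = perm_act (tperm i j * w)%g x.
Proof. by apply/rowP => l; rewrite !mxE permM. Qed.

Lemma perm_actZ (w : 'S_d) (t : R) (x : 'rV[R]_d) :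
  perm_act w (t *: x) = t *: perm_act w x.
Proof. by apply/rowP => l; rewrite !mxE. Qed.

Lemma regular_perm_act (w : 'S_d) (x : 'rV[R]_d) : regular x -> regular (perm_act w x).
Proof. by move=> rx i j ij; rewrite !mxE rx// (inj_eq perm_inj). Qed.

Lemma regularZ (t : R) (x : 'rV[R]_d) : t != 0 -> regular x -> regular (t *: x).
Proof. by move=> t0 rx i j ij; rewrite !mxE (inj_eq (mulfI t0)) rx. Qed.

Lemma ray_derive (f : 'rV[R]_d -> R) g (x : 'rV[R]_d) (t : R) : C1grad f g ->
  is_derive t (1 : R) (fun t => f (t *: x)) (\sum_j x 0 j * g j (t *: x)).
Proof. by move=> fC1; apply: (line_derive _ fC1) => h s; exact: scalerDl. Qed.

(** Reflecting [perm_act w x] multiplies [w] on the left by a transposition, so the rays indexed by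
    the symmetric group form a closed system. The sum runs over ordered pairs, each transposition
    twice, hence [k / 2]. *)
Lemma dunkl_ray_ode (f : 'rV[R]_d -> R) (X x : 'rV[R]_d) (w : 'S_d) (t : R) :
  regular x -> (forall j y, regular y -> dunkl k j f y = X 0 j * f y) -> 0 < t ->
  let u w t := f (t *: perm_act w x) in
  t * (\sum_j perm_act w x 0 j * 'D_(e_ R j) f (t *: perm_act w x)) =
  - (k / 2 * \sum_(p : 'I_d * 'I_d | p.2 != p.1) (u w t - u (tperm p.2 p.1 * w)%g t))
  + t * ((\sum_j X 0 j * perm_act w x 0 j) * u w t).
Proof.
move=> rx T t0 u.
have ry : regular (t *: perm_act w x).
  by apply: regularZ; [rewrite gt_eqF|exact: regular_perm_act].
have := dunkl_euler ry (fun j => T j _ ry).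
rewrite mulr_sumr; under eq_bigr do rewrite mxE -mulrA.
move=> ->; congr (- (_ * _) + _).
  rewrite pair_big_dep/=; apply: eq_bigr => -[i j] _ /=.
  by rewrite /u -perm_actZ swap_perm_act !perm_actZ.
rewrite mulrA; congr (_ * _); rewrite mulr_sumr; apply: eq_bigr => j _.
by rewrite mxE mulrCA.
Qed.

End DunklRay.

(** * The interlacing weight *)

Section SignedPower.
Variable R : realType.
Implicit Types (x y e : R).

Lemma der_abspow e y : y != 0 ->
  is_derive y (1 : R) (fun z => powR `|z| e) (e * powR `|y| (e - 1) * Num.sg y).
Proof.
move=> y0.
have sy : 0 < Num.sg y * y by rewrite -normrEsg normr_gt0.
have h : is_derive y (1 : R) (fun z => powR (Num.sg y * z) e)
    (e * powR (Num.sg y * y) (e - 1) * (Num.sg y * 1)).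
  by apply: (der_comp (is_derive1_powR e sy)); apply: derZ; exact: der_id.
rewrite mulr1 -normrEsg in h.
have sz : \forall z \near y, 0 < Num.sg y * z.
  have [yn|yp|y00] := ltgtP y 0; last by rewrite y00 eqxx in y0.
    by near=> z; rewrite ltr0_sg// mulN1r oppr_gt0; near: z; exact: lt_nbhsl.
  by near=> z; rewrite gtr0_sg// mul1r; near: z; exact: lt_nbhsr.
apply: near_eq_is_derive h; apply: filterS sz => z hz.
suff -> : `|z| = Num.sg y * z by [].
by rewrite -[RHS]gtr0_norm// normrM normr_sg y0 mul1r.
Unshelve. all: by end_near. Qed.

(** The odd power function. For [e > 0] it is continuous also at 0, and its derivative elsewhere is
    [e] times a one-node weight, so it is the antiderivative to use on either side of a node. *)
Definition spow e y : R := y * powR `|y| (e - 1).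

Lemma der_spow e y : y != 0 -> is_derive y (1 : R) (spow e) (e * powR `|y| (e - 1)).
Proof.
move=> y0; have h := derM (der_id y) (der_abspow (e - 1) y0).
apply: (is_derive_eq h); rewrite mul1r.
have e1 : powR `|y| (e - 1) = `|y| * powR `|y| (e - 1 - 1).
  rewrite [in RHS]powRB ?normr_eq0 ?y0 ?implybT// powRr1// mulrCA divff ?mulr1//.
  by rewrite normr_eq0.
rewrite !e1; set p := powR _ (e - 1 - 1).
have -> : y * ((e - 1) * p * Num.sg y) = (e - 1) * p * (Num.sg y * y) by ring.
by rewrite -normrEsg; ring.
Qed.

Lemma norm_spow e y : 0 < e -> `|spow e y| = powR `|y| e.
Proof.
by move=> e0; rewrite normrM (ger0_norm (powR_ge0 _ _)) mulr_powRB1.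
Qed.

Lemma cont_spow e : 0 < e -> continuous (spow e).
Proof.
move=> e0 y; have [->|y0] := eqVneq y 0; last first.
  by apply: differentiable_continuous; apply/derivable1_diffP; have [] := der_spow e y0.
apply: cont_dist => d d0.
have -> : spow e 0 = 0 by rewrite /spow mul0r.
have d1 : 0 < powR d e^-1 by apply: powR_gt0.
apply/nbhs_ballP; exists (powR d e^-1) => // z; rewrite -ball_normE/= !sub0r !normrN => hz.
rewrite norm_spow//.
have -> : d = powR (powR d e^-1) e by rewrite -powRrM mulVf ?gt_eqF// powRr1// ltW.
by apply: ge0_ler_powR; rewrite ?nnegrE ?normr_ge0 ?ltW//.
Qed.

Lemma der_shift (f : R -> R) c x df : is_derive (x - c) (1 : R) f df ->
  is_derive x (1 : R) (fun t => f (t - c)) df.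
Proof.
move=> h; have h2 : is_derive x (1 : R) (fun t => t - c) 1.
  by have := derD (der_id x) (derC x (1 : R) (- c)); rewrite addr0.
by have := der_comp (g := fun t => t - c) h h2; rewrite mulr1.
Qed.

Lemma der_continuous (f : R -> R) x df : is_derive x (1 : R) f df -> {for x, continuous f}.
Proof. by case=> h _; apply: differentiable_continuous; exact/derivable1_diffP. Qed.

Lemma der_prod (I : eqType) (r : seq I) (f : I -> R -> R) (df : I -> R) x : uniq r ->
  (forall i, i \in r -> is_derive x (1 : R) (f i) (df i)) ->
  is_derive x (1 : R) (fun t => \prod_(i <- r) f i t)
    (\sum_(i <- r) df i * \prod_(j <- r | j != i) f j x).
Proof.
elim: r => [|i r IH] /=.
  move=> _ _; rewrite big_nil.
  have -> : (fun t => \prod_(i <- [::]) f i t) = (fun=> 1) by apply/funext => t; rewrite big_nil.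
  exact: derC.
move=> /andP[ir ur] hf.
have -> : (fun t => \prod_(j <- i :: r) f j t) = (fun t => f i t * \prod_(j <- r) f j t).
  by apply/funext => t; rewrite big_cons.
have h := derM (hf i (mem_head _ _)) (IH ur (fun j jr => hf j (mem_behead (s := i :: r) jr))).
apply: (is_derive_eq h).
rewrite big_cons; congr (_ + _).
  rewrite big_cons eqxx/=; congr (_ * _).
  rewrite [LHS]big_seq [RHS]big_seq_cond; apply: eq_bigl => j.
  by rewrite andbC; have [->|//] := eqVneq j i; rewrite (negPf ir).
rewrite mulr_sumr [LHS]big_seq [RHS]big_seq; apply: eq_bigr => j jr.
have ij : i != j by apply: contraNneq ir => ->.
by rewrite big_cons ij mulrCA.
Qed.

(** A power is monotone on the positive reals, increasing or decreasing with the sign of [e], so one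
    endpoint always dominates; the sum covers both cases. *)
Lemma powR_between u v y e : 0 < u -> 0 < v -> (u <= y <= v) || (v <= y <= u) ->
  powR y e <= powR u e + powR v e.
Proof.
wlog uv : u v / (u <= y <= v).
  move=> H u0 v0 /orP[h|h]; first by apply: H => //; rewrite h.
  by rewrite addrC; apply: H => //; rewrite h.
move=> u0 v0 _; case/andP: uv => uy yv; have y0 : 0 < y := lt_le_trans u0 uy.
have [e0|e0] := leP 0 e.
  by apply: ler_wpDl; [exact: powR_ge0|apply: ge0_ler_powR; rewrite ?nnegrE// ltW].
apply: ler_wpDr; first exact: powR_ge0.
rewrite -[e]opprK !(powRN _ (- e)) lef_pV2 ?posrE ?powR_gt0//.
by apply: ge0_ler_powR; rewrite ?nnegrE ?oppr_ge0// ltW.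
Qed.

End SignedPower.

Section PowIntegrable.
Variable R : realType.
Local Notation mu := (@lebesgue_measure R).

Lemma integrable_oo_cc (a b : R) (f : R -> R) :
  mu.-integrable `]a, b[ (EFin \o f) -> mu.-integrable `[a, b] (EFin \o f).
Proof.
move=> /integrableP[/measurable_EFinP mf intf].
apply/integrableP; split; first by apply/measurable_EFinP; exact: measurable_fun_itv_cc mf.
rewrite integral_itv_bndoo//.
by apply: measurableT_comp => //; exact/measurable_EFinP.
Qed.

Lemma integrable_abspow_l (a b e : R) : a < b -> 0 < e ->
  mu.-integrable `]a, b[ (EFin \o (fun x => powR `|x - a| (e - 1))).
Proof.
move=> ab e0.
have ne x : a < x < b -> x - a != 0.
  by move=> /andP[ax xb]; rewrite subr_eq0 gt_eqF.
have ei : 0 <= e^-1 by rewrite invr_ge0 ltW.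
have h1 x : a < x < b -> 0 <= powR `|x - a| (e - 1) by move=> _; exact: powR_ge0.
have h2 x : a < x < b -> {for x, continuous (fun x => powR `|x - a| (e - 1))}.
  by move=> /ne xe; exact: der_continuous (der_shift (der_abspow (e - 1) xe)).
have h3 x : a < x < b ->
    is_derive x (1 : R) (fun x => spow e (x - a) / e) (powR `|x - a| (e - 1)).
  move=> /ne xe; have h := derM (der_shift (der_spow e xe)) (derC x (1 : R) e^-1).
  by apply: (is_derive_eq h); rewrite mulr0 addr0 mulrAC divff ?mul1r// gt_eqF.
have h4 x : a < x < b -> `|spow e (x - a) / e| <= powR (b - a) e / e.
  move=> /andP[ax xb]; rewrite normrM norm_spow// (ger0_norm ei).
  rewrite ler_pM2r ?invr_gt0// gtr0_norm ?subr_gt0//.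
  by apply: ge0_ler_powR; rewrite ?nnegrE ?subr_ge0 ?lerB// ltW// (lt_trans ax).
exact: (ge0_derive_integrable ab h1 h2 h3 h4).
Qed.

Lemma integrable_abspow_r (a b e : R) : a < b -> 0 < e ->
  mu.-integrable `]a, b[ (EFin \o (fun x => powR `|x - b| (e - 1))).
Proof.
move=> ab e0.
have ne x : a < x < b -> x - b != 0.
  by move=> /andP[ax xb]; rewrite subr_eq0 lt_eqF.
have ei : 0 <= e^-1 by rewrite invr_ge0 ltW.
have h1 x : a < x < b -> 0 <= powR `|x - b| (e - 1) by move=> _; exact: powR_ge0.
have h2 x : a < x < b -> {for x, continuous (fun x => powR `|x - b| (e - 1))}.
  by move=> /ne xe; exact: der_continuous (der_shift (der_abspow (e - 1) xe)).
have h3 x : a < x < b ->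
    is_derive x (1 : R) (fun x => spow e (x - b) / e) (powR `|x - b| (e - 1)).
  move=> /ne xe; have h := derM (der_shift (der_spow e xe)) (derC x (1 : R) e^-1).
  by apply: (is_derive_eq h); rewrite mulr0 addr0 mulrAC divff ?mul1r// gt_eqF.
have h4 x : a < x < b -> `|spow e (x - b) / e| <= powR (b - a) e / e.
  move=> /andP[ax xb]; rewrite normrM norm_spow// (ger0_norm ei).
  rewrite ler_pM2r ?invr_gt0// ltr0_norm ?subr_lt0// opprB.
  by apply: ge0_ler_powR; rewrite ?nnegrE ?subr_ge0 ?lerB// ltW// (lt_trans ax).
exact: (ge0_derive_integrable ab h1 h2 h3 h4).
Qed.

End PowIntegrable.

Section InterlacingWeight.
Variables (R : realType) (n : nat) (lam : 'rV[R]_n.+1).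
Hypothesis lamC : chamber lam.
Local Notation mu := (@lebesgue_measure R).

(** With indices from 0, variable [s] lies between nodes [s + 1] and [s]. Both indices are at most
    [n], so [inord] never returns its default. *)
Definition lo (s : 'I_n) : R := lam 0 (inord s.+1).
Definition hi (s : 'I_n) : R := lam 0 (inord s).

(** On the interlacing box [W_k] is the product over the variables of this function with all
    exponents equal to [k] ([W_k_wgt]). Separate exponents per node are needed to raise them one at
    a time in the recursion of the Dixon-Anderson integral. *)
Definition wgt (al : 'I_n.+1 -> R) (x : R) : R :=
  \prod_r powR `|x - lam 0 r| (al r - 1).
Definition node_poly (x : R) : R := \prod_r (x - lam 0 r).
Definition node_minor (r : 'I_n.+1) (x : R) : R := \prod_(q | q != r) (x - lam 0 q).

Lemma chamber_le (i j : 'I_n.+1) : (i <= j)%N -> lam 0 j <= lam 0 i.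
Proof.
by rewrite leq_eqVlt => /orP[/eqP/val_inj ->//|ij]; rewrite ltW// lamC.
Qed.

Lemma chamber_inj (i j : 'I_n.+1) : i != j -> lam 0 i != lam 0 j.
Proof.
rewrite -val_eqE neq_ltn => /orP[/lamC|/lamC] h; first by rewrite gt_eqF.
by rewrite lt_eqF.
Qed.

Lemma lo_lt_hi s : lo s < hi s.
Proof.
by apply: lamC; rewrite !inordK// ltnS ?ltn_ord// ltnW// ltn_ord.
Qed.

Lemma hi_le (s : 'I_n) (r : 'I_n.+1) : (r <= s)%N -> hi s <= lam 0 r.
Proof. by move=> rs; apply: chamber_le; rewrite inordK// ltnS ltnW. Qed.

Lemma le_lo (s : 'I_n) (r : 'I_n.+1) : (s < r)%N -> lam 0 r <= lo s.
Proof. by move=> rs; apply: chamber_le; rewrite inordK// ltnS ltn_ord. Qed.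

Lemma inside_neq s x r : lo s < x < hi s -> x - lam 0 r != 0.
Proof.
move=> /andP[lx xh]; rewrite subr_eq0; have [rs|rs] := leqP r s.
  by rewrite lt_eqF// (lt_le_trans xh)// hi_le.
by rewrite gt_eqF// (le_lt_trans _ lx)// le_lo.
Qed.

Variable al : 'I_n.+1 -> R.
Hypothesis al0 : forall r, 0 < al r.

Lemma wgt_ge0 x : 0 <= wgt al x.
Proof. by apply: prodr_ge0 => r _; exact: powR_ge0. Qed.

Lemma measurable_abspow (D : set R) c e : measurable_fun D (fun x => powR `|x - c| e).
Proof.
have -> : (fun x => powR `|x - c| e) = (@powR R ^~ e) \o (fun x => `|x - c|) by [].
apply: measurable_funTS; apply: measurableT_comp; first exact: measurable_powR.
apply: continuous_measurable_fun.
have c1 : continuous (fun x : R => x - c) by apply: contB; [exact: cont_id|exact: contC].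
exact: (cont_comp c1 (@norm_continuous _ R)).
Qed.

(** Only the two endpoint nodes give singular factors: all others are bounded on the interval by
    [K], and the product of the two singular ones is dominated by a combination of the two
    separately integrable powers. *)
Lemma weight_wgt s : weight (lo s) (hi s) (wgt al).
Proof.
have lh := lo_lt_hi s; split=> //; first by move=> x _; exact: wgt_ge0.
pose r1 : 'I_n.+1 := inord s.+1; pose r2 : 'I_n.+1 := inord s.
have r12 : r1 != r2.
  by rewrite -val_eqE /= !inordK// ?ltnS ?ltn_ord ?gtn_eqF// ltnW// ltn_ord.
pose B e r := powR `|lo s - lam 0 r| e + powR `|hi s - lam 0 r| e.
pose L := hi s - lo s.
have L0 : 0 < L by rewrite subr_gt0.
pose M e := powR (L / 2) e + powR L e.
pose K := \prod_(r | (r != r1) && (r != r2)) B (al r - 1) r.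
have K0 : 0 <= K by apply: prodr_ge0 => r _; rewrite addr_ge0 ?powR_ge0.
have M0 e : 0 <= M e by rewrite addr_ge0 ?powR_ge0.
pose G x := K * (M (al r2 - 1) * powR `|x - lo s| (al r1 - 1)
   + M (al r1 - 1) * powR `|x - hi s| (al r2 - 1)).
have iG : mu.-integrable `](lo s), (hi s)[ (EFin \o G).
  have -> : EFin \o G = (fun x => K%:E * ((M (al r2 - 1))%:E * (powR `|x - lo s| (al r1 - 1))%:E
       + (M (al r1 - 1))%:E * (powR `|x - hi s| (al r2 - 1))%:E))%E.
    by apply/funext => x; rewrite /G /= EFinM EFinD !EFinM.
  apply: integrableZl => //; apply: integrableD => //; apply: integrableZl => //.
    exact: integrable_abspow_l.
  exact: integrable_abspow_r.
apply: (le_integrable _ _ _ iG) => //.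
  apply/measurable_EFinP; apply: measurable_prod => r _; exact: measurable_abspow.
move=> x /=; rewrite in_itv/= => /[dup] xin /andP[lx xh].
have bnd r : (r != r1) && (r != r2) -> powR `|x - lam 0 r| (al r - 1) <= B (al r - 1) r.
  move=> /andP[h1 h2]; apply: powR_between.
  - rewrite normr_gt0 subr_eq0 /lo -/r1; apply: chamber_inj; by rewrite eq_sym.
  - rewrite normr_gt0 subr_eq0 /hi -/r2; apply: chamber_inj; by rewrite eq_sym.
  have [rs|rs] := leqP r s.
    have h := hi_le rs; rewrite !ler0_norm; lra.
  have h := le_lo rs; rewrite !ger0_norm; lra.
(* In each half of the interval the distance to the far endpoint lies between [L / 2] and [L], so
   its power is at most [M]. *)
have two : powR `|x - lo s| (al r1 - 1) * powR `|x - hi s| (al r2 - 1) <=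
    M (al r2 - 1) * powR `|x - lo s| (al r1 - 1) + M (al r1 - 1) * powR `|x - hi s| (al r2 - 1).
  have L20 : 0 < L / 2 by rewrite divr_gt0.
  have [xm|xm] := leP (x - lo s) (L / 2).
    apply: ler_wpDr; first by rewrite mulr_ge0// powR_ge0.
    rewrite mulrC ler_wpM2r ?powR_ge0//; apply: powR_between => //.
    rewrite ltr0_norm ?subr_lt0//; move: xm lx; rewrite /L; lra.
  apply: ler_wpDl; first by rewrite mulr_ge0// powR_ge0.
  rewrite ler_wpM2r ?powR_ge0//; apply: powR_between => //.
  rewrite gtr0_norm ?subr_gt0//; move: xm xh; rewrite /L; lra.
rewrite lee_fin (ger0_norm (wgt_ge0 x)); apply: le_trans (ler_norm _).
rewrite /wgt (bigD1 r1)//= (bigD1 r2)/=; last by rewrite eq_sym.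
rewrite mulrA mulrC /G; apply: ler_pM.
- by apply: prodr_ge0 => r _; exact: powR_ge0.
- by rewrite mulr_ge0// powR_ge0.
- by apply: ler_prod => r hr; rewrite powR_ge0 bnd.
- exact: two.
Qed.

Lemma node_poly_wgt x : node_poly x * wgt al x = \prod_r spow (al r) (x - lam 0 r).
Proof. by rewrite /node_poly /wgt -big_split. Qed.

Lemma node_minorE r x : node_poly x = (x - lam 0 r) * node_minor r x.
Proof. by rewrite /node_poly (bigD1 r). Qed.

(** Multiplication by [node_poly] turns every factor of the weight into a signed power
    [spow (al r)]. The derivative is then a polynomial times the original weight, no worse than the
    weight itself. *)
Lemma der_node_wgt s x : lo s < x < hi s ->
  is_derive x (1 : R) (fun x => node_poly x * wgt al x)
    ((\sum_r al r * node_minor r x) * wgt al x).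
Proof.
move=> xin.
have -> : (fun x => node_poly x * wgt al x) = (fun x => \prod_r spow (al r) (x - lam 0 r)).
  by apply/funext => y; exact: node_poly_wgt.
have h := der_prod (index_enum_uniq _) (fun r _ => der_shift (der_spow (al r) (inside_neq r xin))).
apply: (is_derive_eq h).
rewrite mulr_suml; apply: eq_bigr => r _.
have -> : \prod_(j | j != r) spow (al j) (x - lam 0 j) =
    node_minor r x * \prod_(j | j != r) powR `|x - lam 0 j| (al j - 1).
  by rewrite -big_split.
by rewrite [wgt al x](bigD1 r)//=; ring.
Qed.

Lemma cont_horner_prod (P : pred 'I_n.+1) :
  continuous (fun x => \prod_(r | P r) (x - lam 0 r)).
Proof.
apply: cont_prod => r _.
by apply: contB; [exact: cont_id|exact: contC].
Qed.

Lemma cont_node_poly : continuous node_poly.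
Proof. exact: cont_horner_prod. Qed.

Lemma cont_node_minor r : continuous (node_minor r).
Proof. exact: cont_horner_prod. Qed.

Lemma cont_node_wgt : continuous (fun x => node_poly x * wgt al x).
Proof.
have -> : (fun x => node_poly x * wgt al x) = (fun x => \prod_r spow (al r) (x - lam 0 r)).
  by apply/funext => y; exact: node_poly_wgt.
apply: cont_prod => r _.
have c1 : continuous (fun x : R => x - lam 0 r) by apply: contB; [exact: cont_id|exact: contC].
exact: (cont_comp c1 (cont_spow (al0 r))).
Qed.

Lemma cont_wgt s x : lo s < x < hi s -> {for x, continuous (wgt al)}.
Proof.
move=> xin; rewrite /wgt.
have h := der_prod (index_enum_uniq _) (fun r _ =>
  der_shift (der_abspow (al r - 1) (inside_neq r xin))).
exact: der_continuous h.
Qed.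

Lemma node_poly_lo s : node_poly (lo s) = 0.
Proof. by rewrite (node_minorE (inord s.+1)) subrr mul0r. Qed.

Lemma node_poly_hi s : node_poly (hi s) = 0.
Proof. by rewrite (node_minorE (inord s)) subrr mul0r. Qed.

(** Integration by parts for [node_poly * wgt * H]: the boundary terms vanish because this function
    is continuous and [node_poly] is zero at both endpoints. Every vanishing integral below comes
    from here. *)
Lemma wgt_ibp s (H H' : R -> R) :
  (forall t : R, is_derive t (1 : R) H (H' t)) -> continuous H' ->
  wint (lo s) (hi s) (wgt al)
    (fun t => (\sum_r al r * node_minor r t) * H t + node_poly t * H' t) = 0.
Proof.
move=> dH cH'.
have cH : continuous H by move=> t; exact: der_continuous (dH t).
pose g t := (\sum_r al r * node_minor r t) * H t + node_poly t * H' t.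
have cg : continuous g.
  apply: contD; apply: contM => //; last exact: cont_node_poly.
  apply: cont_sum => r _.
  by apply: contM; [exact: contC|exact: cont_node_minor].
have ig := wint_integrable (weight_wgt s) cg.
pose F t := node_poly t * wgt al t * H t.
have cF : continuous F by apply: contM => //; exact: cont_node_wgt.
have F0 t : node_poly t = 0 -> F t = 0 by move=> h; rewrite /F h !mul0r.
have dF t : lo s < t < hi s -> is_derive t (1 : R) F (g t * wgt al t).
  move=> tin; have h := derM (der_node_wgt tin) (dH t).
  by apply: (is_derive_eq h); rewrite /g; ring.
have cf t : lo s < t < hi s -> {for t, continuous (fun t => g t * wgt al t)}.
  by move=> tin; apply: continuousM; [exact: cg|exact: cont_wgt tin].
have Fl : F x @[x --> (lo s)^'+] --> (0 : R).
  by rewrite -(F0 _ (node_poly_lo s)); apply: cvg_at_right_filter; exact: cF.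
have Fh : F x @[x --> (hi s)^'-] --> (0 : R).
  by rewrite -(F0 _ (node_poly_hi s)); apply: cvg_at_left_filter; exact: cF.
have e := FTC_open (lo_lt_hi s) (integrable_oo_cc ig) cf dF Fl Fh.
transitivity (Rintegral mu `[lo s, hi s] (fun t => g t * wgt al t)).
  rewrite /wint /Rintegral [in RHS]integral_itv_bndoo//.
  by case/integrableP: ig.
by rewrite e subrr.
Qed.

End InterlacingWeight.

(** * Determinants of polynomial families and their integrals *)

Section VandermondeFamily.
Variable R : comNzRingType.

Lemma det_poly_family m (f : 'I_m -> {poly R}) (y : 'rV[R]_m) :
  (forall p, (size (f p) <= m)%N) ->
  \det (\matrix_(p, c) (f p).[y 0 c]) =
  \det (\matrix_(p, i) (f p)`_i) * \det (Vandermonde m y).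
Proof.
move=> sf; rewrite -det_mulmx; congr (\det _); apply/matrixP => p c.
rewrite !mxE (horner_coef_wide _ (sf p)); apply: eq_bigr => i _.
by rewrite !mxE.
Qed.

Definition snoc_row n (v : 'rV[R]_n) (x : R) : 'rV[R]_n.+1 :=
  \row_c (if unlift ord_max c is Some s then v 0 s else x).

Lemma snoc_lift n (v : 'rV[R]_n) x s : snoc_row v x 0 (lift ord_max s) = v 0 s.
Proof. by rewrite mxE liftK. Qed.

Lemma snoc_max n (v : 'rV[R]_n) x : snoc_row v x 0 ord_max = x.
Proof. by rewrite mxE unlift_none. Qed.

Lemma widen_lift n (s : 'I_n) : widen_ord (leqnSn n) s = lift ord_max s.
Proof. by apply: val_inj; rewrite /= /bump leqNgt ltn_ord add0n. Qed.

Lemma det_Vandermonde_snoc n (v : 'rV[R]_n) x :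
  \det (Vandermonde n.+1 (snoc_row v x)) = \det (Vandermonde n v) * \prod_s (x - v 0 s).
Proof.
rewrite !det_Vandermonde big_ord_recr/= [X in _ * X]big1 ?mulr1; last first.
  by move=> j; rewrite ltnNge -ltnS ltn_ord.
rewrite -big_split/=; apply: eq_bigr => i _.
rewrite big_mkcond big_ord_recr/= ltn_ord !widen_lift snoc_max !snoc_lift.
congr (_ * _); rewrite [RHS]big_mkcond; apply: eq_bigr => j _.
by rewrite widen_lift snoc_lift.
Qed.

End VandermondeFamily.

Section IterDet.
Variables (R : realType) (n : nat).
Variables (a b : 'I_n -> R) (w : 'I_n -> R -> R).
Hypothesis wt : forall s, weight (a s) (b s) (w s).
Local Notation J F := (iterint a b w (rev (enum 'I_n)) F 0).
Local Notation I_ s g := (wint (a s) (b s) (w s) g).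

Lemma iterint_enum_prod (g : 'I_n -> R -> R) : (forall s, continuous (g s)) ->
  J (fun v => \prod_s g s (v 0 s)) = \prod_s I_ s (g s).
Proof.
move=> cg; rewrite iterint_prod ?rev_uniq ?enum_uniq//.
by apply: eq_bigr => s _; rewrite mem_rev mem_enum.
Qed.

Lemma cont_coord_prod (g : 'I_n -> R -> R) (f : 'I_n -> 'I_n) : (forall s, continuous (g s)) ->
  continuous (fun v : 'rV[R]_n => \prod_s g s (v 0 (f s))).
Proof.
move=> cg; apply: cont_prod => s _; apply: (cont_comp _ (cg s)).
exact: coord_continuous.
Qed.

Lemma cont_det_coord (q : 'I_n -> R -> R) : (forall i, continuous (q i)) ->
  continuous (fun v : 'rV[R]_n => \det (\matrix_(i, s) q i (v 0 s))).
Proof.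
move=> cq; rewrite /determinant; apply: cont_sum => u _; apply: contM; first exact: contC.
have -> : (fun v : 'rV[R]_n => \prod_i (\matrix_(i, s) q i (v 0 s)) i (u i)) =
   (fun v => \prod_i q i (v 0 (u i))).
  by apply/funext => v; apply: eq_bigr => i _; rewrite mxE.
exact: cont_coord_prod.
Qed.

(** In the Leibniz expansion each term is a product of functions of single variables, so it
    integrates factor by factor and the integrals reassemble into a determinant. *)
Lemma iterint_det (q : 'I_n -> R -> R) : (forall i, continuous (q i)) ->
  J (fun v => \det (\matrix_(i, s) q i (v 0 s))) = \det (\matrix_(i, s) I_ s (q i)).
Proof.
move=> cq.
have -> : (fun v : 'rV[R]_n => \det (\matrix_(i, s) q i (v 0 s))) =
   (fun v => \sum_(u : 'S_n) (-1) ^+ u * \prod_i q i (v 0 (u i))).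
  apply/funext => v; apply: eq_bigr => u _; congr (_ * _).
  by apply: eq_bigr => i _; rewrite mxE.
have cp (u : 'S_n) : continuous (fun v : 'rV[R]_n => \prod_i q i (v 0 (u i))).
  exact: cont_coord_prod.
rewrite (iterint_sum wt); last by move=> u _; apply: contM; [exact: contC|exact: cp].
apply: eq_bigr => u _; rewrite (iterintZ wt)//; congr (_ * _).
have -> : (fun v : 'rV[R]_n => \prod_i q i (v 0 (u i))) =
    (fun v => \prod_s q ((u^-1)%g s) (v 0 s)).
  apply/funext => v; rewrite [RHS](reindex_inj (@perm_inj _ u)).
  by apply: eq_bigr => i _; rewrite permK.
rewrite (iterint_enum_prod (g := fun s => q ((u^-1)%g s)))// (reindex_inj (@perm_inj _ u)).
by apply: eq_bigr => i _; rewrite permK mxE.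
Qed.

Definition last_col_mx (T : Type) (m : nat) (A : 'I_m.+1 -> 'I_m -> T) (h : 'I_m.+1 -> T) : 'M[T]_m.+1 :=
  \matrix_(p, c) (if unlift ord_max c is Some s then A p s else h p).

Lemma det_last_col (m : nat) (A : 'I_m.+1 -> 'I_m -> R) h :
  \det (last_col_mx A h) = \sum_p h p * ((-1) ^+ (p + m) *
    \det (\matrix_(i, s) A (lift p i) s)).
Proof.
rewrite (expand_det_col _ ord_max); apply: eq_bigr => p _.
rewrite mxE unlift_none /cofactor; congr (_ * (_ * \det _)).
by apply/matrixP => i s; rewrite !mxE liftK.
Qed.

Lemma iterint_det_col (q : 'I_n.+1 -> R -> R) (h : 'I_n.+1 -> R) :
  (forall i, continuous (q i)) ->
  J (fun v => \det (last_col_mx (fun p s => q p (v 0 s)) h)) =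
  \det (last_col_mx (fun p s => I_ s (q p)) h).
Proof.
move=> cq; under eq_fun do rewrite det_last_col.
have cd p : continuous (fun v : 'rV[R]_n => \det (\matrix_(i, s) q (lift p i) (v 0 s))).
  exact: (@cont_det_coord (fun i => q (lift p i))).
rewrite (iterint_sum wt); last first.
  by move=> p _; apply: contM; [exact: contC|apply: contM; [exact: contC|exact: cd]].
rewrite det_last_col; apply: eq_bigr => p _.
rewrite (iterintZ wt); last by apply: contM; [exact: contC|exact: cd].
by rewrite (iterintZ wt)// (@iterint_det (fun i => q (lift p i))).
Qed.

Lemma det_last_row0 (m : nat) (A : 'I_m.+1 -> 'I_m -> R) h :
  (forall s, A ord_max s = 0) ->
  \det (last_col_mx A h) = h ord_max * \det (\matrix_(i, s) A (lift ord_max i) s).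
Proof.
move=> A0; rewrite (expand_det_row _ ord_max) (bigD1 ord_max)//= big1 ?addr0; last first.
  move=> c cm; rewrite mxE.
  by case: unliftP cm => [s _|->]; [rewrite A0 mul0r|rewrite eqxx].
rewrite mxE unlift_none /cofactor addnn -signr_odd odd_double expr0 mul1r.
by congr (_ * \det _); apply/matrixP => i s; rewrite !mxE liftK.
Qed.

(* Two monic families have the same Vandermonde determinant, so the top monomial may be
   replaced by a monic polynomial [B] that all the functionals [I_ s] annihilate. *)
Lemma iterint_Vandermonde_orth (B : {poly R}) (x : R) :
  (size B <= n.+1)%N -> B`_n = 1 -> (forall s, I_ s (fun t => B.[t]) = 0) ->
  J (fun v => \det (Vandermonde n v) * \prod_s (x - v 0 s)) =
  B.[x] * J (fun v => \det (Vandermonde n v)).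
Proof.
move=> sB lB IB.
pose f (p : 'I_n.+1) : {poly R} := if unlift ord_max p is Some i then 'X^i else B.
have fm : f ord_max = B by rewrite /f unlift_none.
have fl i : f (lift ord_max i) = 'X^i by rewrite /f liftK.
have sf p : (size (f p) <= n.+1)%N.
  rewrite /f; case: unliftP => [i _|_]; last by [].
  by rewrite size_polyXn ltnS ltnW.
have det1 : \det (\matrix_(p, i) (f p)`_i) = 1 :> R.
  rewrite det_trig.
    apply: big1 => p _; rewrite mxE /f; case: unliftP => [i ->|->]; last by [].
    by rewrite coefXn -widen_lift eqxx.
  apply/is_trig_mxP => p i pi; rewrite mxE /f; case: unliftP pi => [j ->|->].
    by rewrite -widen_lift coefXn/= => /gtn_eqF ->.
  by rewrite /= ltnNge -ltnS ltn_ord.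
have cf p : continuous (fun t => (f p).[t]) by exact: continuous_horner.
have fE (v : 'rV[R]_n) : \det (Vandermonde n v) * \prod_s (x - v 0 s) =
    \det (last_col_mx (fun p s => (f p).[v 0 s]) (fun p => (f p).[x])).
  rewrite -det_Vandermonde_snoc -[LHS]mul1r -det1 -det_poly_family//.
  congr (\det _); apply/matrixP => p c; rewrite !mxE.
  by case: unlift.
under eq_fun do rewrite fE.
rewrite (iterint_det_col _ cf) det_last_row0; last by move=> s; rewrite fm.
rewrite fm; congr (_ * _).
have -> : (fun v : 'rV[R]_n => \det (Vandermonde n v)) =
   (fun v => \det (\matrix_(i, s) (v 0 s) ^+ (i : 'I_n))).
  by apply/funext => v; congr (\det _); apply/matrixP => i s; rewrite !mxE.
rewrite (@iterint_det (fun i t => t ^+ i)); last by move=> i; exact: exprn_continuous.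
congr (\det _); apply/matrixP => i s; rewrite !mxE; apply: eq_wint => t _.
by rewrite fl hornerXn.
Qed.

End IterDet.

(** * The Dixon-Anderson integral *)

Section PositiveIntegral.
Variable R : realType.
Local Notation mu := (@lebesgue_measure R).

(** A zero integral of a nonnegative function would make it vanish almost everywhere, whereas it is
    positive on an interval of positive length. *)
Lemma Rintegral_itv_gt0 (a b : R) (D : set R) (f : R -> R) : a < b -> measurable D ->
  (forall x, a < x < b -> D x) -> mu.-integrable D (EFin \o f) ->
  (forall x, D x -> 0 <= f x) -> (forall x, a < x < b -> 0 < f x) ->
  0 < Rintegral mu D f.
Proof.
move=> ab mD abD intf f0 fp.
have sD : `]a, b[%classic `<=` D by move=> x /=; rewrite in_itv/=; exact: abD.
rewrite lt_neqAle Rintegral_ge0// andbT eq_sym; apply/eqP => e.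
have e0 : (\int[mu]_(x in D) `|(EFin \o f) x| = 0)%E.
  transitivity (\int[mu]_(x in D) (EFin \o f) x)%E.
    by apply: eq_integral => x; rewrite inE => Dx; rewrite gee0_abs// lee_fin f0.
  by rewrite -[LHS]fineK ?integrable_fin_num//; congr EFin.
have mf : measurable_fun D (EFin \o f) by have /integrableP[] := intf.
have [N [mN N0 subN]] := (ae_eq_integral_abs mu mD mf).1 e0.
have : (mu `]a, b[ <= mu N)%E.
  apply: le_measure; rewrite ?inE// => x xab; apply: subN => /= h.
  move: (h (sD _ xab)) => [fx0]; move: xab; rewrite /= in_itv/= => /fp.
  by rewrite fx0 ltxx.
rewrite N0 lebesgue_measure_itv/= lte_fin ab -EFinD lee_fin subr_le0.
by rewrite leNgt ab.
Qed.

Lemma wint_gt0 (a b : R) (w g : R -> R) : weight a b w -> continuous g ->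
  (forall x, a < x < b -> 0 < w x) -> (forall x, a < x < b -> 0 < g x) ->
  0 < wint a b w g.
Proof.
move=> wt cg wp gp; have [ab _ _] := wt.
apply: (@Rintegral_itv_gt0 a b) => //.
- exact: wint_integrable.
- by move=> x /=; rewrite in_itv/= => xab; rewrite mulr_ge0// ltW ?wp ?gp.
- by move=> x xab; rewrite mulr_gt0 ?wp ?gp.
Qed.

End PositiveIntegral.

(** * Log-convexity and uniqueness in the style of Bohr and Mollerup *)

Section LogConvex.
Variable R : realType.
Implicit Types (u v : R -> R).

Lemma young (x y t : R) : 0 <= x -> 0 <= y -> 0 < t < 1 ->
  powR x (1 - t) * powR y t <= (1 - t) * x + t * y.
Proof.
move=> x0 y0 /andP[t0 t1].
have t1' : 0 < 1 - t by rewrite subr_gt0.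
have := @conjugate_powR R (powR x (1 - t)) (powR y t) (1 - t)^-1 t^-1
  (powR_ge0 _ _) (powR_ge0 _ _).
rewrite !invr_gt0 !invrK -!powRrM !divff ?gt_eqF// !powRr1// subrK => /(_ t1' t0 erefl).
by rewrite [x * _]mulrC [y * _]mulrC.
Qed.

(** A pointwise form of Hoelder's inequality. It is linear in [x] and [y], so it can be integrated;
    taking for [A] and [B] the two integrals afterwards makes the bracket equal to 1, as in
    [logconvex_linear]. *)
Lemma young_scaled (x y A B t : R) : 0 <= x -> 0 <= y -> 0 < A -> 0 < B -> 0 < t < 1 ->
  powR x (1 - t) * powR y t <=
  powR A (1 - t) * powR B t * ((1 - t) * (x / A) + t * (y / B)).
Proof.
move=> x0 y0 A0 B0 t01.
have [An Bn] : 0 <= A /\ 0 <= B by rewrite !ltW.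
have xA : 0 <= x / A by rewrite divr_ge0.
have yB : 0 <= y / B by rewrite divr_ge0.
have -> : powR x (1 - t) * powR y t =
    powR A (1 - t) * powR B t * (powR (x / A) (1 - t) * powR (y / B) t).
  have e1 : powR A (1 - t) * powR (x / A) (1 - t) = powR x (1 - t).
    by rewrite -powRM// mulrC divfK// gt_eqF.
  have e2 : powR B t * powR (y / B) t = powR y t.
    by rewrite -powRM// mulrC divfK// gt_eqF.
  by rewrite mulrACA e1 e2.
apply: ler_wpM2l; first by rewrite mulr_ge0// powR_ge0.
exact: young.
Qed.

Definition logconvex u := forall p q t, 1 <= p -> 1 <= q -> 0 < t < 1 ->
  u ((1 - t) * p + t * q) <= powR (u p) (1 - t) * powR (u q) t.

Lemma logconvex_linear u : (forall p, 1 <= p -> 0 < u p) ->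
  (forall p q t A B, 1 <= p -> 1 <= q -> 0 < t < 1 -> 0 < A -> 0 < B ->
     u ((1 - t) * p + t * q) <=
     powR A (1 - t) * powR B t * ((1 - t) * (u p / A) + t * (u q / B))) ->
  logconvex u.
Proof.
move=> u0 H p q t p1 q1 t01; have h := H p q t _ _ p1 q1 t01 (u0 p p1) (u0 q q1).
apply: le_trans h _; rewrite !divff ?gt_eqF ?u0//.
by rewrite !mulr1 subrK mulr1.
Qed.

Lemma logconvexM u v : (forall p, 1 <= p -> 0 <= u p) -> (forall p, 1 <= p -> 0 <= v p) ->
  logconvex u -> logconvex v -> logconvex (fun x => u x * v x).
Proof.
move=> u0 v0 lu lv p q t p1 q1 t01.
have r1 : 1 <= (1 - t) * p + t * q by move: t01 => /andP[]; nra.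
rewrite !powRM ?u0 ?v0// [leRHS]mulrACA; apply: ler_pM; rewrite ?u0 ?v0//.
  exact: lu.
exact: lv.
Qed.

Lemma logconvexX u n : (forall p, 1 <= p -> 0 <= u p) -> logconvex u ->
  logconvex (fun x => u x ^+ n).
Proof.
move=> u0 lu; elim: n => [|n IH].
  by move=> p q t _ _ _; rewrite !expr0 !powR1 mulr1.
have -> : (fun x => u x ^+ n.+1) = (fun x => u x * u x ^+ n).
  by apply/funext => x; rewrite exprS.
by apply: logconvexM => // p p1; rewrite exprn_ge0// u0.
Qed.

Lemma logconvex_powR a b c : 0 < a -> logconvex (fun x => powR a (b * x + c)).
Proof.
move=> a0 p q t _ _ _; rewrite -!powRrM -powRD; last by rewrite (gt_eqF a0) implybT.
by rewrite le_eqVlt; apply/orP; left; apply/eqP; congr powR; ring.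
Qed.

Lemma logconvex_scale u c : 1 <= c -> logconvex u -> logconvex (fun x => u (c * x)).
Proof.
move=> c1 lu p q t p1 q1 t01.
have -> : c * ((1 - t) * p + t * q) = (1 - t) * (c * p) + t * (c * q) by ring.
by apply: lu => //; nra.
Qed.

(** Convexity on [[N, N + 1]], evaluated at [N + x], with the recursion inserted for the right
    endpoint. *)
Lemma logconvex_step_le u (N x r : R) : 1 <= N -> 0 < x < 1 -> 0 < u N -> 0 <= r ->
  logconvex u -> u (N + 1) = r * u N -> u (N + x) <= u N * powR r x.
Proof.
move=> N1 x01 uN r0 lu e.
have N2 : 1 <= N + 1 by lra.
have := lu N (N + 1) x N1 N2 x01.
have -> : (1 - x) * N + x * (N + 1) = N + x by ring.
rewrite e powRM//; last exact: ltW.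
rewrite mulrCA -powRD; last by rewrite (gt_eqF uN) implybT.
by rewrite subrK powRr1 1?mulrC// ltW.
Qed.

(** Here [N + 1] is the interior point of [[N, N + 1 + x]], with weight [1 / (1 + x)] on the right
    end. Raising the inequality to the power [1 + x] isolates [u (N + 1 + x)] from below. *)
Lemma logconvex_step_ge u (N x r : R) : 1 <= N -> 0 < x < 1 -> 0 < u N ->
  0 <= u (N + 1 + x) -> 0 <= r ->
  logconvex u -> u (N + 1) = r * u N -> u (N + 1) * powR r x <= u (N + 1 + x).
Proof.
move=> N1 x01 uN uNx r0 lu e; have /andP[x0 x1] := x01.
have x10 : 0 < 1 + x by rewrite addr_gt0.
have x1n : 1 + x != 0 by rewrite gt_eqF.
pose t := (1 + x)^-1.
have t01 : 0 < t < 1 by rewrite invr_gt0 x10 invf_lt1// ltrDl.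
have N2 : 1 <= N + 1 + x by lra.
have := lu N (N + 1 + x) t N1 N2 t01.
have -> : (1 - t) * N + t * (N + 1 + x) = N + 1.
  by rewrite /t; field.
have t0 : 0 <= 1 - t by case/andP: t01 => _ /ltW; rewrite subr_ge0.
rewrite e => h.
have : powR (r * u N) (1 + x) <= powR (powR (u N) (1 - t) * powR (u (N + 1 + x)) t) (1 + x).
  by apply: ge0_ler_powR; rewrite ?nnegrE ?mulr_ge0 ?powR_ge0// ltW.
rewrite [X in _ <= X]powRM ?powR_ge0// -!powRrM.
have -> : (1 - t) * (1 + x) = x by rewrite /t; field.
have -> : t * (1 + x) = 1 by rewrite /t mulVf.
have uNn : 0 <= u N by rewrite ltW.
have rN : 0 <= r * u N by rewrite mulr_ge0.
have -> : powR (r * u N) (1 + x) = (r * u N) * (powR r x * powR (u N) x).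
  rewrite powRD; last by rewrite (negPf x1n).
  by rewrite powRr1// powRM.
rewrite powRr1// => h2.
have px : 0 < powR (u N) x by apply: powR_gt0.
rewrite -(ler_pM2l px); apply: le_trans h2.
by rewrite le_eqVlt; apply/orP; left; apply/eqP; ring.
Qed.

End LogConvex.

Section BohrMollerup.
Variable R : realType.

(** The quotient [u / v] is unchanged by integer shifts and equals 1 at positive integers. Bounding
    [u] from above and [v] from below at [M + 1 + x] gives [u x <= v x * (1 + 1 / M) ^ m], and [M]
    tends to infinity. *)
Lemma bohr_mollerup_le (u v : R -> R) (m : nat) (c : R) : 0 < c ->
  (forall x, 0 < x -> 0 < u x) -> (forall x, 0 < x -> 0 < v x) ->
  (forall x, 0 < x -> u (x + 1) = c * x ^+ m * u x) ->
  (forall x, 0 < x -> v (x + 1) = c * x ^+ m * v x) ->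
  logconvex u -> logconvex v -> u 1 = v 1 ->
  forall x, 0 < x < 1 -> u x <= v x.
Proof.
move=> c0 u0 v0 hu hv lu lv uv1 x x01; have /andP[x0 x1] := x01.
have uvN N : u N.+1%:R = v N.+1%:R.
  elim: N => [//|N IH]; rewrite -[N.+2%:R]natr1 hu ?hv ?ltr0n//.
  by rewrite IH.
have shift N : u (N%:R + x) * v x = v (N%:R + x) * u x.
  elim: N => [|N IH]; first by rewrite add0r mulrC.
  have Nx : 0 < N%:R + x by rewrite ltr_wpDl.
  have -> : N.+1%:R + x = N%:R + x + 1 by rewrite -natr1; ring.
  by rewrite hu// hv// -!mulrA IH.
have rho0 (y : R) : 0 < y -> 0 <= c * y ^+ m by move=> y0; rewrite mulr_ge0 ?exprn_ge0 ?ltW.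
have step N : u x <= v x * (1 + N.+1%:R^-1) ^+ m.
  set M : R := N.+1%:R.
  have M0 : 0 < M by rewrite ltr0n.
  have M1 : 1 <= M by rewrite ler1n.
  have M10 : 0 < M + 1 by rewrite addr_gt0.
  have vp : 0 < v (M + 1 + x) by rewrite v0// addr_gt0.
  have hu1 : u (M + 1 + x) <= u (M + 1) * powR (c * (M + 1) ^+ m) x.
    have M11 : 1 <= M + 1 by rewrite lerDr ltW.
    exact: (logconvex_step_le M11 x01 (u0 _ M10) (rho0 _ M10) lu (hu _ M10)).
  have hv1 : v (M + 1) * powR (c * M ^+ m) x <= v (M + 1 + x).
    exact: (logconvex_step_ge M1 x01 (v0 _ M0) (ltW vp) (rho0 _ M0) lv (hv _ M0)).
  have e1 : u (M + 1) = v (M + 1) by rewrite /M natr1 uvN.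
  have s1 : u (M + 1 + x) * v x = v (M + 1 + x) * u x by rewrite /M natr1 shift.
  rewrite -(ler_pM2l vp) -s1.
  have key : powR (c * (M + 1) ^+ m) x <= powR (c * M ^+ m) x * (1 + M^-1) ^+ m.
    have -> : c * (M + 1) ^+ m = c * M ^+ m * (1 + M^-1) ^+ m.
      by rewrite -mulrA -exprMn mulrDr mulr1 divff// gt_eqF.
    have b1 : 1 <= (1 + M^-1) ^+ m by rewrite exprn_ege1// lerDl invr_ge0 ltW.
    rewrite powRM ?rho0//; last by rewrite (le_trans _ b1).
    by apply: ler_wpM2l; [exact: powR_ge0|apply: ler1_powR => //; exact: ltW].
  apply: le_trans (_ : v (M + 1) * (powR (c * M ^+ m) x * (1 + M^-1) ^+ m) * v x <= _).
    rewrite ler_pM2r ?v0//; apply: le_trans hu1 _; rewrite e1.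
    by rewrite ler_pM2l ?v0.
  have b0 : 0 <= (1 + M^-1) ^+ m by rewrite exprn_ge0// addr_ge0// invr_ge0 ltW.
  have := ler_wpM2r (mulr_ge0 b0 (ltW (v0 x x0))) hv1.
  by rewrite !mulrA => h; apply: le_trans h _; rewrite le_eqVlt; apply/orP; left; apply/eqP; ring.
have cv : v x * (1 + (fun N : nat => N.+1%:R^-1) N) ^+ m @[N --> \oo] --> v x * (1 + 0) ^+ m.
  apply: cvgMl_tmp; apply: (@continuous_cvg _ _ _ _ _ _ (fun y : R => (1 + y) ^+ m)).
    have c1 : continuous (fun y : R => 1 + y) by apply: contD; [exact: contC|exact: cont_id].
    exact: (cont_comp c1 (@exprn_continuous R m)).
  exact: cvg_harmonic.
rewrite addr0 expr1n mulr1 in cv.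
apply: (ler_cvg_to (cvg_cst (u x)) cv).
by apply: nearW => N; exact: step.
Qed.

Lemma bohr_mollerup (u v : R -> R) (m : nat) (c : R) : 0 < c ->
  (forall x, 0 < x -> 0 < u x) -> (forall x, 0 < x -> 0 < v x) ->
  (forall x, 0 < x -> u (x + 1) = c * x ^+ m * u x) ->
  (forall x, 0 < x -> v (x + 1) = c * x ^+ m * v x) ->
  logconvex u -> logconvex v -> u 1 = v 1 ->
  forall x, 0 < x -> u x = v x.
Proof.
move=> c0 u0 v0 hu hv lu lv uv1.
have base x : 0 < x <= 1 -> u x = v x.
  move=> /andP[x0]; rewrite le_eqVlt => /orP[/eqP -> //|x1].
  apply/eqP; rewrite eq_le !(@bohr_mollerup_le _ _ m c)//; by [rewrite x0 x1|].
have ind N : forall x, 0 < x <= N.+1%:R -> u x = v x.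
  elim: N => [//|N IH] x /andP[x0 xN].
  have [x1|x1] := leP x 1; first by apply: base; rewrite x0 x1.
  have -> : x = x - 1 + 1 by rewrite subrK.
  have x10 : 0 < x - 1 by rewrite subr_gt0.
  rewrite hu// hv// IH// x10/= lerBlDr natr1//.
move=> x x0; apply: (ind (Num.truncn x)); rewrite x0/=.
by rewrite ltW// truncnS_gt.
Qed.

End BohrMollerup.

(** * The Gamma integral: convergence, functional equation and log-convexity *)

Section GammaFunction.
Variable R : realType.
Local Notation mu := (@lebesgue_measure R).
Implicit Types (s t : R).

Definition gammai s t : R := powR t (s - 1) * expR (- t).

Lemma powR_le_expR (e : R) : exists2 C, 0 < C &
  forall t, 1 <= t -> powR t e <= C * expR (t / 2).
Proof.
pose m := Num.truncn `|e|.
(* The exponential series gives [(t / 2) ^ (m + 1) <= (m + 1)! * exp (t / 2)], and [e <= m + 1] with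
   [t >= 1] bounds the real power by the integer one. *)
exists (2 ^+ m.+1 * m.+1`!%:R); first by rewrite mulr_gt0 ?exprn_gt0// ltr0n fact_gt0.
move=> t t1; have t0 : 0 < t by rewrite (lt_le_trans _ t1).
have em : e <= m.+1%:R by rewrite (le_trans (ler_norm _))// ltW// truncnS_gt.
apply: le_trans (ler_powR t1 em) _; rewrite powR_mulrn; last exact: ltW.
have t2 : 0 <= t / 2 by rewrite divr_ge0// ltW.
have h := expR_ge1Dxn m t2.
have f0 : 0 < m.+1`!%:R :> R by rewrite ltr0n fact_gt0.
have {}h : (t / 2) ^+ m.+1 <= m.+1`!%:R * expR (t / 2).
  rewrite -ler_pdivrMl// mulrC; apply: le_trans h; by rewrite lerDr.
rewrite -mulrA; apply: le_trans (ler_wpM2l _ h); last by rewrite exprn_ge0.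
by rewrite -exprMn mulrC divfK.
Qed.

Lemma gammai_ge0 s t : 0 <= gammai s t.
Proof. by rewrite mulr_ge0 ?powR_ge0 ?expR_ge0. Qed.

Lemma measurable_gammai s (D : set R) : measurable_fun D (gammai s).
Proof.
apply: measurable_funTS; apply: measurable_funM; first exact: measurable_powR.
apply: continuous_measurable_fun.
have c1 : continuous (fun x : R => - x) by move=> x; exact: oppr_continuous.
exact: (cont_comp c1 (@continuous_expR R)).
Qed.

(** Below 1 the integrand is dominated by a power with exponent above -1, beyond 1 by a multiple of
    the exponential density of rate [1 / 2]. *)
Lemma gammai_integrable_cy s : 0 < s -> mu.-integrable `[0, +oo[ (EFin \o gammai s).
Proof.
move=> s0.
have mg D : measurable_fun D (EFin \o gammai s) by apply/measurable_EFinP; exact: measurable_gammai.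
have iA : mu.-integrable `[0, 1] (EFin \o gammai s).
  have i1 := integrable_oo_cc (integrable_abspow_l (a := 0) (b := 1) ltr01 s0).
  apply: (le_integrable _ _ _ i1); [exact: measurable_itv|exact: mg|].
  move=> t; rewrite /= in_itv/= => /andP[t0 _].
  rewrite lee_fin ger0_norm ?gammai_ge0// ger0_norm ?powR_ge0// subr0 (ger0_norm t0).
  by rewrite ler_piMr ?powR_ge0// expR_le1 oppr_le0.
have iB : mu.-integrable `]1, +oo[ (EFin \o gammai s).
  have [C C0 hC] := powR_le_expR (s - 1).
  have h2 : (0 : R) < 2^-1 by rewrite invr_gt0.
  have iE0 : mu.-integrable `]1, +oo[ (EFin \o exponential_pdf (2^-1 : R)).
    by apply: (integrableS _ _ _ (integrable_exponential_pdf h2)).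
  (* The factor 2 cancels the rate [1 / 2] in front of the exponential density. *)
  have iE : mu.-integrable `]1, +oo[
      (fun t => (2 * C)%:E * (EFin \o exponential_pdf (2^-1 : R)) t)%E.
    exact: integrableZl.
  apply: (le_integrable _ _ _ iE); [exact: measurable_itv|exact: mg|].
  move=> t; rewrite /= in_itv/= andbT => t1.
  rewrite /exponential_pdf patchE mem_set/=; last by rewrite in_itv/= andbT ltW// (lt_trans _ t1).
  rewrite lee_fin ger0_norm ?gammai_ge0//; apply: le_trans (ler_norm _).
  apply: le_trans (ler_wpM2r (expR_ge0 _) (hC t (ltW t1))) _.
  rewrite -mulrA -expRD.
  rewrite (_ : t / 2 - t = - 2^-1 * t); last by lra.
  rewrite le_eqVlt; apply/orP; left; apply/eqP; lra.
have UAB : `[0, +oo[%classic = `[0, 1]%classic `|` `]1, +oo[%classic :> set R.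
  by rewrite -itv_bndbnd_setU// bnd_simp.
have [_ fA] := integrableP _ _ _ iA; have [_ fB] := integrableP _ _ _ iB.
apply/integrableP; split; first exact: mg.
rewrite UAB ge0_integral_setU//=.
- by rewrite lte_add_pinfty.
- by apply/measurable_EFinP; apply: measurableT_comp => //; exact: measurable_gammai.
- apply/disj_setPS => t [/=]; rewrite !in_itv/= andbT => /andP[_ t1] /(le_lt_trans t1).
  by rewrite ltxx.
Qed.

Lemma gammai_integrable s : 0 < s -> mu.-integrable `]0, +oo[ (EFin \o gammai s).
Proof.
move=> s0; apply: integrableS (gammai_integrable_cy s0) => //.
by apply: subset_itvr; rewrite bnd_simp.
Qed.

Lemma Gamma_gt0 s : 0 < s -> 0 < Gamma s.
Proof.
move=> s0.
have sub t : 0 < t < 1 -> `]0, +oo[%classic t.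
  by move=> /andP[t0 _]; rewrite /= in_itv/= andbT.
have pos t : 0 < t < 1 -> 0 < gammai s t.
  by move=> /andP[t0 _]; rewrite mulr_gt0 ?powR_gt0 ?expR_gt0.
have h : 0 < Rintegral mu `]0, +oo[ (gammai s).
  apply: (Rintegral_itv_gt0 ltr01 _ sub (gammai_integrable s0) _ pos) => //.
  by move=> t _; exact: gammai_ge0.
exact: h.
Qed.

Lemma der_gammai s t : 0 < t ->
  is_derive t (1 : R) (gammai (s + 1)) (s * gammai s t - gammai (s + 1) t).
Proof.
move=> t0.
have h1 := is_derive1_powR (s + 1 - 1) t0.
have h2 := der_expR (derZ (-1) (der_id t)).
have -> : gammai (s + 1) = (fun t => powR t (s + 1 - 1) * expR (-1 * t)).
  by apply/funext => x; rewrite /gammai mulN1r.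
apply: (is_derive_eq (derM h1 h2)); rewrite /gammai !mulN1r !addrK; ring.
Qed.

(** The function [gammai (s + 1)], that is [t ^ s * exp (- t)], tends to 0 at both ends of the half
    line, so its derivative [f] has integral zero. *)
Lemma Gamma_rec s : 0 < s -> Gamma (s + 1) = s * Gamma s.
Proof.
move=> s0; have s10 : 0 < s + 1 by rewrite addr_gt0.
pose f t := s * gammai s t - gammai (s + 1) t.
have i1 : mu.-integrable `]0, +oo[ (EFin \o (fun t => s * gammai s t)).
  have -> : EFin \o (fun t => s * gammai s t) = (fun t => s%:E * (EFin \o gammai s) t)%E.
    by apply/funext => t; rewrite /= EFinM.
  by apply: integrableZl => //; exact: gammai_integrable.
have i2 := gammai_integrable s10.
have if_ : mu.-integrable `]0, +oo[ (EFin \o f).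
  have -> : EFin \o f = ((EFin \o (fun t => (s * gammai s t)%R)) \- (EFin \o gammai (s + 1)%R))%E.
    by apply/funext => t; rewrite /f /= EFinB.
  exact: integrableB.
suff : Rintegral mu `]0, +oo[ f = 0.
  rewrite /f RintegralB// RintegralZl//; last exact: gammai_integrable.
  by move=> /eqP; rewrite subr_eq0 => /eqP.
have cg e t : 0 < t -> {for t, continuous (gammai e)}.
  move=> t0; have := der_gammai (e - 1) t0; rewrite subrK; exact: der_continuous.
have cf t : 0 < t -> {for t, continuous f}.
  move=> t0; apply: (@continuousB _ _ _ (fun t => s * gammai s t)); last exact: cg.
  by apply: continuousM; [exact: cst_continuous|exact: cg].
have pos t : s <= t -> 0 < t by move=> /(lt_le_trans s0).
(* [f] changes sign only at [t = s], so each half is a one-signed improper integral. *)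
have fle0 t : s <= t -> f t <= 0.
  move=> st; rewrite /f /gammai addrK subr_le0 mulrA ler_wpM2r ?expR_ge0//.
  have <- : t * powR t (s - 1) = powR t s by rewrite mulr_powRB1// ltW// pos.
  by rewrite ler_wpM2r ?powR_ge0.
have cexp (x : R) : {for x, continuous (fun t : R => expR (- t))}.
  have c1 : continuous (fun x : R => - x) by move=> y; exact: oppr_continuous.
  exact: (cont_comp c1 (@continuous_expR R)).
have e1 : Rintegral mu `]0, s] f = gammai (s + 1) s.
  rewrite Rintegral_itv_obnd_cbnd; last first.
    by apply: integrableS if_ => //; exact: subset_itvl.
  rewrite -[RHS]subr0; apply: FTC_open => //.
  - apply: integrable_oo_cc; apply: integrableS if_ => //; exact: subset_itvl.
  - by move=> t /andP[t0 _]; exact: cf.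
  - by move=> t /andP[t0 _]; exact: der_gammai.
  - have := cvgM (powR_cvg0 s0) (cvg_at_right_filter (cexp 0)).
    have -> : gammai (s + 1) = (fun t => powR t s * expR (- t)).
      by apply/funext => t; rewrite /gammai addrK.
    by rewrite mul0r; exact.
  - by apply: cvg_at_left_filter; exact: cg.
have Fy : gammai (s + 1) t @[t --> +oo] --> (0 : R).
  have [C C0 hC] := powR_le_expR s.
  have cE : C * expR (- (t / 2)) @[t --> +oo] --> (0 : R).
    rewrite -[X in _ --> X](mulr0 C); apply: cvgMl_tmp.
    have half : t / 2 @[t --> +oo] --> (+oo : set_system R).
      by apply: gt0_cvgMly => //; exact: cvg_id.
    exact: (cvg_comp _ _ half (@cvgr_expR R)).
  apply: (squeeze_cvgr _ (cvg_cst 0) cE); near=> t.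
  rewrite gammai_ge0/= /gammai addrK.
  have t1 : 1 <= t by near: t; exact: nbhs_pinfty_ge.
  apply: le_trans (ler_wpM2r (expR_ge0 _) (hC t t1)) _.
  rewrite -mulrA -expRD (_ : t / 2 - t = - (t / 2))//; lra.
have e2 : Rintegral mu `]s, +oo[ f = - gammai (s + 1) s.
  rewrite Rintegral_itv_obnd_cbnd; last first.
    by apply: integrableS if_ => //; apply: subset_itvr; rewrite bnd_simp ltW.
  have cfs : {within `[s, +oo[, continuous f}.
    by apply: continuous_in_subspaceT => t; rewrite inE/= in_itv/= andbT => /pos; exact: cf.
  have Fs : gammai (s + 1) t @[t --> s^'+] --> gammai (s + 1) s.
    by apply: cvg_at_right_filter; exact: cg.
  have dF t : s < t -> derivable (gammai (s + 1)) t 1.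
    by move=> /ltW/pos t0; have [] := der_gammai s t0.
  have eF : {in `]s, +oo[, derive1 (gammai (s + 1)) =1 f}.
    move=> t; rewrite in_itv/= andbT => /ltW/pos t0.
    by rewrite derive1E; have [_ ->] := der_gammai s t0.
  by rewrite /Rintegral (le0_continuous_FTC2y fle0 cfs Fy Fs dF eF)/= sub0r.
have s0b : (BRight (0 : R) <= BRight s)%O by rewrite bnd_simp ltW.
have := Rintegral_itvB if_ s0b isT.
by rewrite e1 e2 => /eqP; rewrite subr_eq addNr => /eqP.
Unshelve. all: by end_near. Qed.

Lemma Gamma1 : Gamma (1 : R) = 1.
Proof.
have e : Gamma (1 : R) = Rintegral mu `]0, +oo[ (fun t => expR (- t)).
  by apply: eq_Rintegral => t _; rewrite subrr powRr0 mul1r.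
have i1 : mu.-integrable `]0, +oo[ (EFin \o (fun t : R => expR (- t))).
  have -> : EFin \o (fun t : R => expR (- t)) = EFin \o gammai 1.
    by apply/funext => t /=; rewrite /gammai subrr powRr0 mul1r.
  exact: gammai_integrable.
rewrite e Rintegral_itv_obnd_cbnd//.
have d (t : R) : is_derive t (1 : R) (fun t => - expR (- t)) (expR (- t)).
  have h := derZ (-1) (der_expR (derZ (-1) (der_id t))).
  have -> : (fun t : R => - expR (- t)) = (fun t => -1 * expR (-1 * t)).
    by apply/funext => x; rewrite !mulN1r.
  by apply: (is_derive_eq h); rewrite !mulN1r mulrN1 opprK.
have c : continuous (fun t : R => - expR (- t)) by move=> t; exact: der_continuous (d t).
have l0 : - expR (- t) @[t --> +oo] --> (0 : R).
  by rewrite -[X in _ --> X]oppr0; apply: cvgN; exact: cvgr_expR.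
have h1 (t : R) : 0 <= t -> 0 <= expR (- t) by move=> _; exact: expR_ge0.
have h2 : {within `[0, +oo[, continuous (fun t : R => expR (- t))}.
  apply: continuous_subspaceT.
  have c1 : continuous (fun x : R => - x) by move=> y; exact: oppr_continuous.
  exact: (cont_comp c1 (@continuous_expR R)).
have h3 (t : R) : 0 < t -> derivable (fun t : R => - expR (- t)) t 1 by move=> _; have [] := d t.
have h4 : - expR (- t) @[t --> 0^'+] --> - expR (- 0 : R) by apply: cvg_at_right_filter; exact: c.
have h5 : {in `]0, +oo[, derive1 (fun t : R => - expR (- t)) =1 (fun t : R => expR (- t))}.
  by move=> t _; rewrite derive1E; have [_ ->] := d t.
rewrite (Rintegral_ge0_continuous_FTC2y h1 h2 l0 h3 h4 h5).
by rewrite oppr0 expR0 opprK add0r.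
Qed.

Lemma Gamma_logconvex : logconvex (@Gamma R).
Proof.
apply: logconvex_linear => [p p1|p q t A B p1 q1 t01 A0 B0].
  by apply: Gamma_gt0; rewrite (lt_le_trans _ p1).
have p0 : 0 < p by rewrite (lt_le_trans _ p1).
have q0 : 0 < q by rewrite (lt_le_trans _ q1).
have r0 : 0 < (1 - t) * p + t * q by move: t01 => /andP[]; nra.
set K := powR A (1 - t) * powR B t.
pose g x := K * (1 - t) / A * gammai p x + K * t / B * gammai q x.
have iZ c s : 0 < s -> mu.-integrable `]0, +oo[ (EFin \o (fun x => c * gammai s x)).
  move=> s0; have -> : EFin \o (fun t => c * gammai s t) = (fun t => c%:E * (EFin \o gammai s) t)%E.
    by apply/funext => x; rewrite /= EFinM.
  by apply: integrableZl => //; exact: gammai_integrable.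
have ig : mu.-integrable `]0, +oo[ (EFin \o g).
  have -> : EFin \o g = ((EFin \o (fun x => (K * (1 - t) / A * gammai p x)%R)) \+
     (EFin \o (fun x => (K * t / B * gammai q x)%R)))%E by apply/funext => x; rewrite /= EFinD.
  by apply: integrableD => //; exact: iZ.
have -> : K * ((1 - t) * (Gamma p / A) + t * (Gamma q / B)) = Rintegral mu `]0, +oo[ g.
  rewrite RintegralD//; try exact: iZ.
  rewrite !RintegralZl//; try exact: gammai_integrable.
  by rewrite (_ : Rintegral mu `]0, +oo[ (gammai p) = Gamma p)// (_ : Rintegral mu `]0, +oo[ (gammai q) = Gamma q)//;
    move: (Gamma p) (Gamma q) => u v; ring.
have ir := gammai_integrable r0.
suff hle x : 0 < x -> gammai ((1 - t) * p + t * q) x <= g x.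
  suff : Rintegral mu `]0, +oo[ (gammai ((1 - t) * p + t * q)) <= Rintegral mu `]0, +oo[ g by [].
  apply: le_Rintegral => //.
  by move=> x; rewrite /= in_itv/= andbT; exact: hle.
move=> x0.
have -> : gammai ((1 - t) * p + t * q) x =
    powR (powR x (p - 1)) (1 - t) * powR (powR x (q - 1)) t * expR (- x).
  rewrite -!powRrM -powRD; last by rewrite (gt_eqF x0) implybT.
  by congr (powR x _ * _); ring.
have := young_scaled (powR_ge0 x (p - 1)) (powR_ge0 x (q - 1)) A0 B0 t01.
move=> /(ler_wpM2r (expR_ge0 (- x))) /le_trans; apply.
by rewrite le_eqVlt; apply/orP; left; apply/eqP; rewrite /g /gammai /K; ring.
Qed.

End GammaFunction.

Section Reweight.
Variables (R : realType) (n : nat) (a b : 'I_n -> R).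
Variables (w w' om : 'I_n -> R -> R).
Hypothesis wt : forall s, weight (a s) (b s) (w s).
Hypothesis om_cont : forall s, continuous (om s).
Hypothesis wE : forall s x, a s < x < b s -> w' s x = om s x * w s x.

Lemma cont_om_prod (l : seq 'I_n) :
  continuous (fun v : 'rV[R]_n => \prod_(s <- l) om s (v 0 s)).
Proof.
apply: cont_prod => s _.
exact: (cont_comp (@coord_continuous R _ _ 0 s) (@om_cont s)).
Qed.

(** Continuous factors may be moved between weight and integrand. This serves to raise one exponent
    by 1, where the factor is a distance to a node, and to express all [k >= 1] against the constant
    weight. *)
Lemma iterint_reweight (l : seq 'I_n) (F : 'rV[R]_n -> R) v : uniq l -> continuous F ->
  iterint a b w' l F v = iterint a b w l (fun v => (\prod_(s <- l) om s (v 0 s)) * F v) v.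
Proof.
move=> + cF; elim: l v => [|s l IH] v /=.
  by move=> _; rewrite big_nil mul1r.
move=> /andP[sl ul].
have -> : (fun v : 'rV[R]_n => \prod_(j <- s :: l) om j (v 0 j) * F v) =
    (fun v => om s (v 0 s) * (\prod_(j <- l) om j (v 0 j) * F v)).
  by apply/funext => x; rewrite big_cons mulrA.
rewrite /slice; apply: eq_Rintegral => t; rewrite inE/= in_itv/= => tab.
rewrite IH// (iterint_pull wt)//; last by apply: contM => //; exact: cont_om_prod.
by rewrite updE wE//; ring.
Qed.

Lemma iterint_gt0 (l : seq 'I_n) (F : 'rV[R]_n -> R) (v0 : 'rV[R]_n) : continuous F ->
  (forall s x, a s < x < b s -> 0 < w s x) ->
  (forall v : 'rV[R]_n, (forall s, s \in l -> a s < v 0 s < b s) ->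
     (forall s, s \notin l -> v 0 s = v0 0 s) -> 0 < F v) ->
  0 < iterint a b w l F v0.
Proof.
move=> cF wp; elim: l v0 => [|s l IH] v0 Fp /=.
  by apply: Fp => // s; rewrite in_nil.
apply: wint_gt0 => //.
- exact: (iterint_line_continuous wt).
- exact: wp.
- move=> t tab; apply: IH => v hv1 hv2; apply: Fp => r.
    rewrite inE; have [rl _|rl] := boolP (r \in l); first exact: hv1.
    by rewrite orbF => /eqP rs; rewrite hv2// rs updE.
  by rewrite inE negb_or => /andP[rs rl]; rewrite hv2// updN.
Qed.

End Reweight.

Section DixonAnderson.
Variables (R : realType) (n : nat) (lam : 'rV[R]_n.+1).
Hypothesis lamC : chamber lam.

Definition vdm (v : 'rV[R]_n) : R := \prod_(i < n) \prod_(j < n | (i < j)%N) (v 0 i - v 0 j).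

(* [rev] makes the last variable outermost, as in [iter_integral]. *)
Definition dixon (al : 'I_n.+1 -> R) : R :=
  iterint (lo lam) (hi lam) (fun=> wgt lam al) (rev (enum 'I_n)) vdm 0.

(** The sign [(-1) ^ (n(n-1)/2)] between [vdm], whose factors are positive on the box, and the
    Vandermonde determinant, whose factors have the opposite order. The same sign relates [Q_poly]
    to [Q_sym]. *)
Definition vdm_sign : R := \prod_(i < n) \prod_(j < n | (i < j)%N) (-1).

Lemma vdmE v : vdm v = vdm_sign * \det (Vandermonde n v).
Proof.
rewrite det_Vandermonde -big_split/=; apply: eq_bigr => i _.
by rewrite -big_split/=; apply: eq_bigr => j _; rewrite mulN1r opprB.
Qed.

Lemma cont_vdm : continuous vdm.
Proof.
apply: cont_prod => i _; apply: cont_prod => j _.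
by apply: contB; exact: coord_continuous.
Qed.

Lemma cont_det_Vandermonde : continuous (fun v : 'rV[R]_n => \det (Vandermonde n v)).
Proof.
under eq_fun do rewrite det_Vandermonde.
apply: cont_prod => i _; apply: cont_prod => j _.
by apply: contB; exact: coord_continuous.
Qed.

Definition in_box (v : 'rV[R]_n) := forall s, lo lam s < v 0 s < hi lam s.

Lemma in_box_lt v (i j : 'I_n) : in_box v -> (i < j)%N -> v 0 j < v 0 i.
Proof.
move=> vb ij; have /andP[li _] := vb i; have /andP[_ jh] := vb j.
apply: lt_le_trans jh _; apply: le_trans (ltW li).
by apply: chamber_le; rewrite // !inordK// ltnS// ltnW// ltn_ord.
Qed.

Lemma vdm_gt0 v : in_box v -> 0 < vdm v.
Proof.
move=> vb; apply: prodr_gt0 => i _; apply: prodr_gt0 => j ij.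
by rewrite subr_gt0; exact: in_box_lt.
Qed.

Lemma wgt_gt0 al s x : lo lam s < x < hi lam s -> 0 < wgt lam al x.
Proof.
move=> xin; apply: prodr_gt0 => r _; rewrite powR_gt0// normr_gt0.
exact: inside_neq xin.
Qed.

Lemma enum_box (v : 'rV[R]_n) : (forall s, s \in rev (enum 'I_n) -> lo lam s < v 0 s < hi lam s) -> in_box v.
Proof. by move=> h s; apply: h; rewrite mem_rev mem_enum. Qed.

Section Exponents.
Variable al : 'I_n.+1 -> R.
Hypothesis al0 : forall r, 0 < al r.
Let wt s := weight_wgt lamC al0 s.
Let S := \sum_q al q.

Lemma dixon_gt0 : 0 < dixon al.
Proof.
apply: (iterint_gt0 wt) => [|s x|v /enum_box vb _]; [exact: cont_vdm|exact: wgt_gt0|exact: vdm_gt0].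
Qed.

Lemma sum_exponents_gt0 : 0 < S.
Proof.
rewrite /S (bigD1 ord0)//= ltr_pwDl//.
by apply: sumr_ge0 => q _; exact: ltW.
Qed.

(** Up to the factor [1 / S] this polynomial times the weight is the derivative of
    [node_poly * wgt], so its integral vanishes on every interval between consecutive nodes.
    Division by the sum [S] of the exponents makes it monic of degree [n]. *)
Definition orth_poly : {poly R} :=
  \sum_q (al q / S) *: \prod_(r | r != q) ('X - (lam 0 r)%:P).

Lemma horner_orth_poly x : orth_poly.[x] = S^-1 * \sum_q al q * node_minor lam q x.
Proof.
rewrite horner_sum mulr_sumr; apply: eq_bigr => q _.
rewrite hornerZ horner_prod mulrA (mulrC S^-1); congr (_ * _).
by apply: eq_bigr => r _; rewrite hornerXsubC.
Qed.

Lemma size_minor_poly (q : 'I_n.+1) :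
  size (\prod_(r | r != q) ('X - (lam 0 r)%:P)) = n.+1.
Proof.
rewrite -big_filter size_prod_XsubC; have [e _ _ [_ ->]] := big_enumP.
by rewrite cardC1 card_ord.
Qed.

Lemma size_orth_poly : (size orth_poly <= n.+1)%N.
Proof.
apply: (leq_trans (size_sum _ _ _)); apply/bigmax_leqP => q _.
by apply: leq_trans (size_scale_leq _ _) _; rewrite size_minor_poly.
Qed.

Lemma coef_orth_poly : orth_poly`_n = 1.
Proof.
rewrite coef_sum (eq_bigr (fun q => al q / S)) => [|q _].
  by rewrite -mulr_suml divff// gt_eqF// sum_exponents_gt0.
have mon : \prod_(r | r != q) ('X - (lam 0 r)%:P) \is monic by exact: monic_prod_XsubC.
move/monicP: mon; rewrite lead_coefE size_minor_poly/= coefZ => ->.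
by rewrite mulr1.
Qed.

Lemma orth_poly_orth s :
  wint (lo lam s) (hi lam s) (wgt lam al) (fun t => orth_poly.[t]) = 0.
Proof.
have cm r : continuous (node_minor lam r) by exact: cont_node_minor.
have c1 : continuous (fun _ : R => 0 : R) by exact: contC.
have h := wgt_ibp lamC al0 s (fun t => derC t (1 : R) 1) c1.
have cs : continuous (fun t => \sum_q al q * node_minor lam q t).
  by apply: cont_sum => r _; apply: contM; [exact: contC|exact: cm].
transitivity (S^-1 * wint (lo lam s) (hi lam s) (wgt lam al)
    (fun t => \sum_q al q * node_minor lam q t)).
  by rewrite -(wintZ (wt s))//; apply: eq_wint => t _; rewrite horner_orth_poly.
rewrite -[RHS](mulr0 S^-1) -[in RHS]h; congr (_ * _); apply: eq_wint => t _.
by rewrite mulr0 addr0 mulr1.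
Qed.

Lemma iterint_det_shift x :
  iterint (lo lam) (hi lam) (fun=> wgt lam al) (rev (enum 'I_n))
    (fun v => \det (Vandermonde n v) * \prod_s (x - v 0 s)) 0 =
  orth_poly.[x] * iterint (lo lam) (hi lam) (fun=> wgt lam al) (rev (enum 'I_n))
    (fun v => \det (Vandermonde n v)) 0.
Proof.
exact: (iterint_Vandermonde_orth wt _ size_orth_poly coef_orth_poly orth_poly_orth).
Qed.

Lemma dixonE : dixon al = vdm_sign *
  iterint (lo lam) (hi lam) (fun=> wgt lam al) (rev (enum 'I_n)) (fun v => \det (Vandermonde n v)) 0.
Proof.
rewrite /dixon -(iterintZ wt); last exact: cont_det_Vandermonde.
by congr (iterint _ _ _ _ _ _); apply/funext => v; rewrite vdmE.
Qed.

(** Raising the exponent at [r] inserts the distances of all variables to node [r]. On the box their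
    product is a fixed sign times [prod (lam_r - nu_s)], so by [iterint_det_shift] the integral is
    multiplied by the value of [orth_poly] at [lam_r], where only the summand [q = r] survives. *)
Lemma dixon_succ (r : 'I_n.+1) :
  dixon (fun q => al q + (q == r)%:R) = al r / S * `|node_minor lam r (lam 0 r)| * dixon al.
Proof.
set al' := fun q => _.
have al'0 q : 0 < al' q by rewrite /al' ltr_wpDr// ler0n.
pose om (s : 'I_n) (x : R) := `|x - lam 0 r|.
have com s : continuous (om s).
  have c1 : continuous (fun x => x - lam 0 r) by apply: contB; [exact: cont_id|exact: contC].
  exact: (cont_comp c1 (@norm_continuous _ R)).
have wE s x : lo lam s < x < hi lam s -> wgt lam al' x = om s x * wgt lam al x.
  move=> xin; rewrite /wgt (bigD1 r)//= [in RHS](bigD1 r)//= mulrA; congr (_ * _).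
    have ne := inside_neq lamC r xin.
    rewrite /al' eqxx addrK /om powRB ?normr_eq0 ?ne ?implybT// powRr1//.
    by rewrite mulrCA divff ?mulr1// normr_eq0.
  by apply: eq_bigr => q /negPf qr; rewrite /al' qr addr0.
pose et : R := \prod_(s < n) (if (r <= s)%N then 1 else -1).
have bE (v : 'rV[R]_n) : in_box v -> \prod_(s <- rev (enum 'I_n)) om s (v 0 s) = et * \prod_s (lam 0 r - v 0 s).
  move=> vb; rewrite big_rev big_enum/= -big_split/=; apply: eq_bigr => s _.
  have /andP[l h] := vb s; rewrite /om; case: leqP => rs.
    by rewrite mul1r ltr0_norm ?opprB// subr_lt0 (lt_le_trans h)// hi_le.
  by rewrite mulN1r opprB gtr0_norm// subr_gt0 (le_lt_trans _ l)// le_lo.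
have cprod : continuous (fun v : 'rV[R]_n => \det (Vandermonde n v) * \prod_s (lam 0 r - v 0 s)).
  apply: contM; first exact: cont_det_Vandermonde.
  by apply: cont_prod => s _; apply: contB; [exact: contC|exact: coord_continuous].
have D' : dixon al' = et * orth_poly.[lam 0 r] * dixon al.
  rewrite dixonE /dixon (iterint_reweight wt com wE) ?rev_uniq ?enum_uniq//; last exact: cont_vdm.
  rewrite mulrA [et * _ * _]mulrAC -!mulrA -iterint_det_shift mulrA.
  rewrite -(iterintZ wt)//; apply: eq_iterint => v /enum_box vb _.
  by rewrite vdmE bE//; ring.
(* Both Dixon integrals are positive, so passing to absolute values disposes of the sign [et] and of
   the sign of the minor. *)
have -> : dixon al' = `|dixon al'|.
  rewrite gtr0_norm//; apply: (iterint_gt0 (fun s => weight_wgt lamC al'0 s)).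
  - exact: cont_vdm.
  - by move=> s x; exact: wgt_gt0.
  - by move=> v /enum_box vb _; exact: vdm_gt0.
rewrite D' !normrM (gtr0_norm dixon_gt0); congr (_ * _).
have -> : `|et| = 1.
  rewrite normr_prod big1// => s _; by case: ifP; rewrite ?normrN normr1.
rewrite mul1r horner_orth_poly (bigD1 r)//= big1 => [|q qr].
  by rewrite addr0 !normrM (gtr0_norm (al0 r)) ger0_norm ?invr_ge0 ?ltW ?sum_exponents_gt0//; ring.
by rewrite /node_minor (bigD1 r) 1?eq_sym//= subrr mul0r mulr0.
Qed.

End Exponents.

End DixonAnderson.

(** * Equal exponents: the value at [k = 1] and the recursion in [k] *)

Section DixonDiagonal.
Variables (R : realType) (n : nat) (lam : 'rV[R]_n.+1).
Hypothesis lamC : chamber lam.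
Local Notation dix k := (dixon lam (fun=> k)).

Lemma pi_poly_gt0 : 0 < pi_poly lam.
Proof.
by apply: prodr_gt0 => i _; apply: prodr_gt0 => j ij; rewrite subr_gt0; exact: lamC.
Qed.

Lemma norm_det_Vandermonde : `|\det (Vandermonde n.+1 lam)| = pi_poly lam.
Proof.
rewrite det_Vandermonde normr_prod; apply: eq_bigr => i _.
rewrite normr_prod; apply: eq_bigr => j ij.
by rewrite distrC gtr0_norm// subr_gt0; exact: lamC.
Qed.

Lemma prod_norm_node_minor :
  \prod_r `|node_minor lam r (lam 0 r)| = pi_poly lam ^+ 2.
Proof.
have -> : pi_poly lam ^+ 2 = (\prod_(i < n.+1) \prod_(j < n.+1 | (i < j)%N) (lam 0 i - lam 0 j)) *
    (\prod_(i < n.+1) \prod_(j < n.+1 | (j < i)%N) (lam 0 j - lam 0 i)).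
  rewrite expr2; congr (_ * _); rewrite [RHS](exchange_big_dep predT)//=.
rewrite -big_split/=; apply: eq_bigr => i _.
rewrite normr_prod (bigID (fun j : 'I_n.+1 => (i < j)%N))/=; congr (_ * _).
  apply: eq_big => [j|j /andP[_ ij]]; last by rewrite gtr0_norm// subr_gt0 lamC.
  by rewrite -val_eqE/= andbC; case: (ltngtP i j).
apply: eq_big => [j|j]; first by rewrite -val_eqE/=; case: (ltngtP i j).
rewrite -leqNgt => /andP[ne ji]; rewrite ltr0_norm ?opprB// subr_lt0 lamC//.
by rewrite ltn_neqAle val_eqE ne.
Qed.

Lemma wgt1 x : wgt lam (fun=> 1) x = 1.
Proof. by rewrite /wgt big1// => r _; rewrite subrr powRr0. Qed.

Lemma wint_wgt1_exp (s : 'I_n) (i : nat) :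
  wint (lo lam s) (hi lam s) (wgt lam (fun=> 1)) (fun t => t ^+ i) =
  i.+1%:R^-1 * (hi lam s ^+ i.+1 - lo lam s ^+ i.+1).
Proof.
have al0 (r : 'I_n.+1) : 0 < (1 : R) by [].
have wt := weight_wgt lamC al0 s.
have cX j : continuous (fun t : R => t ^+ j) by exact: exprn_continuous.
have it := wint_integrable wt (cX i).
pose F (t : R) := i.+1%:R^-1 * t ^+ i.+1.
have dF (t : R) : is_derive t (1 : R) F (t ^+ i * wgt lam (fun=> 1) t).
  have hX : is_derive t (1 : R) (fun t : R => t ^+ i.+1) (i.+1%:R * t ^+ i).
    apply: DeriveDef; first exact: exprn_derivable.
    by rewrite exp_derive /GRing.scale/= mulr1.
  apply: (is_derive_eq (derZ i.+1%:R^-1 hX)).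
  by rewrite wgt1 mulr1 mulrA mulVf ?mul1r// pnatr_eq0.
have cF : continuous F by apply: contM; [exact: contC|exact: cX].
transitivity (Rintegral (@lebesgue_measure R) `[lo lam s, hi lam s]
    (fun t => t ^+ i * wgt lam (fun=> 1) t)).
  rewrite /wint /Rintegral [in RHS]integral_itv_bndoo//.
  by case/integrableP: it.
have cf t : lo lam s < t < hi lam s ->
    {for t, continuous (fun t : R => t ^+ i * wgt lam (fun=> 1) t)}.
  move=> _; have -> : (fun t : R => t ^+ i * wgt lam (fun=> 1) t) = (fun t => t ^+ i).
    by apply/funext => x; rewrite wgt1 mulr1.
  exact: cX.
rewrite mulrBr; apply: (FTC_open (lo_lt_hi lamC s) (integrable_oo_cc it) cf (fun t _ => dF t)).
  by apply: cvg_at_right_filter; exact: cF.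
by apply: cvg_at_left_filter; exact: cF.
Qed.

(** Subtracting from each column of the full Vandermonde matrix the next one is multiplication by
    the unipotent matrix [L]. The row of zeroth powers becomes [(0, ..., 0, 1)], and expanding along
    it leaves the matrix of consecutive differences. *)
Lemma norm_det_consecutive :
  `|\det (\matrix_(i < n, s < n) (hi lam s ^+ i.+1 - lo lam s ^+ i.+1))| = pi_poly lam.
Proof.
rewrite -norm_det_Vandermonde.
pose L : 'M[R]_n.+1 := \matrix_(c, s) ((c == s)%:R - (c == s.+1 :> nat)%:R).
have dL : \det L = 1.
  rewrite det_trig.
    by apply: big1 => c _; rewrite mxE eqxx (ltn_eqF (ltnSn c)) subr0.
  apply/is_trig_mxP => c s cs; rewrite mxE -val_eqE/= !ltn_eqF ?subrr//.
  exact: ltnW.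
have VL p s : (Vandermonde n.+1 lam *m L) p s =
    lam 0 s ^+ p - (if (s < n)%N then lam 0 (inord s.+1) ^+ p else 0).
  rewrite mxE; under eq_bigr do rewrite !mxE mulrBr.
  rewrite sumrB; congr (_ - _).
    rewrite (bigD1 s)//= eqxx mulr1 big1 ?addr0// => c /negPf ->; by rewrite mulr0.
  case: ifP => sn.
    rewrite (bigD1 (inord s.+1))//= inordK// eqxx mulr1 big1 ?addr0// => c.
    by rewrite -val_eqE/= inordK// => /negPf ->; rewrite mulr0.
  rewrite big1// => c _; rewrite ltn_eqF ?mulr0//.
  by apply: leq_trans (ltn_ord c) _; rewrite ltnS leqNgt sn.
rewrite -[in RHS](mulr1 (\det _)) -dL -det_mulmx (expand_det_row _ ord0) (bigD1 ord_max)//=.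
rewrite big1 ?addr0 => [|s sm].
  rewrite VL ltnn subr0 expr0 mul1r /cofactor normrM normrX normrN1 expr1n mul1r.
  congr `|\det _|; apply/matrixP => i s; rewrite [RHS]mxE [RHS]mxE VL mxE.
  rewrite lift0 -widen_lift /= ltn_ord /hi /lo; congr (lam _ _ ^+ _ - _).
  by apply: val_inj; rewrite /= inordK// ltnS ltnW.
rewrite VL; case: ifP => [_|/negbT]; first by rewrite !expr0 subrr mul0r.
rewrite -leqNgt => ns; case/negP: sm; rewrite -val_eqE eqn_leq ns andbT.
by rewrite -ltnS ltn_ord.
Qed.

Lemma norm_vdm_sign : `|vdm_sign R n| = 1.
Proof.
by rewrite normr_prod big1// => i _; rewrite normr_prod big1// => j _; rewrite normrN normr1.
Qed.

(** For exponents 1 the weight is constant, and the entries of the integrated Vandermonde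
    determinant are [(hi ^ (i+1) - lo ^ (i+1)) / (i+1)]; the denominators multiply to [n!]. *)
Lemma dixon1 : dix 1 = pi_poly lam / n`!%:R.
Proof.
have al0 (r : 'I_n.+1) : 0 < (1 : R) by [].
rewrite -[LHS]gtr0_norm; last exact: dixon_gt0.
rewrite (dixonE lamC al0) normrM norm_vdm_sign mul1r.
have -> : (fun v : 'rV[R]_n => \det (Vandermonde n v)) =
   (fun v => \det (\matrix_(i < n, s < n) (v 0 s) ^+ i)).
  by apply/funext => v; congr (\det _); apply/matrixP => i s; rewrite !mxE.
rewrite (@iterint_det _ _ _ _ _ (fun s => weight_wgt lamC al0 s) (fun i t => t ^+ i)); last first.
  by move=> i; exact: exprn_continuous.
have -> : (\matrix_(i < n, s < n) wint (lo lam s) (hi lam s) (wgt lam (fun=> 1)) (fun t => t ^+ i)) =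
   diag_mx (\row_(i < n) i.+1%:R^-1) *m
     (\matrix_(i < n, s < n) (hi lam s ^+ i.+1 - lo lam s ^+ i.+1)).
  by apply/matrixP => i s; rewrite mul_diag_mx !mxE wint_wgt1_exp.
rewrite det_mulmx det_diag normrM norm_det_consecutive mulrC; congr (_ * _).
rewrite normr_prod; under eq_bigr do rewrite mxE ger0_norm ?invr_ge0 ?ler0n//.
by rewrite prodfV fact_prod natr_prod big_add1 big_mkord.
Qed.

(** The exponents are raised node by node. When [j] of them have been raised their sum is
    [(n+1) k + j], which gives the denominators, and the node still to be raised has exponent [k];
    the minors multiply to the square of [pi_poly]. *)
Lemma dixon_diag_succ k : 0 < k ->
  dix (k + 1) = pi_poly lam ^+ 2 * k ^+ n.+1 / (\prod_(j < n.+1) (n.+1%:R * k + j%:R)) * dix k.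
Proof.
move=> k0.
pose al (j : nat) (q : 'I_n.+1) : R := k + (q < j)%:R.
have al0 j q : 0 < al j q by rewrite /al ltr_wpDr// ler0n.
have sal j : (j <= n.+1)%N -> \sum_q al j q = n.+1%:R * k + j%:R.
  move=> jn; rewrite big_split/= sumr_const card_ord mulr_natl; congr (_ + _).
  rewrite -natr_sum; congr _%:R.
  rewrite (eq_bigr (fun q : 'I_n.+1 => if (q < j)%N then 1%N else 0%N)) => [|q _].
    by rewrite -big_mkcond -(big_ord_widen _ (fun=> 1%N))//= sum1_card card_ord.
  by case: ifP.
pose F (i : 'I_n.+1) := k / (n.+1%:R * k + i%:R) * `|node_minor lam i (lam 0 i)|.
have chain j : (j <= n.+1)%N ->
    dixon lam (al j) = (\prod_(i < n.+1 | (i < j)%N) F i) * dix k.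
  elim: j => [_|j IH jn].
    have -> : al 0%N = (fun=> k) by apply/funext => q; rewrite /al addr0.
    by rewrite big1 ?mul1r.
  have jo := inordK jn.
  have -> : al j.+1 = (fun q => al j q + (q == inord j)%:R).
    apply/funext => q; rewrite /al -addrA -natrD; congr (_ + _%:R).
    by rewrite -val_eqE/= jo ltnS; case: ltngtP.
  rewrite (dixon_succ lamC (al0 j)) (IH (ltnW jn)) sal ?(ltnW jn)//.
  rewrite [in RHS](bigD1 (inord j))/= ?jo// [in RHS]/F jo.
  have -> : al j (inord j) = k by rewrite /al jo ltnn addr0.
  rewrite [RHS]mulrAC -!mulrA; do 3 congr (_ * _); rewrite mulrC; congr (_ * _).
  apply: eq_bigl => i; rewrite -val_eqE/= jo ltnS.
  by case: ltngtP.
have := chain n.+1 (leqnn _).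
have -> : al n.+1 = (fun=> k + 1).
  by apply/funext => q; rewrite /al ltn_ord.
move=> ->; congr (_ * _).
rewrite (eq_bigl xpredT) => [|i]; last by rewrite ltn_ord.
rewrite /F big_split/= prod_norm_node_minor mulrC -mulrA; congr (_ * _).
by rewrite prodf_div prodr_const card_ord.
Qed.

End DixonDiagonal.

Section DixonFormula.
Variables (R : realType) (n : nat) (lam : 'rV[R]_n.+1).
Hypothesis lamC : chamber lam.
Local Notation dix k := (dixon lam (fun=> k)).

Lemma powR_prod (I : Type) (r : seq I) (f : I -> R) e : (forall i, 0 <= f i) ->
  \prod_(i <- r) powR (f i) e = powR (\prod_(i <- r) f i) e.
Proof.
move=> f0; elim: r => [|i r IH]; first by rewrite !big_nil powR1.
by rewrite !big_cons IH powRM// prodr_ge0.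
Qed.

Lemma cont_abspow e : 0 <= e -> continuous (fun y : R => powR `|y| e).
Proof.
rewrite le_eqVlt => /orP[/eqP <-|e0].
  have -> : (fun y : R => powR `|y| 0) = (fun=> 1) by apply/funext => y; rewrite powRr0.
  exact: contC.
have -> : (fun y : R => powR `|y| e) = (fun y => `|spow e y|).
  by apply/funext => y; rewrite norm_spow.
exact: (cont_comp (cont_spow e0) (@norm_continuous _ R)).
Qed.

Lemma cont_wgt_ge1 k : 1 <= k -> continuous (wgt lam (fun=> k)).
Proof.
move=> k1; apply: cont_prod => r _.
have c1 : continuous (fun x : R => x - lam 0 r) by apply: contB; [exact: cont_id|exact: contC].
have k0 : 0 <= k - 1 by rewrite subr_ge0.
exact: (cont_comp c1 (cont_abspow k0)).
Qed.

(** For [k >= 1] the weight is continuous up to the nodes, so the integrals for different [k] can be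
    taken over one common weight and compared pointwise. *)
Lemma dixon_ge1 k : 1 <= k -> dix k =
  iterint (lo lam) (hi lam) (fun=> wgt lam (fun=> 1)) (rev (enum 'I_n))
    (fun v => (\prod_(s <- rev (enum 'I_n)) wgt lam (fun=> k) (v 0 s)) * vdm v) 0.
Proof.
move=> k1; have al0 (r : 'I_n.+1) : 0 < (1 : R) by [].
have wE s x : lo lam s < x < hi lam s ->
    wgt lam (fun=> k) x = wgt lam (fun=> k) x * wgt lam (fun=> 1) x.
  by move=> _; rewrite wgt1 mulr1.
have c1 (s : 'I_n) : continuous (wgt lam (fun=> k)) by exact: cont_wgt_ge1.
rewrite /dixon (iterint_reweight (fun s => weight_wgt lamC al0 s) c1 wE) ?rev_uniq ?enum_uniq//.
exact: cont_vdm.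
Qed.

Definition gap_prod (v : 'rV[R]_n) : R := \prod_(s <- rev (enum 'I_n)) \prod_r `|v 0 s - lam 0 r|.

Lemma wgt_gap_prod k (v : 'rV[R]_n) :
  \prod_(s <- rev (enum 'I_n)) wgt lam (fun=> k) (v 0 s) = powR (gap_prod v) (k - 1).
Proof.
rewrite /wgt; under eq_bigr do rewrite powR_prod//.
by rewrite powR_prod// => s; exact: prodr_ge0.
Qed.

Lemma cont_gap k : 1 <= k -> continuous (fun v => powR (gap_prod v) (k - 1) * vdm v).
Proof.
move=> k1; apply: contM; last exact: cont_vdm.
under eq_fun do rewrite -wgt_gap_prod.
apply: cont_prod => s _.
exact: (cont_comp (@coord_continuous R _ _ 0 s) (cont_wgt_ge1 k1)).
Qed.

Lemma dixon_gap k : 1 <= k -> dix k =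
  iterint (lo lam) (hi lam) (fun=> wgt lam (fun=> 1)) (rev (enum 'I_n))
    (fun v => powR (gap_prod v) (k - 1) * vdm v) 0.
Proof.
move=> k1; rewrite dixon_ge1//; congr (iterint _ _ _ _ _ _).
by apply/funext => v; rewrite wgt_gap_prod.
Qed.

Lemma dixon_logconvex : logconvex (fun k => dix k).
Proof.
apply: logconvex_linear => [p p1|p q t A B p1 q1 t01 A0 B0].
  by apply: dixon_gt0 => // r; rewrite (lt_le_trans _ p1).
have r1 : 1 <= (1 - t) * p + t * q by move: t01 => /andP[]; nra.
have al0 (r : 'I_n.+1) : 0 < (1 : R) by [].
have wt s := weight_wgt lamC al0 s.
rewrite !dixon_gap//.
set K := powR A (1 - t) * powR B t.
have -> (x y : R) : K * ((1 - t) * (x / A) + t * (y / B)) = K * (1 - t) / A * x + K * t / B * y by ring.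
have cZ c k : 1 <= k -> continuous (fun v => c * (powR (gap_prod v) (k - 1) * vdm v)).
  by move=> k1; apply: contM; [exact: contC|exact: cont_gap].
rewrite -!(iterintZ wt)//; try exact: cont_gap.
rewrite -(iterintD wt)//; try exact: cZ.
apply: (le_iterint wt); [exact: cont_gap|apply: contD; exact: cZ|].
move=> v /enum_box vb.
have v0 := vdm_gt0 lamC vb.
have g0 : 0 < gap_prod v.
  apply: prodr_gt0 => s _; apply: prodr_gt0 => r _; rewrite normr_gt0.
  exact: inside_neq (vb s).
have -> : powR (gap_prod v) ((1 - t) * p + t * q - 1) =
    powR (powR (gap_prod v) (p - 1)) (1 - t) * powR (powR (gap_prod v) (q - 1)) t.
  rewrite -!powRrM -powRD; last by rewrite (gt_eqF g0) implybT.
  by congr (powR _ _); ring.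
have := young_scaled (powR_ge0 (gap_prod v) (p - 1)) (powR_ge0 (gap_prod v) (q - 1)) A0 B0 t01.
move=> /(ler_wpM2r (ltW v0)) /le_trans; apply.
by rewrite le_eqVlt; apply/orP; left; apply/eqP; rewrite -/K; ring.
Qed.

Lemma Gamma_shift (x : R) m : 0 < x -> Gamma (x + m%:R) = (\prod_(j < m) (x + j%:R)) * Gamma x.
Proof.
move=> x0; elim: m => [|m IH]; first by rewrite addr0 big_ord0 mul1r.
have xm : 0 < x + m%:R by apply: ltr_wpDr.
rewrite -natr1 addrA (Gamma_rec xm) IH big_ord_recr/=; ring.
Qed.

Lemma Gamma_natS m : Gamma (m.+1%:R : R) = m`!%:R.
Proof.
elim: m => [|m IH]; first by rewrite Gamma1.
by rewrite -natr1 Gamma_rec ?ltr0n// IH factS natrM.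
Qed.

(** Both sides satisfy [u (k + 1) = pi_poly ^ 2 * k ^ (n+1) * u k]: on the left the shift of [Gamma]
    by [n + 1] cancels the denominators of [dixon_diag_succ]. Both sides equal [pi_poly] at
    [k = 1]. *)
Lemma dixon_Gamma k : 0 < k ->
  dix k * Gamma (n.+1%:R * k) = Gamma k ^+ n.+1 * powR (pi_poly lam) (2 * k - 1).
Proof.
have p0 := pi_poly_gt0 lamC.
have n0 : 0 < n.+1%:R :> R by rewrite ltr0n.
apply: (@bohr_mollerup _ (fun k => dix k * Gamma (n.+1%:R * k))
  (fun k => Gamma k ^+ n.+1 * powR (pi_poly lam) (2 * k - 1)) n.+1 (pi_poly lam ^+ 2)).
- exact: exprn_gt0.
- by move=> x x0; rewrite mulr_gt0 ?dixon_gt0 ?Gamma_gt0 ?mulr_gt0.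
- by move=> x x0; rewrite mulr_gt0 ?exprn_gt0 ?Gamma_gt0 ?powR_gt0.
- move=> x x0; rewrite dixon_diag_succ// mulrDr mulr1 Gamma_shift ?mulr_gt0//.
  set P := \prod_(j < n.+1) _.
  have P0 : P != 0.
    by rewrite gt_eqF//; apply: prodr_gt0 => j _; rewrite ltr_wpDr// mulr_gt0.
  by field.
- move=> x x0; rewrite Gamma_rec// exprMn.
  have -> : 2 * (x + 1) - 1 = 2 * x - 1 + 2%:R by ring.
  rewrite powRD; last by rewrite (gt_eqF p0) implybT.
  by rewrite powR_mulrn ?(ltW p0)//; ring.
- apply: logconvexM.
  + by move=> p p1; rewrite ltW// dixon_gt0// => r; rewrite (lt_le_trans _ p1).
  + by move=> p p1; rewrite ltW// Gamma_gt0// mulr_gt0// (lt_le_trans _ p1).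
  + exact: dixon_logconvex.
  + by apply: logconvex_scale; [rewrite ler1n|exact: Gamma_logconvex].
- apply: logconvexM.
  + by move=> p p1; rewrite exprn_ge0// ltW// Gamma_gt0// (lt_le_trans _ p1).
  + by move=> p _; exact: powR_ge0.
  + apply: logconvexX; last exact: Gamma_logconvex.
    by move=> p p1; rewrite ltW// Gamma_gt0// (lt_le_trans _ p1).
  + exact: logconvex_powR.
- rewrite mulr1 dixon1// Gamma_natS Gamma1 expr1n mul1r mulr1.
  rewrite divfK ?pnatr_eq0 -?lt0n ?fact_gt0//.
  have -> : 2 - 1 = 1 :> R by ring.
  by rewrite powRr1 1?ltW.
Qed.

End DixonFormula.

(** * The right-hand side solves the Dunkl system *)

Section RationalIdentity.
Variables (R : realType) (n : nat).
Local Notation wd := (widen_ord (leqnSn n)).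

(** The polynomial [Q] up to the sign [vdm_sign], with all factors written as variable minus node.
    No order of the nodes enters, so it can be evaluated at permuted nodes; factor [s] omits node
    [s], and the last node is never omitted. *)
Definition Q_sym (mu : 'rV[R]_n.+1) (N : 'rV[R]_n) : R :=
  \prod_s node_minor mu (wd s) (N 0 s).

Variables (mu : 'rV[R]_n.+1) (N : 'rV[R]_n).
Hypothesis ne : forall s r, N 0 s - mu 0 r != 0.
Hypothesis rN : regular N.

(** The factor by which the [s]-th factor of [Q_sym] changes when node [r] is omitted instead of
    node [s]. Every reflected [Q_sym] is [Q_sym] times a product of these, almost all of them 1. *)
Let a (s : 'I_n) (r : 'I_n.+1) : R := (N 0 s - mu 0 (wd s)) / (N 0 s - mu 0 r).

Lemma node_minor_div s r : node_minor mu r (N 0 s) = node_poly mu (N 0 s) / (N 0 s - mu 0 r).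
Proof. by rewrite (node_minorE mu r) mulrAC divff ?mul1r. Qed.

Lemma a_diag s : a s (wd s) = 1. Proof. by rewrite /a divff. Qed.

Lemma node_minor_swap (i j r : 'I_n.+1) (s : 'I_n) :
  node_minor (swap_coord i j mu) r (N 0 s) =
  node_poly mu (N 0 s) / (N 0 s - mu 0 (tperm i j r)).
Proof.
have e : node_poly (swap_coord i j mu) (N 0 s) = node_poly mu (N 0 s).
  rewrite /node_poly [RHS](reindex_inj (@perm_inj _ (tperm i j))).
  by apply: eq_bigr => q _; rewrite mxE.
rewrite -e (node_minorE _ r) mxE mulrAC divff ?mul1r//.
Qed.

Lemma Q_sym_swap_nodes (i j : 'I_n.+1) :
  Q_sym (swap_coord i j mu) N = Q_sym mu N * \prod_s a s (tperm i j (wd s)).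
Proof.
rewrite -big_split; apply: eq_bigr => s _ /=.
rewrite node_minor_swap node_minor_div /a; field.
by rewrite !ne.
Qed.

Lemma Q_sym_swap_vars (i j : 'I_n) :
  Q_sym mu (swap_coord i j N) = Q_sym mu N * \prod_s a s (wd (tperm i j s)).
Proof.
rewrite /Q_sym (reindex_inj (@perm_inj _ (tperm i j))) -big_split; apply: eq_bigr => s _ /=.
rewrite mxE tpermK !node_minor_div /a; field.
by rewrite !ne.
Qed.

Lemma prod_a_swap (i j : 'I_n) : i != j ->
  \prod_s a s (wd (tperm i j s)) = a i (wd j) * a j (wd i).
Proof.
move=> ij; rewrite (bigD1 i)//= (bigD1 j)/=; last by rewrite eq_sym.
rewrite tpermL tpermR mulrA big1 ?mulr1// => s /andP[si sj].
by rewrite tpermD 1?eq_sym// a_diag.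
Qed.

Lemma wd_inj : injective wd.
Proof. by move=> i j /(congr1 val)/= h; exact: val_inj. Qed.

Lemma tperm_wd (i j s : 'I_n) : tperm (wd i) (wd j) (wd s) = wd (tperm i j s).
Proof.
by rewrite !permE /= !(inj_eq wd_inj); do 2 case: ifP => //.
Qed.

Lemma wd_neq_max (i : 'I_n) : wd i != ord_max.
Proof. by rewrite -val_eqE/= ltn_eqF. Qed.

Lemma prod_a_swap_max (i : 'I_n) :
  \prod_s a s (tperm (wd i) ord_max (wd s)) = a i ord_max.
Proof.
rewrite (bigD1 i)//= tpermL big1 ?mulr1// => s si.
rewrite tpermD ?a_diag//; last by rewrite eq_sym wd_neq_max.
by rewrite (inj_eq wd_inj) eq_sym.
Qed.

Lemma sum_pairs_recr (f : 'I_n.+1 -> 'I_n.+1 -> R) : (forall i j, f i j = f j i) ->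
  2^-1 * \sum_j \sum_(i | i != j) f i j =
  2^-1 * (\sum_(j < n) \sum_(i < n | i != j) f (wd i) (wd j)) + \sum_(i < n) f (wd i) ord_max.
Proof.
move=> fs; rewrite big_ord_recr/=.
rewrite [X in _ + X]big_mkcond big_ord_recr/= eqxx/= addr0.
have -> : \sum_(i < n) (if wd i != ord_max then f (wd i) ord_max else 0) =
    \sum_(i < n) f (wd i) ord_max.
  by apply: eq_bigr => i _; rewrite wd_neq_max.
have -> : \sum_(j < n) \sum_(i | i != wd j) f i (wd j) =
    \sum_(j < n) \sum_(i < n | i != j) f (wd i) (wd j) + \sum_(i < n) f (wd i) ord_max.
  rewrite -big_split; apply: eq_bigr => j _ /=.
  rewrite big_mkcond big_ord_recr/= eq_sym wd_neq_max fs; congr (_ + _).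
  rewrite [RHS]big_mkcond; apply: eq_bigr => i _.
  by rewrite (inj_eq wd_inj).
lra.
Qed.

Lemma sum_antisym (T : 'I_n -> 'I_n -> R) :
  (forall i j, i != j -> T i j + T j i = 0) -> \sum_j \sum_(i | i != j) T i j = 0.
Proof.
move=> h; set S := LHS.
have e : S = \sum_j \sum_(i | i != j) T j i.
  rewrite /S (exchange_big_dep predT)//=; apply: eq_bigr => j _.
  by apply: eq_bigl => i; rewrite eq_sym.
have : S + S = 0.
  rewrite {2}e -big_split big1// => j _; rewrite -big_split big1// => i ij.
  exact: h.
lra.
Qed.

(** On the left are the reflections of the nodes, with a plus sign because [(-1) ^+ w] flips, minus
    those of the variables; on the right is what the divergence leaves. After division by [Q_sym]
    the terms of the last node agree on both sides, and the rest is a sum over ordered pairs of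
    variables whose symmetrization vanishes. *)
Lemma dunkl_rational_identity :
  2^-1 * \sum_j \sum_(i | i != j) (Q_sym mu N + Q_sym (swap_coord i j mu) N)
  - \sum_(j < n) mu 0 (wd j) * (\sum_(i < n | i != j)
      (Q_sym mu N - Q_sym mu (swap_coord i j N)) / (N 0 j - N 0 i)) =
  \sum_(j < n) (\prod_(i < n | i != j) node_minor mu (wd i) (N 0 i)) *
     \sum_r node_minor mu r (N 0 j).
Proof.
set Q := Q_sym mu N.
have -> : 2^-1 * \sum_j \sum_(i | i != j) (Q + Q_sym (swap_coord i j mu) N) =
   Q * (2^-1 * (\sum_(j < n) \sum_(i < n | i != j) (1 + a i (wd j) * a j (wd i)))
    + \sum_(i < n) (1 + a i ord_max)).
  rewrite sum_pairs_recr => [|i j]; last by rewrite /swap_coord tpermC.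
  rewrite mulrDr mulrCA; congr (_ * _ + _); rewrite mulr_sumr; apply: eq_bigr => j _.
    rewrite mulr_sumr; apply: eq_bigr => i ij.
    rewrite Q_sym_swap_nodes mulrDr mulr1; congr (_ + _ * _).
    by rewrite -prod_a_swap//; apply: eq_bigr => s _; rewrite tperm_wd.
  by rewrite Q_sym_swap_nodes prod_a_swap_max mulrDr mulr1.
have -> : \sum_(j < n) mu 0 (wd j) * (\sum_(i < n | i != j)
      (Q - Q_sym mu (swap_coord i j N)) / (N 0 j - N 0 i)) =
    Q * \sum_(j < n) \sum_(i < n | i != j)
      mu 0 (wd j) * (1 - a i (wd j) * a j (wd i)) / (N 0 j - N 0 i).
  rewrite mulr_sumr; apply: eq_bigr => j _; rewrite !mulr_sumr; apply: eq_bigr => i ij.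
  by rewrite Q_sym_swap_vars -/Q prod_a_swap//; ring.
have -> : \sum_(j < n) (\prod_(i < n | i != j) node_minor mu (wd i) (N 0 i)) *
     (\sum_r node_minor mu r (N 0 j)) =
   Q * (\sum_(j < n) (1 + a j ord_max) + \sum_(j < n) \sum_(i < n | i != j) a j (wd i)).
  rewrite -big_split mulr_sumr; apply: eq_bigr => j _ /=.
  have -> : \sum_r node_minor mu r (N 0 j) =
      node_minor mu (wd j) (N 0 j) * \sum_r a j r.
    rewrite mulr_sumr; apply: eq_bigr => r _; rewrite !node_minor_div /a; field.
    by rewrite !ne.
  rewrite mulrA [X in X * _]mulrC -(bigD1 (P := predT) j)//=; congr (_ * _).
  rewrite big_ord_recr (bigD1 j)//= a_diag; ring.
rewrite -mulrBr; congr (Q * _).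
apply/eqP; rewrite -subr_eq0; apply/eqP.
rewrite mulr_sumr.
have -> (A B C D : R) : A + B - C - (B + D) = A - C - D by ring.
(* The summands do not vanish singly; each cancels against the one with [i] and [j] exchanged, which
   is an identity of rational functions in two variables and two nodes. *)
rewrite -!sumrB -[RHS](@sum_antisym (fun i j => 2^-1 * (1 + a i (wd j) * a j (wd i))
   - mu 0 (wd j) * (1 - a i (wd j) * a j (wd i)) / (N 0 j - N 0 i) - a j (wd i))).
  by apply: eq_bigr => j _; rewrite mulr_sumr -!sumrB.
move=> i j ij.
have h1 : N 0 j - N 0 i != 0 by rewrite subr_eq0 eq_sym rN.
have h2 : N 0 i - N 0 j != 0 by rewrite subr_eq0 rN.
rewrite /a; field.
by rewrite h1 h2 !ne.
Qed.

End RationalIdentity.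

(** * The integrand along a ray and its divergence terms *)

Section InnerIntegrand.
Variables (R : realType) (n : nat) (lam : 'rV[R]_n.+1) (k : R).
Hypothesis lamC : chamber lam.
Hypothesis k0 : 0 < k.
Variables (e : 'rV[R]_n -> R) (g : 'I_n -> 'rV[R]_n -> R).
Hypothesis eC1 : C1grad e g.
Local Notation wd := (widen_ord (leqnSn n)).
Local Notation J F := (iterint (lo lam) (hi lam) (fun=> wgt lam (fun=> k)) (rev (enum 'I_n)) F 0).
Let al0 (r : 'I_n.+1) : 0 < (fun=> k) r. Proof. exact: k0. Qed.
Let wt s := weight_wgt lamC al0 s.

(** The candidate solution at [t * w lam], before integration. The variables range over the box of
    [lam] for all [w] and [t], and [t] enters through [e] alone; the sign [(-1) ^+ w] makes the
    integral at [t = 0] independent of [w]. *)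
Definition integrand (w : 'S_n.+1) (t : R) (v : 'rV[R]_n) : R :=
  (-1) ^+ w * \sum_(u : 'S_n) (-1) ^+ u *
    (Q_sym (perm_act w lam) (perm_act u v) * e (t *: perm_act u v)).

Definition integrand' (w : 'S_n.+1) (t : R) (v : 'rV[R]_n) : R :=
  (-1) ^+ w * \sum_(u : 'S_n) (-1) ^+ u *
    (Q_sym (perm_act w lam) (perm_act u v) *
      \sum_j perm_act u v 0 j * g j (t *: perm_act u v)).

(* The weight times [div_term] is the derivative in [v 0 (u j)] of the weight times
   [node_poly mu (v 0 (u j)) * (\prod_(i | i != j) _) * e (t *: perm_act u v)]. *)
Definition div_term (mu : 'rV[R]_n.+1) (u : 'S_n) (j : 'I_n) (t : R) (v : 'rV[R]_n) : R :=
  (\sum_r k * node_minor mu r (v 0 (u j))) *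
     ((\prod_(i < n | i != j) node_minor mu (wd i) (v 0 (u i))) * e (t *: perm_act u v)) +
  node_poly mu (v 0 (u j)) *
     ((\prod_(i < n | i != j) node_minor mu (wd i) (v 0 (u i))) * (t * g j (t *: perm_act u v))).

Lemma cont_coordP (i : 'I_n) : continuous (fun v : 'rV[R]_n => v 0 i).
Proof. exact: coord_continuous. Qed.

Lemma cont_perm_act (T : topologicalType) (u : 'S_n) (f : T -> R) (h : T -> 'rV[R]_n) :
  continuous f -> continuous h -> continuous (fun p => f p *: perm_act u (h p)).
Proof.
move=> cf ch; apply: continuous_rV => i.
have -> : (fun p => (f p *: perm_act u (h p)) 0 i) = (fun p => f p * h p 0 (u i)).
  by apply/funext => p; rewrite !mxE.
apply: contM => //; exact: (cont_comp ch (@cont_coordP (u i))).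
Qed.

Lemma cont_minor_coord (mu : 'rV[R]_n.+1) r (i : 'I_n) :
  continuous (fun v : 'rV[R]_n => node_minor mu r (v 0 i)).
Proof. exact: (cont_comp (@cont_coordP i) (@cont_node_minor _ _ mu r)). Qed.

Lemma cont_Q_sym (mu : 'rV[R]_n.+1) (u : 'S_n) : continuous (fun v => Q_sym mu (perm_act u v)).
Proof.
have -> : (fun v => Q_sym mu (perm_act u v)) = (fun v => \prod_s node_minor mu (wd s) (v 0 (u s))).
  by apply/funext => v; apply: eq_bigr => s _; rewrite mxE.
by apply: cont_prod => s _; exact: cont_minor_coord.
Qed.

Lemma cont_integrand w : continuous (fun p : R * 'rV[R]_n => integrand w p.1 p.2).
Proof.
have [ce _ _] := eC1.
have c1 : continuous (fun p : R * 'rV[R]_n => p.1) by apply: cont_fst; exact: cont_id.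
have c2 : continuous (fun p : R * 'rV[R]_n => p.2) by apply: cont_snd; exact: cont_id.
apply: contM; first exact: contC.
apply: cont_sum => u _; apply: contM; first exact: contC.
apply: contM; first exact: (cont_comp c2 (@cont_Q_sym _ u)).
exact: (cont_comp (cont_perm_act (u := u) c1 c2) ce).
Qed.

Lemma cont_integrand' w : continuous (fun p : R * 'rV[R]_n => integrand' w p.1 p.2).
Proof.
have [_ cg _] := eC1.
have c1 : continuous (fun p : R * 'rV[R]_n => p.1) by apply: cont_fst; exact: cont_id.
have c2 : continuous (fun p : R * 'rV[R]_n => p.2) by apply: cont_snd; exact: cont_id.
apply: contM; first exact: contC.
apply: cont_sum => u _; apply: contM; first exact: contC.
apply: contM; first exact: (cont_comp c2 (@cont_Q_sym _ u)).
apply: cont_sum => j _; apply: contM; last exact: (cont_comp (cont_perm_act (u := u) c1 c2) (cg j)).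
have -> : (fun p : R * 'rV[R]_n => perm_act u p.2 0 j) = (fun p => p.2 0 (u j)).
  by apply/funext => p; rewrite mxE.
exact: (cont_comp c2 (@cont_coordP (u j))).
Qed.

Lemma der_integrand w (t : R) v :
  is_derive t (1 : R) (fun t => integrand w t v) (integrand' w t v).
Proof.
apply: derZ; apply: der_sum => u _; apply: derZ; apply: derZ.
apply: (line_derive _ eC1) => h s; exact: scalerDl.
Qed.

Lemma node_poly_perm (w : 'S_n.+1) x : node_poly (perm_act w lam) x = node_poly lam x.
Proof.
rewrite /node_poly [RHS](reindex_inj (@perm_inj _ w)).
by apply: eq_bigr => q _; rewrite mxE.
Qed.

Lemma node_minor_perm (w : 'S_n.+1) r x :
  node_minor (perm_act w lam) r x = node_minor lam (w r) x.
Proof.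
rewrite /node_minor [RHS](reindex_inj (@perm_inj _ w)).
by apply: eq_big => q; [rewrite (inj_eq perm_inj)|rewrite mxE].
Qed.

Lemma sum_node_minor_perm (w : 'S_n.+1) x :
  \sum_r k * node_minor (perm_act w lam) r x = \sum_r k * node_minor lam r x.
Proof.
rewrite [RHS](reindex_inj (@perm_inj _ w)).
by apply: eq_bigr => r _; rewrite node_minor_perm.
Qed.

Lemma cont_div_part (mu : 'rV[R]_n.+1) (u : 'S_n) j (f : 'rV[R]_n -> R) (t : R) : continuous f ->
  continuous (fun v : 'rV[R]_n => (\prod_(i < n | i != j) node_minor mu (wd i) (v 0 (u i))) *
     f (t *: perm_act u v)).
Proof.
move=> cf; apply: contM.
  by apply: cont_prod => i _; exact: cont_minor_coord.
have ct : continuous (fun _ : 'rV[R]_n => t) by exact: contC.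
exact: (cont_comp (cont_perm_act (u := u) ct (@cont_id _)) cf).
Qed.

Lemma div_term_parts (mu : 'rV[R]_n.+1) (u : 'S_n) j t :
  [/\ continuous (fun x : R => \sum_r k * node_minor mu r x),
      continuous (@node_poly R n mu),
      continuous (fun v : 'rV[R]_n => (\prod_(i < n | i != j) node_minor mu (wd i) (v 0 (u i))) *
         e (t *: perm_act u v)) &
      continuous (fun v : 'rV[R]_n => (\prod_(i < n | i != j) node_minor mu (wd i) (v 0 (u i))) *
         (t * g j (t *: perm_act u v)))].
Proof.
have [ce cg _] := eC1; split.
- by apply: cont_sum => r _; apply: contM; [exact: contC|exact: cont_node_minor].
- exact: cont_node_poly.
- exact: cont_div_part.
- have cf : continuous (fun v => t * g j v) by apply: contM; [exact: contC|exact: cg].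
  exact: (cont_div_part cf).
Qed.

Lemma cont_div_term (mu : 'rV[R]_n.+1) u j t : continuous (div_term mu u j t).
Proof.
have [c1 c2 c3 c4] := div_term_parts mu u j t.
apply: contD; apply: contM => //.
  exact: (cont_comp (@cont_coordP (u j)) c1).
exact: (cont_comp (@cont_coordP (u j)) c2).
Qed.

(** Both [node_poly] and the sum of all minors are symmetric in the nodes, so permuting them does
    not disturb the integration by parts against the weight of [lam]. The remaining product of
    minors does not involve the variable [u j]. *)
Lemma iterint_div_term (w : 'S_n.+1) u j t : J (div_term (perm_act w lam) u j t) = 0.
Proof.
have [c1 c2 c3 c4] := div_term_parts (perm_act w lam) u j t.
apply: (iterint_ibp wt (s := u j) (p := fun x => \sum_r k * node_minor (perm_act w lam) r x)
   (q := node_poly (perm_act w lam)) _ _ _ _ c1 c2 c3 c4).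
- by rewrite rev_uniq enum_uniq.
- by rewrite mem_rev mem_enum.
- move=> H H' dH cH'; rewrite -[RHS](wgt_ibp lamC al0 (u j) dH cH').
  by apply: eq_wint => x _; rewrite sum_node_minor_perm node_poly_perm.
- move=> v x.
  have pE y : \prod_(i < n | i != j) node_minor (perm_act w lam) (wd i) (upd (u j) y v 0 (u i)) =
      \prod_(i < n | i != j) node_minor (perm_act w lam) (wd i) (v 0 (u i)).
    by apply: eq_bigr => i ij; rewrite updN// (inj_eq perm_inj).
  under eq_fun do rewrite pE; rewrite pE; apply: derZ.
  have lin h s : t *: perm_act u (upd (u j) (h + s) v) =
      h *: (t *: e_ R j) + t *: perm_act u (upd (u j) s v).
    apply/rowP => i; rewrite !mxE eqxx/= (inj_eq perm_inj).
    by case: eqP => _; rewrite /=; ring.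
  have h := line_derive x eC1 lin.
  apply: (is_derive_eq h); rewrite (bigD1 j)//= big1 => [|i ij].
    by rewrite addr0 !mxE !eqxx mulr1.
  by rewrite !mxE (negPf ij) andbF mulr0 mul0r.
Qed.

End InnerIntegrand.

(** * The integral satisfies the system along rays *)

Section InnerOde.
Variables (R : realType) (n : nat) (lam : 'rV[R]_n.+1) (k : R).
Hypothesis lamC : chamber lam.
Hypothesis k0 : 0 < k.
Variables (e : 'rV[R]_n -> R) (g : 'I_n -> 'rV[R]_n -> R) (Y : 'I_n -> R).
Hypothesis eC1 : C1grad e g.
Hypothesis eT : forall j (y : 'rV[R]_n), regular y ->
  g j y + k * \sum_(i | i != j) (e y - e (swap_coord i j y)) / (y 0 j - y 0 i) = Y j * e y.
Local Notation wd := (widen_ord (leqnSn n)).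
Local Notation J F := (iterint (lo lam) (hi lam) (fun=> wgt lam (fun=> k)) (rev (enum 'I_n)) F 0).
Let al0 (r : 'I_n.+1) : 0 < (fun=> k) r. Proof. exact: k0. Qed.
Let wt s := weight_wgt lamC al0 s.

Lemma in_box_regular (v : 'rV[R]_n) : in_box lam v -> regular v.
Proof.
move=> vb i j; rewrite -val_eqE neq_ltn => /orP[ij|ji].
  by rewrite gt_eqF// (in_box_lt lamC vb).
by rewrite lt_eqF// (in_box_lt lamC vb).
Qed.

Lemma signr_tperm d (i j : 'I_d) (u : 'S_d) : i != j ->
  (-1) ^+ (tperm i j * u)%g = - (-1) ^+ u :> R.
Proof. by move=> ij; rewrite odd_permM odd_tperm ij addTb signrN. Qed.

(* The reflected values [e (t * s_ij N)] are traded for reflected polynomials by reindexing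
   the alternating sum with [u := s_ij u]. *)
Lemma alternating_reflection (mu : 'rV[R]_n.+1) t (v : 'rV[R]_n) (i j : 'I_n) : i != j ->
  \sum_(u : 'S_n) (-1) ^+ u * (Q_sym mu (perm_act u v) *
     e (t *: swap_coord i j (perm_act u v)) / (perm_act u v 0 j - perm_act u v 0 i)) =
  \sum_(u : 'S_n) (-1) ^+ u * (Q_sym mu (swap_coord i j (perm_act u v)) *
     e (t *: perm_act u v) / (perm_act u v 0 j - perm_act u v 0 i)).
Proof.
move=> ij; rewrite (reindex_inj (mulgI (tperm i j))); apply: eq_bigr => u _ /=.
rewrite signr_tperm// -!swap_perm_act.
have -> : swap_coord i j (swap_coord i j (perm_act u v)) = perm_act u v.
  by apply/rowP => l; rewrite !mxE tpermK.
set N := perm_act u v.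
have -> : swap_coord i j N 0 j = N 0 i by rewrite mxE tpermR.
have -> : swap_coord i j N 0 i = N 0 j by rewrite mxE tpermL.
by rewrite -[N 0 i - N 0 j]opprB invrN !(mulrN, mulNr, opprK).
Qed.

(** The sign of the transposition turns the difference of the two integrands into a sum of the
    polynomial and its reflection. *)
Lemma integrand_reflection (w : 'S_n.+1) t v (i j : 'I_n.+1) : i != j ->
  integrand lam e w t v - integrand lam e (tperm i j * w)%g t v =
  (-1) ^+ w * \sum_(u : 'S_n) (-1) ^+ u *
    ((Q_sym (perm_act w lam) (perm_act u v) +
      Q_sym (swap_coord i j (perm_act w lam)) (perm_act u v)) * e (t *: perm_act u v)).
Proof.
move=> ij; rewrite /integrand signr_tperm// mulNr opprK -mulrDr -big_split/=.
congr (_ * _); apply: eq_bigr => u _; rewrite -mulrDr -mulrDl.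
by rewrite swap_perm_act.
Qed.

(** The differential system fails for the integrand itself; its defect is written here pointwise as
    a sum of divergence terms. The terms are arranged so that all reflections act on [Q_sym] and
    none on [e], and [dunkl_rational_identity] closes the gap. *)
Lemma integrand_ode (w : 'S_n.+1) t v : 0 < t -> in_box lam v ->
  t * integrand' lam g w t v
  + k / 2 * \sum_(p : 'I_n.+1 * 'I_n.+1 | p.2 != p.1)
      (integrand lam e w t v - integrand lam e (tperm p.2 p.1 * w)%g t v)
  - t * ((\sum_j Y j * perm_act w lam 0 (wd j)) * integrand lam e w t v) =
  (-1) ^+ w * \sum_(u : 'S_n) (-1) ^+ u *
     \sum_j div_term k e g (perm_act w lam) u j t v.
Proof.
move=> t0 vb; set mu := perm_act w lam.
have rv := in_box_regular vb.
(* The Dunkl equation at [t * N], multiplied by [t]: this factor cancels the [t] in the denominators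
   of the reflection terms. *)
have eS (u : 'S_n) (N := perm_act u v) j :
    t * (Y j * e (t *: N)) = t * g j (t *: N) +
      k * \sum_(i | i != j) (e (t *: N) - e (t *: swap_coord i j N)) / (N 0 j - N 0 i).
  have rN : regular N by exact: regular_perm_act.
  have rtN : regular (t *: N) by apply: regularZ; rewrite ?gt_eqF.
  rewrite -(eT j rtN) mulrDr; congr (_ + _); rewrite mulrCA; congr (_ * _).
  rewrite mulr_sumr; apply: eq_bigr => i ij.
  have -> : swap_coord i j (t *: N) = t *: swap_coord i j N by apply/rowP => l; rewrite !mxE.
  have d0 : N 0 j - N 0 i != 0 by rewrite subr_eq0 eq_sym rN.
  have -> : (t *: N) 0 j - (t *: N) 0 i = t * (N 0 j - N 0 i) by rewrite !mxE mulrBr.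
  have tn : t != 0 by rewrite gt_eqF.
  by field; rewrite d0 tn.
(* The eigenvalue term: the Dunkl equation replaces [Y j * e] by [g j] and reflected values of [e],
   and [alternating_reflection] moves these reflections onto [Q_sym]. *)
have step1 : t * ((\sum_j Y j * mu 0 (wd j)) * integrand lam e w t v) =
  (-1) ^+ w * \sum_(u : 'S_n) (-1) ^+ u *
    (Q_sym mu (perm_act u v) * (\sum_j mu 0 (wd j) * (t * g j (t *: perm_act u v)))
     + k * e (t *: perm_act u v) * \sum_j mu 0 (wd j) * \sum_(i | i != j)
        (Q_sym mu (perm_act u v) - Q_sym mu (swap_coord i j (perm_act u v)))
          / (perm_act u v 0 j - perm_act u v 0 i)).
  have -> : t * ((\sum_j Y j * mu 0 (wd j)) * integrand lam e w t v) =
    (-1) ^+ w * \sum_(u : 'S_n) (-1) ^+ u * (Q_sym mu (perm_act u v) *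
       \sum_j mu 0 (wd j) * (t * (Y j * e (t *: perm_act u v)))).
    rewrite /integrand -/mu; set S := \sum_j Y j * _.
    have re (x y z T : R) : x * (y * (z * T)) = z * (x * y * T) by ring.
    rewrite re mulr_sumr; congr (_ * _); apply: eq_bigr => u _.
    have -> : \sum_j mu 0 (wd j) * (t * (Y j * e (t *: perm_act u v))) = t * S * e (t *: perm_act u v).
      by rewrite /S mulr_sumr mulr_suml; apply: eq_bigr => j _; ring.
    by rewrite mulrCA; congr (_ * _); rewrite mulrCA.
  congr (_ * _).
  pose A (u : 'S_n) : R := (-1) ^+ u * (Q_sym mu (perm_act u v) *
     (\sum_j mu 0 (wd j) * (t * g j (t *: perm_act u v)))
     + k * e (t *: perm_act u v) * \sum_j mu 0 (wd j) * \sum_(i | i != j)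
        Q_sym mu (perm_act u v) / (perm_act u v 0 j - perm_act u v 0 i)).
  transitivity (\sum_u A u - k * \sum_j mu 0 (wd j) * \sum_(i | i != j)
    \sum_(u : 'S_n) (-1) ^+ u * (Q_sym mu (perm_act u v) *
     e (t *: swap_coord i j (perm_act u v)) / (perm_act u v 0 j - perm_act u v 0 i))).
    have -> : k * \sum_j mu 0 (wd j) * \sum_(i | i != j)
       \sum_(u : 'S_n) (-1) ^+ u * (Q_sym mu (perm_act u v) *
       e (t *: swap_coord i j (perm_act u v)) / (perm_act u v 0 j - perm_act u v 0 i)) =
      \sum_(u : 'S_n) k * \sum_j mu 0 (wd j) * \sum_(i | i != j) (-1) ^+ u *
       (Q_sym mu (perm_act u v) *
       e (t *: swap_coord i j (perm_act u v)) / (perm_act u v 0 j - perm_act u v 0 i)).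
      rewrite -mulr_sumr exchange_big/=; congr (_ * _); apply: eq_bigr => j _.
      by rewrite -mulr_sumr exchange_big.
    rewrite -sumrB; apply: eq_bigr => u _; under eq_bigr do rewrite eS.
    rewrite /A [in RHS]mulrDr [LHS]mulrA.
    rewrite -[RHS]addrA; rewrite (eq_bigr (fun j => mu 0 (wd j) * (t * g j (t *: perm_act u v)) +
       mu 0 (wd j) * (k * \sum_(i | i != j) (e (t *: perm_act u v) - e (t *: swap_coord i j (perm_act u v)))
         / (perm_act u v 0 j - perm_act u v 0 i)))); last by move=> j _; rewrite mulrDr.
    rewrite big_split mulrDr -[in LHS]mulrA; congr (_ + _).
    rewrite !mulr_sumr -sumrB; apply: eq_bigr => j _.
    rewrite !mulr_sumr -sumrB; apply: eq_bigr => i ij.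
    have re (s q m E E' d : R) : s * q * (m * (k * ((E - E') * d))) =
       s * (k * E * (m * (q * d))) - k * (m * (s * (q * E' * d))) by ring.
    exact: re.
  have -> : \sum_(j < n) mu 0 (wd j) * \sum_(i | i != j)
    \sum_(u : 'S_n) (-1) ^+ u * (Q_sym mu (perm_act u v) *
     e (t *: swap_coord i j (perm_act u v)) / (perm_act u v 0 j - perm_act u v 0 i)) =
   \sum_(j < n) mu 0 (wd j) * \sum_(i | i != j)
    \sum_(u : 'S_n) (-1) ^+ u * (Q_sym mu (swap_coord i j (perm_act u v)) *
     e (t *: perm_act u v) / (perm_act u v 0 j - perm_act u v 0 i)).
    apply: eq_bigr => j _; congr (_ * _); apply: eq_bigr => i ij.
    exact: alternating_reflection.
  have -> : k * \sum_(j < n) mu 0 (wd j) * \sum_(i | i != j)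
    \sum_(u : 'S_n) (-1) ^+ u * (Q_sym mu (swap_coord i j (perm_act u v)) *
     e (t *: perm_act u v) / (perm_act u v 0 j - perm_act u v 0 i)) =
    \sum_(u : 'S_n) k * \sum_(j < n) mu 0 (wd j) * \sum_(i | i != j)
     (-1) ^+ u * (Q_sym mu (swap_coord i j (perm_act u v)) *
     e (t *: perm_act u v) / (perm_act u v 0 j - perm_act u v 0 i)).
    rewrite -mulr_sumr exchange_big/=; congr (_ * _); apply: eq_bigr => j _.
    by rewrite -mulr_sumr exchange_big.
  rewrite -sumrB; apply: eq_bigr => u _; rewrite /A !mulrDr -addrA; congr (_ + _).
  rewrite !mulr_sumr -sumrB; apply: eq_bigr => j _.
  rewrite !mulr_sumr -sumrB; apply: eq_bigr => i ij.
  have re (s q q' m E d : R) : s * (k * E * (m * (q * d))) - k * (m * (s * (q' * E * d))) =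
     s * (k * E * (m * ((q - q') * d))) by ring.
  exact: re.
(* The reflections among the rays, which permute the nodes. *)
have step2 : k / 2 * \sum_(p : 'I_n.+1 * 'I_n.+1 | p.2 != p.1)
      (integrand lam e w t v - integrand lam e (tperm p.2 p.1 * w)%g t v) =
  (-1) ^+ w * \sum_(u : 'S_n) (-1) ^+ u * (k * e (t *: perm_act u v) *
    (2^-1 * \sum_j \sum_(i | i != j) (Q_sym mu (perm_act u v) +
      Q_sym (swap_coord i j mu) (perm_act u v)))).
  rewrite (eq_bigr _ (fun p pP => integrand_reflection w t v pP)) -mulr_sumr mulrCA.
  congr (_ * _); rewrite exchange_big mulr_sumr; apply: eq_bigr => u _ /=.
  rewrite pair_big_dep/= -mulr_sumr mulrCA; congr (_ * _).
  by rewrite -mulr_suml; ring.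
rewrite step1 step2 /integrand' -/mu mulrCA -mulrDr -mulrBr; congr (_ * _).
rewrite mulr_sumr -big_split -sumrB; apply: eq_bigr => u _ /=.
rewrite mulrCA -mulrDr -mulrBr; congr (_ * _).
set N := perm_act u v.
have ne s r : N 0 s - mu 0 r != 0.
  by rewrite !mxE; apply: (inside_neq lamC); exact: (vb (u s)).
have rN : regular N by exact: regular_perm_act.
(* Since [node_poly] at [N_j] is [N_j - mu_j] times the minor missing from the product, the
   derivative part is [Q_sym * (N_j - mu_j) * t * g_j]: the part with [N_j] is [t] times the
   integrand of [integrand'], the part with [mu_j] matches [step1]. *)
have -> : \sum_j div_term k e g mu u j t v =
   k * e (t *: N) * (\sum_(j < n) (\prod_(i < n | i != j) node_minor mu (wd i) (N 0 i)) *
      \sum_r node_minor mu r (N 0 j)) +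
   Q_sym mu N * \sum_j (N 0 j - mu 0 (wd j)) * (t * g j (t *: N)).
  rewrite !mulr_sumr -big_split; apply: eq_bigr => j _ /=.
  rewrite /div_term -mulr_sumr.
  have -> : \prod_(i < n | i != j) node_minor mu (wd i) (v 0 (u i)) =
      \prod_(i < n | i != j) node_minor mu (wd i) (N 0 i).
    by apply: eq_bigr => i _; rewrite mxE.
  have -> : v 0 (u j) = N 0 j by rewrite mxE.
  have -> : Q_sym mu N = node_minor mu (wd j) (N 0 j) *
       \prod_(i < n | i != j) node_minor mu (wd i) (N 0 i).
    by rewrite /Q_sym (bigD1 j).
  rewrite (node_minorE mu (wd j)); set p := \prod_(i | _) _; ring.
rewrite -(dunkl_rational_identity ne rN).
have -> : \sum_j (N 0 j - mu 0 (wd j)) * (t * g j (t *: N)) =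
   t * (\sum_j N 0 j * g j (t *: N)) - \sum_j mu 0 (wd j) * (t * g j (t *: N)).
  by rewrite mulr_sumr -sumrB; apply: eq_bigr => j _; ring.
by ring.
Qed.

Definition inner_int (w : 'S_n.+1) (t : R) : R := J (integrand lam e w t).
Definition inner_int' (w : 'S_n.+1) (t : R) : R := J (integrand' lam g w t).

Lemma der_inner_int w (t : R) : is_derive t (1 : R) (inner_int w) (inner_int' w t).
Proof.
have d (s : R) v : is_derive s (1 : R) (integrand lam e w ^~ v) (integrand' lam g w s v).
  exact: der_integrand.
have c := cont_integrand (lam := lam) (w := w) eC1.
have c' := cont_integrand' (lam := lam) (w := w) eC1.
have h := iterint_derive wt (rev (enum 'I_n)) d c c' t 0.
exact: h.
Qed.

Lemma inner_int_ode w t : 0 < t ->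
  t * inner_int' w t =
  - (k / 2 * \sum_(p : 'I_n.+1 * 'I_n.+1 | p.2 != p.1)
       (inner_int w t - inner_int (tperm p.2 p.1 * w)%g t))
  + t * ((\sum_j Y j * perm_act w lam 0 (wd j)) * inner_int w t).
Proof.
move=> t0.
have cG u : continuous (integrand lam e u t).
  have c := cont_integrand (lam := lam) (w := u) eC1.
  exact: (section_continuous_rV (t := t) c).
have cG' : continuous (integrand' lam g w t).
  have c := cont_integrand' (lam := lam) (w := w) eC1.
  exact: (section_continuous_rV (t := t) c).
set a := \sum_j _.
have cS : continuous (fun v => \sum_(p : 'I_n.+1 * 'I_n.+1 | p.2 != p.1)
    (integrand lam e w t v - integrand lam e (tperm p.2 p.1 * w)%g t v)).
  by apply: cont_sum => p _; apply: contB; exact: cG.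
have c1 : continuous (fun v => t * integrand' lam g w t v) by apply: contM => //; exact: contC.
have c2 : continuous (fun v => k / 2 * \sum_(p : 'I_n.+1 * 'I_n.+1 | p.2 != p.1)
    (integrand lam e w t v - integrand lam e (tperm p.2 p.1 * w)%g t v)).
  by apply: contM => //; exact: contC.
have c3 : continuous (fun v => t * a * integrand lam e w t v).
  by apply: contM; [exact: contC|exact: cG].
have E : t * inner_int' w t + k / 2 * \sum_(p : 'I_n.+1 * 'I_n.+1 | p.2 != p.1)
       (inner_int w t - inner_int (tperm p.2 p.1 * w)%g t) - t * a * inner_int w t = 0.
  rewrite /inner_int /inner_int' -(iterintZ wt)//.
  under eq_bigr do rewrite -(iterintB wt)//.
  rewrite -(iterint_sum wt); last by move=> p _; apply: contB; exact: cG.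
  rewrite -!(iterintZ wt)// -(iterintD wt)// -(iterintB wt)//; last exact: contD.
  have cd u j : continuous (div_term k e g (perm_act w lam) u j t) by exact: cont_div_term.
  have cD u : continuous (fun v => \sum_j div_term k e g (perm_act w lam) u j t v).
    by apply: cont_sum => j _; exact: cd.
  transitivity (J (fun v => (-1) ^+ w * \sum_(u : 'S_n) (-1) ^+ u *
     \sum_j div_term k e g (perm_act w lam) u j t v)).
    apply: eq_iterint => v /enum_box vb _.
    by rewrite -integrand_ode// -/a -[t * a * _]mulrA.
  rewrite (iterintZ wt); last by apply: cont_sum => u _; apply: contM; [exact: contC|exact: cD].
  rewrite (iterint_sum wt); last by move=> u _; apply: contM; [exact: contC|exact: cD].
  rewrite big1 ?mulr0// => u _; rewrite (iterintZ wt)// (iterint_sum wt)//.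
  by rewrite big1 ?mulr0// => j _; exact: (iterint_div_term lamC k0 eC1).
by move: E; set s := \sum_(p | _) _; lra.
Qed.

End InnerOde.

(** * Value at the origin and conclusion *)

Section InitialValue.
Variables (R : realType) (n : nat).
Local Notation wd := (widen_ord (leqnSn n)).

Definition minor_poly (mu : 'rV[R]_n.+1) (p : 'I_n.+1) : {poly R} :=
  \prod_(q | q != p) ('X - (mu 0 q)%:P).

Lemma horner_minor_poly mu p x : (minor_poly mu p).[x] = node_minor mu p x.
Proof.
by rewrite horner_prod; apply: eq_bigr => q _; rewrite hornerXsubC.
Qed.

Lemma node_minor_eq0 (mu : 'rV[R]_n.+1) (p q : 'I_n.+1) : q != p ->
  node_minor mu p (mu 0 q) = 0.
Proof. by move=> qp; rewrite /node_minor (bigD1 q)//= subrr mul0r. Qed.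

Lemma alternating_Q_sym (mu : 'rV[R]_n.+1) (v : 'rV[R]_n) :
  \sum_(u : 'S_n) (-1) ^+ u * Q_sym mu (perm_act u v) =
  \det (\matrix_(i, s) node_minor mu (wd i) (v 0 s)).
Proof.
by apply: eq_bigr => u _; congr (_ * _); apply: eq_bigr => i _; rewrite !mxE.
Qed.

(** The Lagrange numerators [minor_poly] are evaluated at two point sets: at all nodes, where the
    matrix is diagonal, and at [v] together with the last node, where the last column has one
    nonzero entry. Both determinants are the same coefficient determinant times a Vandermonde, and
    cross-multiplying eliminates it. *)
Lemma det_node_minor (mu : 'rV[R]_n.+1) (v : 'rV[R]_n) :
  node_minor mu ord_max (mu 0 ord_max) *
    \det (\matrix_(i, s) node_minor mu (wd i) (v 0 s)) * \det (Vandermonde n.+1 mu) =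
  (\prod_p node_minor mu p (mu 0 p)) *
    (\det (Vandermonde n v) * \prod_s (mu 0 ord_max - v 0 s)).
Proof.
have sf p : (size (minor_poly mu p) <= n.+1)%N by rewrite size_minor_poly.
have Dmu := det_poly_family mu sf; have Dv := det_poly_family (snoc_row v (mu 0 ord_max)) sf.
have -> : \prod_p node_minor mu p (mu 0 p) =
    \det (\matrix_(p, c) (minor_poly mu p).[mu 0 c]).
  rewrite det_trig.
    by apply: eq_bigr => p _; rewrite mxE horner_minor_poly.
  apply/is_trig_mxP => p c pc; rewrite mxE horner_minor_poly node_minor_eq0//.
  by rewrite -val_eqE/= gtn_eqF.
rewrite Dmu -det_Vandermonde_snoc [RHS]mulrAC -Dv; congr (_ * _).
have -> : (\matrix_(p, c) (minor_poly mu p).[snoc_row v (mu 0 ord_max) 0 c]) =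
   last_col_mx (fun p s => node_minor mu p (v 0 s)) (fun p => node_minor mu p (mu 0 ord_max)).
  apply/matrixP => p c; rewrite !mxE horner_minor_poly.
  by case: unlift.
rewrite det_last_col (bigD1 ord_max)//= big1 ?addr0 => [|p pm].
  rewrite addnn -signr_odd odd_double expr0 mul1r; congr (_ * \det _).
  by apply/matrixP => i s; rewrite !mxE widen_lift.
by rewrite node_minor_eq0 ?mul0r// eq_sym.
Qed.

Lemma det_Vandermonde_perm (w : 'S_n.+1) (lam : 'rV[R]_n.+1) :
  \det (Vandermonde n.+1 (perm_act w lam)) = (-1) ^+ w * \det (Vandermonde n.+1 lam).
Proof.
have -> : Vandermonde n.+1 (perm_act w lam) = col_perm w (Vandermonde n.+1 lam).
  by apply/matrixP => i j; rewrite !mxE.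
by rewrite col_permE det_mulmx det_perm odd_permV mulrC.
Qed.

Lemma prod_node_minor (lam : 'rV[R]_n.+1) :
  \prod_p node_minor lam p (lam 0 p) = \det (Vandermonde n.+1 lam) * pi_poly lam.
Proof.
rewrite det_Vandermonde [in RHS](exchange_big_dep predT)//= -big_split/=.
apply: eq_bigr => i _; rewrite /node_minor (bigID (fun j : 'I_n.+1 => (i < j)%N))/= mulrC.
congr (_ * _); apply: eq_bigl => j; rewrite -val_eqE/= -?leqNgt; by case: ltngtP.
Qed.

(** Only the factors [lam_r - nu_s] with [r < s] are turned around, one for each pair below [n]. *)
Lemma Q_poly_sym (lam : 'rV[R]_n.+1) (v : 'rV[R]_n) :
  Q_poly lam v = vdm_sign R n * Q_sym lam v.
Proof.
rewrite /vdm_sign (exchange_big_dep predT)//= -big_split/= /Q_poly.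
rewrite big_split/= (exchange_big_dep predT)//= [X in _ * X](exchange_big_dep predT)//=.
rewrite -big_split/=; apply: eq_bigr => s _.
rewrite /node_minor [in RHS](bigID (fun r : 'I_n.+1 => (r < s)%N))/= mulrA; congr (_ * _).
  have -> : \prod_(i < n | (i < s)%N) (-1) = \prod_(i < n.+1 | (i < s)%N) (-1 : R).
    rewrite [RHS]big_mkcond big_ord_recr/= [in RHS]ltnNge ltnW ?ltn_ord//= mulr1.
    by rewrite [LHS]big_mkcond.
  rewrite [X in _ * X](eq_bigl (fun i : 'I_n.+1 => (i < s)%N)); last first.
    by move=> i; rewrite -val_eqE/=; case: ltngtP.
  by rewrite -big_split/=; apply: eq_bigr => r _; rewrite mulN1r opprB.
by apply: eq_bigl => r; rewrite -val_eqE/= -leqNgt; case: ltngtP.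
Qed.

Variables (lam : 'rV[R]_n.+1) (k : R).
Hypothesis lamC : chamber lam.
Hypothesis k0 : 0 < k.
Let al0 (r : 'I_n.+1) : 0 < (fun=> k) r. Proof. exact: k0. Qed.
Let wt s := weight_wgt lamC al0 s.

(** At [t = 0] the kernel is 1 and the alternating sum is a determinant of minors. By
    [det_node_minor] it is proportional to a Vandermonde times [prod (mu_last - nu_s)], which
    [iterint_det_shift] integrates; the sign of [w] cancels against that of the Vandermonde of the
    permuted nodes. *)
Lemma inner_int0 (e : 'rV[R]_n -> R) (w : 'S_n.+1) : e 0 = 1 ->
  vdm_sign R n * inner_int lam k e w 0 = pi_poly lam / n.+1%:R * dixon lam (fun=> k).
Proof.
move=> e0; set mu := perm_act w lam.
have Vn0 : \det (Vandermonde n.+1 lam) != 0.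
  by rewrite -normr_gt0 norm_det_Vandermonde// pi_poly_gt0.
have Pn0 : \prod_p node_minor lam p (lam 0 p) != 0.
  by rewrite prod_node_minor mulf_neq0// gt_eqF// pi_poly_gt0.
have PE : \prod_p node_minor mu p (mu 0 p) = \prod_p node_minor lam p (lam 0 p).
  rewrite [RHS](reindex_inj (@perm_inj _ w)); apply: eq_bigr => p _.
  by rewrite node_minor_perm mxE.
have Pm0 : node_minor mu ord_max (mu 0 ord_max) != 0.
  by move: Pn0; rewrite -PE => /prodf_neq0; apply.
have cd : continuous (fun v : 'rV[R]_n => \det (\matrix_(i, s) node_minor mu (wd i) (v 0 s))).
  by apply: (@cont_det_coord _ _ (fun i => node_minor mu (wd i))) => i; exact: cont_node_minor.
pose c := node_minor mu ord_max (mu 0 ord_max) * \det (Vandermonde n.+1 mu).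
have c0 : c != 0 by rewrite mulf_neq0// det_Vandermonde_perm mulf_neq0// signr_eq0.
have JE : inner_int lam k e w 0 = (-1) ^+ w *
    iterint (lo lam) (hi lam) (fun=> wgt lam (fun=> k)) (rev (enum 'I_n))
      (fun v => \det (\matrix_(i, s) node_minor mu (wd i) (v 0 s))) 0.
  rewrite -(iterintZ wt)//; congr (iterint _ _ _ _ _ _); apply/funext => v.
  rewrite /integrand -alternating_Q_sym; congr (_ * _); apply: eq_bigr => u _.
  by rewrite scale0r e0 mulr1.
(* With all exponents equal to [k] their sum is [(n+1) k], and only one minor is nonzero at the
   chosen node; this is where [1 / (n+1)] comes from. *)
have orth : (orth_poly lam (fun=> k)).[mu 0 ord_max] =
    node_minor mu ord_max (mu 0 ord_max) / n.+1%:R.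
  rewrite horner_orth_poly sumr_const card_ord -mulr_sumr mxE.
  rewrite (bigD1 (w ord_max))//= big1 ?addr0 => [|q qw]; last by rewrite node_minor_eq0// eq_sym.
  rewrite node_minor_perm -[_ *+ n.+1]mulr_natl invfM; set m := node_minor _ _ _.
  by rewrite -mulrA mulKf ?gt_eqF// mulrC.
have main := iterint_det_shift lamC al0 (mu 0 ord_max).
have cV : c * iterint (lo lam) (hi lam) (fun=> wgt lam (fun=> k)) (rev (enum 'I_n))
      (fun v => \det (\matrix_(i, s) node_minor mu (wd i) (v 0 s))) 0 =
   (\prod_p node_minor lam p (lam 0 p)) * ((orth_poly lam (fun=> k)).[mu 0 ord_max] *
     iterint (lo lam) (hi lam) (fun=> wgt lam (fun=> k)) (rev (enum 'I_n))
       (fun v => \det (Vandermonde n v)) 0).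
  rewrite -main -!(iterintZ wt)//; last first.
    apply: contM; first exact: cont_det_Vandermonde.
    by apply: cont_prod => s _; apply: contB; [exact: contC|exact: coord_continuous].
  congr (iterint _ _ _ _ _ _); apply/funext => v.
  by rewrite -PE -det_node_minor /c mulrAC.
rewrite (dixonE lamC al0) JE [RHS]mulrCA; congr (_ * _).
move: cV; rewrite /c orth prod_node_minor det_Vandermonde_perm -/mu.
set I1 := iterint _ _ _ _ _ _; set I2 := iterint _ _ _ _ _ _.
set m := node_minor _ _ _; set V := \det (Vandermonde _ _).
move=> cV.
have s1 : (-1) ^+ w * (-1) ^+ w = 1 :> R by rewrite -expr2 sqrr_sign.
apply: (mulfI (mulf_neq0 Pm0 Vn0)); rewrite -/m -/V.
have -> : m * V * ((-1) ^+ w * I1) = m * ((-1) ^+ w * V) * I1.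
  by move: ((-1) ^+ w) => s; ring.
by rewrite cV; move: (pi_poly lam) (n.+1%:R^-1) => p q; ring.
Qed.

End InitialValue.

(** * Passage to the integral of the statement *)

Section IterIntegral.
Variables (R : realType) (n : nat).
Variables (a b : 'I_n -> R) (w : 'I_n -> R -> R).
Hypothesis wt : forall s, weight (a s) (b s) (w s).
Variables (a' b' : nat -> R).
Hypothesis aE : forall s : 'I_n, a' s = a s.
Hypothesis bE : forall s : 'I_n, b' s = b s.

(** The first [m] variables remain to be integrated; the others are frozen, by substitution inside
    [F] and through [v0] on the other side. The closed intervals of [iter_integral] and the open
    ones of [wint] give the same integral. *)
Lemma iter_integral_iterint m (F : (nat -> R) -> R) (G : 'rV[R]_n -> R) (v0 : 'rV[R]_n) :
  (m <= n)%N -> continuous G ->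
  (forall v : nat -> R, (forall s : 'I_n, (s < m)%N -> a s < v s < b s) ->
     F v = G (\row_s (if (s < m)%N then v s else v0 0 s)) * \prod_(s < n | (s < m)%N) w s (v s)) ->
  iter_integral m a' b' F = iterint a b w (rev (take m (enum 'I_n))) G v0.
Proof.
elim: m F G v0 => [|m IH] F G v0 mn cG FE.
  rewrite /= take0/= FE => [|s//]; rewrite big1// mulr1; congr G.
  by apply/rowP => s; rewrite mxE.
pose j : 'I_n := Ordinal mn.
have -> : rev (take m.+1 (enum 'I_n)) = j :: rev (take m (enum 'I_n)).
  rewrite (take_nth j) ?size_enum_ord// rev_rcons; congr (_ :: _).
  by apply: ord_inj; rewrite nth_enum_ord.
rewrite /= /slice (aE j) (bE j).
have inner t : a j < t < b j ->
    iter_integral m a' b' (fun v => F (fun i => if i == m then t else v i)) =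
    iterint a b w (rev (take m (enum 'I_n))) G (upd j t v0) * w j t.
  move=> tj; rewrite mulrC -(iterintZ wt)//; apply: IH => [||v vb]; first exact: ltnW.
    by apply: contM => //; exact: contC.
  rewrite FE => [|s]; last first.
    rewrite ltnS leq_eqVlt => /orP[sm|sm]; last by rewrite ltn_eqF// vb.
    by rewrite sm; have -> : s = j by apply: val_inj; exact/eqP.
  rewrite (bigD1 j)//= eqxx mulrA [_ * w j t]mulrC; congr (_ * G _ * _).
    apply/rowP => s; rewrite !mxE -val_eqE/= ltnS leq_eqVlt.
    by case: ltngtP.
  apply: eq_big => [s|s /andP[_ sj]]; first by rewrite ltnS -val_eqE/= [RHS]ltn_neqAle andbC.
  by rewrite -val_eqE/= in sj; rewrite (negPf sj).
have cI := iterint_line_continuous wt (l := rev (take m (enum 'I_n))) (s := j) (v := v0) cG.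
have /integrableP[mI _] := wint_integrable (wt j) cI.
have eqI : {in `]a j, b j[, (fun t => iterint a b w (rev (take m (enum 'I_n))) G (upd j t v0) * w j t)
    =1 (fun t => iter_integral m a' b' (fun v => F (fun i => if i == m then t else v i)))}.
  by move=> t; rewrite in_itv/= => tj; rewrite inner.
rewrite /wint /Rintegral integral_itv_bndoo.
  by congr fine; apply: eq_integral => t; rewrite inE => tj; rewrite /= eqI.
apply: eq_measurable_fun mI => t; rewrite inE => tj /=; by rewrite eqI.
Qed.

End IterIntegral.

Section InterlacingIntegral.
Variables (R : realType) (n : nat) (lam : 'rV[R]_n.+1) (k : R).
Hypothesis lamC : chamber lam.
Hypothesis k0 : 0 < k.

(** On the box every factor of [W_base] is positive and equals the distance between a variable and a
    node; for nonnegative bases the power of the product is the product of the powers. *)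
Lemma W_k_wgt (v : 'rV[R]_n) : in_box lam v -> W_k k lam v = \prod_s wgt lam (fun=> k) (v 0 s).
Proof.
move=> vb; rewrite /W_k /wgt.
under eq_bigr do rewrite powR_prod//.
rewrite powR_prod => [|s]; last exact: prodr_ge0.
congr (powR _ _); rewrite exchange_big/=; apply: eq_bigr => r _.
rewrite [RHS](bigID (fun s : 'I_n => (r <= s)%N))/=; congr (_ * _).
  apply: eq_bigr => s rs; have /andP[_ h] := vb s.
  by rewrite ltr0_norm ?opprB// subr_lt0 (lt_le_trans h)// hi_le.
apply: eq_big => [s|s sr]; first by rewrite ltnNge.
have /andP[h _] := vb s.
by rewrite gtr0_norm// subr_gt0 (le_lt_trans _ h)// le_lo.
Qed.

Lemma iter_integral_interlacing (G : 'rV[R]_n -> R) : continuous G ->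
  iter_integral n (fun s => lam 0 (inord s.+1)) (fun s => lam 0 (inord s))
    (fun v => G (\row_(s < n) v s) * W_k k lam (\row_(s < n) v s)) =
  iterint (lo lam) (hi lam) (fun=> wgt lam (fun=> k)) (rev (enum 'I_n)) G 0.
Proof.
move=> cG; rewrite -[in RHS](take_oversize (n := n) (s := enum 'I_n)) ?size_enum_ord//.
have al0 (r : 'I_n.+1) : 0 < (fun=> k) r by exact: k0.
apply: (iter_integral_iterint (fun s => weight_wgt lamC al0 s)) => // v vb.
have vb' : in_box lam (\row_(s < n) v s) by move=> s; rewrite mxE; exact: vb.
rewrite W_k_wgt//; congr (G _ * _).
  by apply/rowP => s; rewrite !mxE ltn_ord.
by apply: eq_big => s; rewrite ?ltn_ord// mxE.
Qed.

End InterlacingIntegral.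

Section ExponentialTwist.
Variables (R : realType) (d : nat) (f : 'rV[R]_d -> R) (g : 'I_d -> 'rV[R]_d -> R) (c : R).
Let ex (y : 'rV[R]_d) := expR (- c * \sum_s y 0 s).

Lemma cont_exp_lin : continuous ex.
Proof.
have cl : continuous (fun y : 'rV[R]_d => - c * \sum_s y 0 s).
  apply: contM; first exact: contC.
  by apply: cont_sum => s _; exact: coord_continuous.
exact: (cont_comp cl (@continuous_expR R)).
Qed.

Lemma der_exp_lin (y v : 'rV[R]_d) : is_derive y v ex (ex y * (- c * \sum_s v 0 s)).
Proof.
pose l (h : R) := - c * \sum_s (h *: v + y) 0 s.
have lE h : l h = - c * (h * (\sum_s v 0 s) + \sum_s y 0 s).
  rewrite /l [h * _]mulr_sumr -big_split; congr (_ * _).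
  by apply: eq_bigr => s _; rewrite !mxE.
have dl : is_derive (0 : R) (1 : R) l (- c * \sum_s v 0 s).
  have -> : l = fun h => - c * (h * (\sum_s v 0 s) + \sum_s y 0 s) by apply/funext.
  apply: derZ; have h := derD (derM (der_id (0 : R)) (derC (0 : R) (1 : R) (\sum_s v 0 s)))
    (derC (0 : R) (1 : R) (\sum_s y 0 s)).
  by apply: (is_derive_eq h); rewrite mul1r mul0r !addr0.
have [dE vE] := der_expR dl.
have E : (fun h : R => h^-1 *: (((fun h => expR (l h)) \o shift (0 : R)) (h *: (1 : R)) - expR (l 0)))
   = (fun h : R => h^-1 *: ((ex \o shift y) (h *: v) - ex y)).
  by apply/funext => h /=; rewrite [h *: 1]mulr1 addr0 /l scale0r add0r.
have e0 : ex y = expR (l 0) by rewrite /l scale0r add0r.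
split; first by rewrite /derivable -E.
by rewrite /derive -E e0 -vE.
Qed.

Lemma C1grad_exp_lin : C1grad f g ->
  C1grad (fun y => f y * ex y) (fun j y => (g j y - c * f y) * ex y).
Proof.
move=> [cf cg df]; have ce := cont_exp_lin; split.
- exact: contM.
- move=> j; apply: contM => //; apply: contB; first exact: cg.
  by apply: contM => //; exact: contC.
- move=> y v; have h := derM (df y v) (der_exp_lin y v); apply: (is_derive_eq h).
  rewrite mulr_suml !mulr_sumr -big_split; apply: eq_bigr => j _ /=.
  by move: (ex y) (f y) (g j y) (v 0 j) => p q r s; ring.
Qed.

Lemma exp_lin_swap (i j : 'I_d) (y : 'rV[R]_d) : ex (swap_coord i j y) = ex y.
Proof.
rewrite /ex [in RHS](reindex_inj (@perm_inj _ (tperm i j))).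
by congr (expR (_ * _)); apply: eq_bigr => s _; rewrite mxE.
Qed.

End ExponentialTwist.

(** * The two solutions along rays and their comparison *)

Section InductiveFormula.
Variables (R : realType) (n : nat) (k : R).
Variables (E : 'rV[R]_n.+1 -> 'rV[R]_n.+1 -> R) (Et : 'rV[R]_n -> 'rV[R]_n -> R).
Hypothesis k0 : 0 < k.
Hypothesis EK : is_dunkl_kernel k E.
Hypothesis EtK : is_dunkl_kernel k Et.
Variables (X lam : 'rV[R]_n.+1).
Hypothesis lamC : chamber lam.
Local Notation wd := (widen_ord (leqnSn n)).
Let X' : 'rV[R]_n := \row_(i < n) X 0 (wd i).
Let xl := X 0 ord_max.
Let e (y : 'rV[R]_n) := Et X' y * expR (- xl * \sum_s y 0 s).
Let g (j : 'I_n) (y : 'rV[R]_n) :=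
  ('D_(e_ R j) (Et X') y - xl * Et X' y) * expR (- xl * \sum_s y 0 s).

Lemma twisted_C1 : C1grad e g.
Proof. by have [/real_analytic_C1 h _ _] := EtK X'; exact: C1grad_exp_lin. Qed.

(** The exponential is invariant under coordinate swaps, so it factors out of the reflection terms;
    its gradient lowers every eigenvalue by [xl]. *)
Lemma twisted_dunkl j (y : 'rV[R]_n) : regular y ->
  g j y + k * \sum_(i | i != j) (e y - e (swap_coord i j y)) / (y 0 j - y 0 i) =
  (X' 0 j - xl) * e y.
Proof.
move=> ry; have [_ /(_ j y ry) T _] := EtK X'.
set ey := expR (- xl * \sum_s y 0 s).
transitivity ((dunkl k j (Et X') y - xl * Et X' y) * ey); last by rewrite T /e -/ey; ring.
rewrite /dunkl /g -/ey [in RHS]addrAC [RHS]mulrDl; congr (_ + _).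
rewrite -mulrA; congr (_ * _); rewrite mulr_suml; apply: eq_bigr => i _.
rewrite /e (exp_lin_swap xl) -/ey -mulrBl.
by move: (Et X' y - Et X' _) ((_ - _)^-1) => p q; rewrite mulrAC.
Qed.

Let C := c_const n k / powR (pi_poly lam) (2 * k) * vdm_sign R n.
Let sl := xl * \sum_i lam 0 i.
Let I_ w t := inner_int lam k e w t.
(** The right-hand side at [t * w lam] after rescaling: the prefactor contributes only the
    exponential of [t * sl], and [C] contains [vdm_sign] because the integrand uses [Q_sym] instead
    of [Q_poly]. *)
Let Phi (w : 'S_n.+1) (t : R) := C * (expR (t * sl) * I_ w t).
Let Phi' (w : 'S_n.+1) (t : R) :=
  C * (expR (t * sl) * sl * I_ w t + expR (t * sl) * inner_int' lam k g w t).

Lemma der_rhs w (t : R) : is_derive t (1 : R) (Phi w) (Phi' w t).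
Proof.
apply: derZ; apply: derM; last exact: (der_inner_int lamC k0 twisted_C1).
apply: (is_derive_eq (der_expR (derM (der_id t) (derC t (1 : R) sl)))).
by rewrite mul1r mulr0 addr0.
Qed.

Lemma rhs_ode w t : 0 < t ->
  t * Phi' w t = - (k / 2 * \sum_(p : 'I_n.+1 * 'I_n.+1 | p.2 != p.1)
     (Phi w t - Phi (tperm p.2 p.1 * w)%g t))
  + t * ((\sum_j X 0 j * perm_act w lam 0 j) * Phi w t).
Proof.
move=> t0.
have h := inner_int_ode lamC k0 twisted_C1 twisted_dunkl w t0.
have -> : \sum_j X 0 j * perm_act w lam 0 j =
   sl + \sum_j (X' 0 j - xl) * perm_act w lam 0 (wd j).
  have -> : sl = xl * \sum_j perm_act w lam 0 j.
    by rewrite /sl (reindex_inj (@perm_inj _ w)); congr (_ * _); apply: eq_bigr => i _; rewrite mxE.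
  rewrite !big_ord_recr/= mulrDr addrAC; congr (_ + _).
  rewrite mulr_sumr -big_split; apply: eq_bigr => j _ /=.
  by rewrite [X' 0 j]mxE -mulrDl addrC subrK.
have -> : \sum_(p : 'I_n.+1 * 'I_n.+1 | p.2 != p.1) (Phi w t - Phi (tperm p.2 p.1 * w)%g t) =
   C * expR (t * sl) * \sum_(p : 'I_n.+1 * 'I_n.+1 | p.2 != p.1)
     (I_ w t - I_ (tperm p.2 p.1 * w)%g t).
  by rewrite mulr_sumr; apply: eq_bigr => p _; rewrite /Phi !mulrA -mulrBr.
rewrite /Phi /Phi'; move: h; rewrite -!/(I_ _ _).
set S := \sum_(p | _) _; set B := \sum_j _; set I' := inner_int' _ _ _ _ _; set I0 := I_ w t.
set ex := expR _ => h.
transitivity (C * ex * (t * sl * I0 + t * I')); first by ring.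
by rewrite h; ring.
Qed.

(** This normalization is what determines [c_const]: by [inner_int0] the integral is
    [pi_poly / (n+1)] times the Dixon integral, which [dixon_Gamma] evaluates. *)
Lemma rhs0 w : Phi w 0 = 1.
Proof.
have e0 : e 0 = 1.
  have [_ _ E0] := EtK X'; rewrite /e E0 mul1r big1 ?mulr0 ?expR0// => s _.
  by rewrite mxE.
rewrite /Phi mul0r expR0 mul1r /C -mulrA (inner_int0 lamC k0 _ e0).
have p0 := pi_poly_gt0 lamC.
have G0 : 0 < Gamma k by exact: Gamma_gt0.
have h := dixon_Gamma lamC k0.
have -> : powR (pi_poly lam) (2 * k) = powR (pi_poly lam) (2 * k - 1) * pi_poly lam.
  rewrite -[X in _ = _ * X]powRr1 ?ltW// -powRD ?subrK//.
  by rewrite (gt_eqF p0) implybT.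
have q0 : powR (pi_poly lam) (2 * k - 1) != 0 by rewrite gt_eqF// powR_gt0.
move: h q0; rewrite /c_const; set q := powR _ _; set D := dixon _ _; set Gn := Gamma (_ * _).
move=> h q0; have Gk0 : Gamma k ^+ n.+1 != 0 by rewrite expf_neq0// gt_eqF.
apply: (mulfI (mulf_neq0 Gk0 q0)); rewrite mulr1 -[RHS]h.
have n0 : n.+1%:R != 0 :> R by rewrite pnatr_eq0.
move: (n.+1%:R) n0 (Gamma k ^+ n.+1) Gk0 (pi_poly lam) (gt_eqF p0) => N N0 G Gn0 p /negbT pn0.
by field; rewrite N0 Gn0 pn0 q0.
Qed.

(** The difference [L w - Phi w] solves the homogeneous linear system and vanishes at 0. Only
    [w = 1] at [t = 1] is wanted, but the system couples all [w], so they are treated together. *)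
Lemma dunkl_kernel_rhs : E X lam = Phi 1%g 1.
Proof.
have rl : regular lam by move=> i j ij; exact: chamber_inj.
have [/real_analytic_C1 h T E0] := EK X.
pose L (w : 'S_n.+1) (t : R) := E X (t *: perm_act w lam).
pose L' (w : 'S_n.+1) (t : R) :=
  \sum_j perm_act w lam 0 j * 'D_(e_ R j) (E X) (t *: perm_act w lam).
have dL w (t : R) : is_derive t (1 : R) (L w) (L' w t) by exact: (ray_derive (perm_act w lam) t h).
have dLP w (t : R) : is_derive t (1 : R) (fun t => L w t - Phi w t) (L' w t - Phi' w t).
  exact: (is_deriveB (dL w t) (der_rhs w t)).
have inj (p : 'I_n.+1 * 'I_n.+1) : injective (fun w : 'S_n.+1 => (tperm p.2 p.1 * w)%g).
  exact: mulgI.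
have zero : forall w : 'S_n.+1, L w 1 - Phi w 1 = 0.
  apply: (@ode_zero R 'S_n.+1 _ (fun p : 'I_n.+1 * 'I_n.+1 => p.2 != p.1)
    (fun p w => (tperm p.2 p.1 * w)%g) inj (k / 2) (fun w => \sum_j X 0 j * perm_act w lam 0 j)
    (fun w t => L w t - Phi w t) (fun w t => L' w t - Phi' w t) _ dLP).
  - by rewrite divr_ge0// ltW.
  - move=> w t t0; rewrite mulrBr (dunkl_ray_ode w rl T t0) rhs_ode//.
    set a := \sum_j _.
    have -> : \sum_(p : 'I_n.+1 * 'I_n.+1 | p.2 != p.1)
       (L w t - Phi w t - (L (tperm p.2 p.1 * w)%g t - Phi (tperm p.2 p.1 * w)%g t)) =
      \sum_(p : 'I_n.+1 * 'I_n.+1 | p.2 != p.1) (L w t - L (tperm p.2 p.1 * w)%g t) -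
      \sum_(p : 'I_n.+1 * 'I_n.+1 | p.2 != p.1) (Phi w t - Phi (tperm p.2 p.1 * w)%g t).
      rewrite -sumrB; apply: eq_bigr => p _.
      by move: (L w t) (L _ t) (Phi w t) (Phi _ t) => x y z u; ring.
    rewrite -/(L w t); set S1 := \sum_(p | _) _; set S2 := \sum_(p | _) _.
    by move: (L w t) (Phi w t) => x y; ring.
  - by move=> w; rewrite /L scale0r E0 rhs0 subrr.
have := zero 1%g; rewrite /L scale1r => /eqP; rewrite subr_eq0 => /eqP <-.
by congr (E X _); apply/rowP => i; rewrite mxE perm1.
Qed.

End InductiveFormula.

Theorem theorem1p1 (R : realType) (n : nat) (k : R)
  (E : 'rV[R]_n.+1 -> 'rV[R]_n.+1 -> R) (Et : 'rV[R]_n -> 'rV[R]_n -> R) :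
  (1 <= n)%N -> 0 < k ->
  is_dunkl_kernel k E -> is_dunkl_kernel k Et ->
  forall (X lam : 'rV[R]_n.+1), chamber lam ->
  let X' : 'rV[R]_n := \row_(i < n) X 0 (widen_ord (leqnSn n) i) in
  let xl := X 0 ord_max in
  E X lam =
    c_const n k * expR (xl * \sum_(i < n.+1) lam 0 i) / powR (pi_poly lam) (2 * k) *
    iter_integral n (fun s => lam 0 (inord s.+1)) (fun s => lam 0 (inord s))
      (fun v => let nu : 'rV[R]_n := \row_(s < n) v s in
         (\sum_(w : 'S_n) (-1) ^+ odd_perm w * Q_poly lam (perm_act w nu) *
             Et X' (perm_act w nu))
         * expR (- xl * \sum_(s < n) nu 0 s) * W_k k lam nu).
Proof.
move=> _ k0 EK EtK X lam lamC X' xl.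
rewrite (dunkl_kernel_rhs k0 EK EtK X lamC) mul1r -/X' -/xl.
pose e (y : 'rV[R]_n) := Et X' y * expR (- xl * \sum_s y 0 s).
(* The summand of the statement without [W_k]: for [w = 1], [t = 1] the twisted kernel absorbs the
   exponential, whose exponent is the same at [nu] and at all its permutations. *)
pose G (v : 'rV[R]_n) := vdm_sign R n * integrand lam e 1%g 1 v.
have eC1 := twisted_C1 EtK X.
have cI := cont_integrand (lam := lam) (w := 1%g) eC1.
have cI1 := section_continuous_rV (t := 1) cI.
have cG : continuous G by apply: contM; [exact: contC|exact: cI1].
have al0 (r : 'I_n.+1) : 0 < (fun=> k) r by exact: k0.
have -> : (fun v : nat -> R => let nu : 'rV[R]_n := \row_(s < n) v s in
         (\sum_(w : 'S_n) (-1) ^+ odd_perm w * Q_poly lam (perm_act w nu) *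
             Et X' (perm_act w nu))
         * expR (- xl * \sum_(s < n) nu 0 s) * W_k k lam nu) =
    (fun v => G (\row_(s < n) v s) * W_k k lam (\row_(s < n) v s)).
  apply/funext => v /=; set nu := \row_s _; congr (_ * _).
  rewrite /G /integrand odd_perm1 expr0 mul1r mulr_suml [RHS]mulr_sumr; apply: eq_bigr => w _.
  have -> : perm_act 1 lam = lam by apply/rowP => i; rewrite mxE perm1.
  rewrite scale1r Q_poly_sym /e.
  have -> : \sum_s perm_act w nu 0 s = \sum_s nu 0 s.
    by rewrite [RHS](reindex_inj (@perm_inj _ w)); apply: eq_bigr => s _; rewrite mxE.
  move: ((-1) ^+ w) (vdm_sign R n) (Q_sym _ _) (Et _ _) (expR _) => p q r s u.
  by ring.
rewrite (iter_integral_interlacing lamC k0 cG) /G.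
rewrite (iterintZ (fun s => weight_wgt lamC al0 s))// -/(inner_int lam k e 1%g 1).
move: (inner_int _ _ _ _ _) (vdm_sign R n) (expR _) (powR _ _) (c_const n k) => p q r s u.
by rewrite -!mulrA; congr (_ * _); ring.
Qed.
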